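(* Let $k_1,k_2>0$. Suppose that $(u^1,u^2,w^1,w^2)(x,t)\in\left[C^1([0,\infty);C^3[0,L])\right]^4$ solves the PDE system (P), and, for each $N\in\mathbb N$ with $h=\frac L{N+1}$, let $\{(u^1,u^2,w^1,w^2)_j(t)\}_{j=0}^{N+1}$ solve the semi-discrete system (S) (both systems are given in the context). Then the corresponding error functions $\{(\theta^1,\theta^2,\eta^1,\eta^2)_j(t)\}_{j=0}^{N+1}$ satisfy the error system (R) of the context. Assume that the initial conditions in (S) are exact (i.e. they are the nodal values at $x_j$ of the initial data of (P)) and that the initial discretized energy $E_h^{\rm ORFD}(0)$ converges to the energy $E(0)$ of the PDE model as $h\to0$. Then there is a positive constant $c(k_1,k_2)$, independent of $h$ and $t$, such that $$\left|E_h^{\rm ORFD}(t)-E(t)\right|\le\left|E_h^{\rm ORFD}(0)-E(0)\right|+c(k_1,k_2)\,h^{3/2}\sqrt t,\qquad t\ge0.$$ Consequently, the energy converges in the uniform norm: $$\lim_{h\to0}\|E_h^{\rm ORFD}(t)-E(t)\|_{C[0,\infty]}=0,$$ i.e. $\sup_{t\ge0}|E_h^{\rm ORFD}(t)-E(t)|\to0$ as $h\to0$.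
   Context: Let $L>0$ and let $\rho,\mu,\alpha,\beta,\gamma$ be positive constants with $\alpha_1:=\alpha-\gamma^2\beta>0$. A dot denotes the time derivative. System (P), on $(0,L)\times(0,\infty)$: $$\begin{cases}\rho\dot w^1-\alpha u^1_x+\gamma\beta u^2_x=0,\quad \mu\dot w^2-\beta u^2_x+\gamma\beta u^1_x=0,\\ \dot u^1-w^1_x=0,\quad \dot u^2-w^2_x=0,\\ w^1(0,t)=w^2(0,t)=0,\\ \alpha u^1(L,t)-\gamma\beta u^2(L,t)=-k_1w^1(L,t),\\ \beta u^2(L,t)-\gamma\beta u^1(L,t)=-k_2w^2(L,t),\\ (u^1,w^1,u^2,w^2)(x,0)=\left(\tfrac{d v_0}{dx},v_1,\tfrac{d p_0}{dx},p_1\right)(x).\end{cases}$$ (It is the first-order form of a piezoelectric beam system with $u^1=v_x$, $u^2=p_x$, $w^1=\dot v$, $w^2=\dot p$.) Its energy is $$E(t)=\frac12\int_0^L\left\{\rho|w^1|^2+\mu|w^2|^2+\alpha|u^1|^2-2\gamma\beta u^1u^2+\beta|u^2|^2\right\}dx.$$ For $N\in\mathbb N$ let $h=\frac L{N+1}$, $x_j=jh$ ($j=0,\dots,N+1$). For a grid function $(U_j)_{j=0}^{N+1}$ write $U_{j+\frac12}:=\frac{U_j+U_{j+1}}2$, $\delta_x[U_{j+\frac12}]:=\frac{U_{j+1}-U_j}h$ for $j=0,\dots,N$. System (S), for grid functions $u^1_j(t),u^2_j(t),w^1_j(t),w^2_j(t)$: $$\begin{cases}\dot u^1_{j+\frac12}-\delta_x[w^1_{j+\frac12}]=0,\quad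 \dot u^2_{j+\frac12}-\delta_x[w^2_{j+\frac12}]=0,\\ \rho\,\dot w^1_{j+\frac12}-\alpha\,\delta_x[u^1_{j+\frac12}]+\gamma\beta\,\delta_x[u^2_{j+\frac12}]=0,\\ \mu\,\dot w^2_{j+\frac12}-\beta\,\delta_x[u^2_{j+\frac12}]+\gamma\beta\,\delta_x[u^1_{j+\frac12}]=0,& j=0,\dots,N,\\ w^1_0=w^2_0=0,\\ \alpha u^1_{N+1}-\gamma\beta u^2_{N+1}=-k_1w^1_{N+1},\\ \beta u^2_{N+1}-\gamma\beta u^1_{N+1}=-k_2w^2_{N+1},\end{cases}$$ with initial data equal to the nodal values at $x_j$ of the initial data of (P). Its energy is $$E_h^{\rm ORFD}(t):=\frac h2\sum_{j=0}^N\left(\rho|w^1_{j+\frac12}|^2+\mu|w^2_{j+\frac12}|^2+\beta|\gamma u^1_{j+\frac12}-u^2_{j+\frac12}|^2+\alpha_1|u^1_{j+\frac12}|^2\right).$$ Let $U^k_j(t):=u^k(x_j,t)$, $W^k_j(t):=w^k(x_j,t)$ ($k=1,2$) be the nodal values of the solution of (P), and define the residuals, for $j=0,\dots,N$, by $$\begin{aligned}r^k_{j+\frac12}&:=\dot U^k_{j+\frac12}-\delta_x[W^k_{j+\frac12}],\quad k=1,2,\\ s^1_{j+\frac12}&:=\rho\dot W^1_{j+\frac12}-\alpha\delta_x[U^1_{j+\frac12}]+\gamma\beta\delta_x[U^2_{j+\frac12}],\\ s^2_{j+\frac12}&:=\mu\dot W^2_{j+\frac12}-\beta\delta_x[U^2_{j+\frac12}]+\gamma\beta\delta_x[U^1_{j+\frac12}].\end{aligned}$$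 The error functions are $\theta^k_j(t):=U^k_j(t)-u^k_j(t)$ and $\eta^k_j(t):=W^k_j(t)-w^k_j(t)$, $k=1,2$, where $u^k_j,w^k_j$ solve (S). Error system (R): $$\begin{cases}\rho\dot\eta^1_{j+\frac12}-\alpha\delta_x[\theta^1_{j+\frac12}]+\gamma\beta\delta_x[\theta^2_{j+\frac12}]=s^1_{j+\frac12}(t),\\ \mu\dot\eta^2_{j+\frac12}-\beta\delta_x[\theta^2_{j+\frac12}]+\gamma\beta\delta_x[\theta^1_{j+\frac12}]=s^2_{j+\frac12}(t),\\ \dot\theta^1_{j+\frac12}-\delta_x[\eta^1_{j+\frac12}]=r^1_{j+\frac12}(t),\quad \dot\theta^2_{j+\frac12}-\delta_x[\eta^2_{j+\frac12}]=r^2_{j+\frac12}(t),& j=0,\dots,N,\\ \eta^1_0=\eta^2_0=0,\quad \alpha\theta^1_{N+1}-\gamma\beta\theta^2_{N+1}=-k_1\eta^1_{N+1},\\ \beta\theta^2_{N+1}-\gamma\beta\theta^1_{N+1}=-k_2\eta^2_{N+1},\\ (\theta^1_j,\theta^2_j,\eta^1_j,\eta^2_j)(0)=\bm 0,& j=0,\dots,N+1.\end{cases}$$ *)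

(* Defs.v *)
From Stdlib Require Import Reals.
From Coquelicot Require Import Coquelicot.
Open Scope R_scope.

(** ** Derivatives relative to a set, and the spaces C^k(D) and C^1([0,oo); C^k(D)) *)

(** Derivative of the restriction of [f] to [D]; one-sided at an endpoint of an
    interval [D].  Values of [f] outside [D] play no role at a point of [D]. *)
Definition is_derive_on (D : R -> Prop) (f : R -> R) (x l : R) : Prop :=
  filterdiff f (within D (locally x)) (fun y : R => scal y l).

Definition ex_derive_on (D : R -> Prop) (f : R -> R) (x : R) : Prop :=
  exists l : R, is_derive_on D f x l.

Definition Derive_on (D : R -> Prop) (f : R -> R) (x : R) : R :=
  iota (fun l : R => is_derive_on D f x l).

Fixpoint Derive_n_on (D : R -> Prop) (f : R -> R) (n : nat) : R -> R :=
  match n with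
  | O => f
  | S m => Derive_on D (Derive_n_on D f m)
  end.

Definition class_C (k : nat) (D : R -> Prop) (f : R -> R) : Prop :=
  (forall (i : nat) (x : R), (i < k)%nat -> D x ->
     ex_derive_on D (Derive_n_on D f i) x) /\
  (forall i : nat, (i <= k)%nat -> continuous_on D (Derive_n_on D f i)).

Definition sup_norm (D : R -> Prop) (f : R -> R) : Rbar :=
  Lub_Rbar (fun y : R => exists x : R, D x /\ y = Rabs (f x)).

(** Meaningful on [class_C k D] for [D] compact, where the suprema are finite. *)
Definition C_norm (k : nat) (D : R -> Prop) (f : R -> R) : R :=
  sum_f_R0 (fun i : nat => real (sup_norm D (Derive_n_on D f i))) k.

Definition nonneg_time (t : R) : Prop := 0 <= t.

Definition segment (L x : R) : Prop := 0 <= x <= L.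

(** [f t] is the element of C^k(D) at time [t], and [g] is the time derivative of
    [f]: limits of difference quotients and continuity are in the norm of C^k(D). *)
Definition C1_time_C_space (k : nat) (D : R -> Prop) (f : R -> R -> R) : Prop :=
  exists g : R -> R -> R,
    (forall t : R, 0 <= t -> class_C k D (f t) /\ class_C k D (g t)) /\
    (forall t : R, 0 <= t ->
       filterlim
         (fun s : R => C_norm k D (fun x => (f s x - f t x) / (s - t) - g t x))
         (within nonneg_time (locally' t)) (locally 0)) /\
    (forall t : R, 0 <= t ->
       filterlim (fun s : R => C_norm k D (fun x => g s x - g t x))
         (within nonneg_time (locally t)) (locally 0)).

(** ** The beam *)

Record params : Type := Params {
  L : R; rho : R; mu : R; alpha : R; beta : R; gamma : R; k1 : R; k2 : R
}.

Definition alpha1 (p : params) : R := alpha p - gamma p ^ 2 * beta p.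

(** The unknowns: [T := R -> R -> R] (arguments [x], [t]) for the PDE and
    [T := nat -> R -> R] (arguments [j], [t]) for grid functions. *)
Record fields (T : Type) : Type := Fields { u1 : T; u2 : T; w1 : T; w2 : T }.
Arguments Fields {T} _ _ _ _.
Arguments u1 {T} _.
Arguments u2 {T} _.
Arguments w1 {T} _.
Arguments w2 {T} _.

Definition regular (p : params) (y : fields (R -> R -> R)) : Prop :=
  let C1C3 f := C1_time_C_space 3 (segment (L p)) (fun t x => f x t) in
  C1C3 (u1 y) /\ C1C3 (u2 y) /\ C1C3 (w1 y) /\ C1C3 (w2 y).

Definition solves_PDE (p : params) (v0 v1 p0 p1 : R -> R)
    (y : fields (R -> R -> R)) : Prop :=
  (forall x t : R, 0 < x < L p -> 0 < t ->
     rho p * Derive (fun s => w1 y x s) t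
       - alpha p * Derive (fun z => u1 y z t) x
       + gamma p * beta p * Derive (fun z => u2 y z t) x = 0 /\
     mu p * Derive (fun s => w2 y x s) t
       - beta p * Derive (fun z => u2 y z t) x
       + gamma p * beta p * Derive (fun z => u1 y z t) x = 0 /\
     Derive (fun s => u1 y x s) t - Derive (fun z => w1 y z t) x = 0 /\
     Derive (fun s => u2 y x s) t - Derive (fun z => w2 y z t) x = 0) /\
  (forall t : R, 0 < t ->
     w1 y 0 t = 0 /\ w2 y 0 t = 0 /\
     alpha p * u1 y (L p) t - gamma p * beta p * u2 y (L p) t
       = - k1 p * w1 y (L p) t /\
     beta p * u2 y (L p) t - gamma p * beta p * u1 y (L p) t
       = - k2 p * w2 y (L p) t) /\
  (forall x : R, segment (L p) x ->
     is_derive_on (segment (L p)) v0 x (u1 y x 0) /\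
     w1 y x 0 = v1 x /\
     is_derive_on (segment (L p)) p0 x (u2 y x 0) /\
     w2 y x 0 = p1 x).

Definition energy (p : params) (y : fields (R -> R -> R)) (t : R) : R :=
  / 2 * RInt (fun x =>
      rho p * Rabs (w1 y x t) ^ 2 + mu p * Rabs (w2 y x t) ^ 2
      + alpha p * Rabs (u1 y x t) ^ 2
      - 2 * gamma p * beta p * u1 y x t * u2 y x t
      + beta p * Rabs (u2 y x t) ^ 2) 0 (L p).

(** ** The order-reduced finite difference scheme *)

Definition mesh (p : params) (N : nat) : R := L p / INR (S N).

Definition node (p : params) (N j : nat) : R := INR j * mesh p N.

(** [half U j] is U_{j+1/2} and [delta h U j] is delta_x[U_{j+1/2}]. *)
Definition half (U : nat -> R -> R) (j : nat) (t : R) : R :=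
  (U j t + U (S j) t) / 2.

Definition delta (h : R) (U : nat -> R -> R) (j : nat) (t : R) : R :=
  (U (S j) t - U j t) / h.

Definition Dt (f : R -> R) (t : R) : R := Derive_on nonneg_time f t.

(** Left-hand sides of the scheme at x_{j+1/2}.  They vanish on a discrete
    solution; on the nodal values of the PDE solution [defect_u1], [defect_u2],
    [defect_w1], [defect_w2] are the residuals r^1, r^2, s^1, s^2. *)
Definition defect_u1 (p : params) (N : nat) (z : fields (nat -> R -> R))
    (j : nat) (t : R) : R :=
  Dt (half (u1 z) j) t - delta (mesh p N) (w1 z) j t.

Definition defect_u2 (p : params) (N : nat) (z : fields (nat -> R -> R))
    (j : nat) (t : R) : R :=
  Dt (half (u2 z) j) t - delta (mesh p N) (w2 z) j t.

Definition defect_w1 (p : params) (N : nat) (z : fields (nat -> R -> R))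
    (j : nat) (t : R) : R :=
  rho p * Dt (half (w1 z) j) t
  - alpha p * delta (mesh p N) (u1 z) j t
  + gamma p * beta p * delta (mesh p N) (u2 z) j t.

Definition defect_w2 (p : params) (N : nat) (z : fields (nat -> R -> R))
    (j : nat) (t : R) : R :=
  mu p * Dt (half (w2 z) j) t
  - beta p * delta (mesh p N) (u2 z) j t
  + gamma p * beta p * delta (mesh p N) (u1 z) j t.

Definition grid_differentiable (N : nat) (z : fields (nat -> R -> R)) : Prop :=
  forall (j : nat) (t : R), (j <= S N)%nat -> 0 <= t ->
    ex_derive_on nonneg_time (u1 z j) t /\ ex_derive_on nonneg_time (u2 z j) t /\
    ex_derive_on nonneg_time (w1 z j) t /\ ex_derive_on nonneg_time (w2 z j) t.

Definition grid_boundary (p : params) (N : nat) (z : fields (nat -> R -> R))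
    : Prop :=
  forall t : R, 0 <= t ->
    w1 z 0%nat t = 0 /\ w2 z 0%nat t = 0 /\
    alpha p * u1 z (S N) t - gamma p * beta p * u2 z (S N) t
      = - k1 p * w1 z (S N) t /\
    beta p * u2 z (S N) t - gamma p * beta p * u1 z (S N) t
      = - k2 p * w2 z (S N) t.

Definition solves_scheme (p : params) (v0 v1 p0 p1 : R -> R) (N : nat)
    (z : fields (nat -> R -> R)) : Prop :=
  grid_differentiable N z /\
  (forall (j : nat) (t : R), (j <= N)%nat -> 0 <= t ->
     defect_u1 p N z j t = 0 /\ defect_u2 p N z j t = 0 /\
     defect_w1 p N z j t = 0 /\ defect_w2 p N z j t = 0) /\
  grid_boundary p N z /\
  (forall j : nat, (j <= S N)%nat ->
     u1 z j 0 = Derive_on (segment (L p)) v0 (node p N j) /\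
     w1 z j 0 = v1 (node p N j) /\
     u2 z j 0 = Derive_on (segment (L p)) p0 (node p N j) /\
     w2 z j 0 = p1 (node p N j)).

Definition energy_ORFD (p : params) (N : nat) (z : fields (nat -> R -> R))
    (t : R) : R :=
  mesh p N / 2 * sum_f_R0 (fun j =>
      rho p * Rabs (half (w1 z) j t) ^ 2 + mu p * Rabs (half (w2 z) j t) ^ 2
      + beta p * Rabs (gamma p * half (u1 z) j t - half (u2 z) j t) ^ 2
      + alpha1 p * Rabs (half (u1 z) j t) ^ 2) N.

(** ** Error functions *)

Definition nodal (p : params) (N : nat) (y : fields (R -> R -> R))
    : fields (nat -> R -> R) :=
  Fields (fun j t => u1 y (node p N j) t) (fun j t => u2 y (node p N j) t)
         (fun j t => w1 y (node p N j) t) (fun j t => w2 y (node p N j) t).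

(** theta^1, theta^2 are the [u1], [u2] components of [grid_minus Y z] with [Y] the
    nodal values, and eta^1, eta^2 its [w1], [w2] components. *)
Definition grid_minus (Y z : fields (nat -> R -> R)) : fields (nat -> R -> R) :=
  Fields (fun j t => u1 Y j t - u1 z j t) (fun j t => u2 Y j t - u2 z j t)
         (fun j t => w1 Y j t - w1 z j t) (fun j t => w2 Y j t - w2 z j t).

(** The error system for [e], with right-hand sides the residuals of [Y]. *)
Definition solves_error_system (p : params) (N : nat)
    (Y e : fields (nat -> R -> R)) : Prop :=
  grid_differentiable N e /\
  (forall (j : nat) (t : R), (j <= N)%nat -> 0 <= t ->
     defect_w1 p N e j t = defect_w1 p N Y j t /\
     defect_w2 p N e j t = defect_w2 p N Y j t /\
     defect_u1 p N e j t = defect_u1 p N Y j t /\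
     defect_u2 p N e j t = defect_u2 p N Y j t) /\
  grid_boundary p N e /\
  (forall j : nat, (j <= S N)%nat ->
     u1 e j 0 = 0 /\ u2 e j 0 = 0 /\ w1 e j 0 = 0 /\ w2 e j 0 = 0).

(* Main.v *)
Require Import Defs.
From Stdlib Require Import Reals Lra Lia.
From Coquelicot Require Import Coquelicot.
Open Scope R_scope.

(** The system is a linear wave equation [y_t = B y_x] whose boundary feedback makes it
    exponentially stable: the multiplier [x] turns the energy into a strict Lyapunov
    functional.  Time derivatives of solutions are solutions, so the energy of [y_ttt]
    decays exponentially; since [y_x] is a multiple of [y_t], this controls the third
    space derivatives, hence, by the trapezoid rule, the residuals, whose discrete norm
    is [O(h^2 exp(- omega t / 2))].  The discrete energy identity and Gronwall then give an
    error energy [O(h^4)], together with a bound on the boundary dissipation of the error.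
    Both energies decrease at their boundary dissipation rates, whose difference is
    estimated by [|a^2 - b^2| <= lambda a^2 + (1 / lambda + 1) (a - b)^2] with
    [lambda = h^2 sqrt(min(t, 1))]. This yields [O(h^2 sqrt(min(t, 1)))], which is
    both the bound [O(h^(3/2) sqrt t)] and the uniform one. *)

(** No decay of the scheme, uniform in h, has to be proved: on the discrete side only the exact
    energy identity enters, and all long-time information comes from the exponentially small
    residuals of the exact solution. In the Gronwall step Young's inequality is used with the
    time-dependent weight exp(- omega t / 2); its integral over the half line is finite, so the
    Gronwall factor stays bounded in t. The hypothesis provides one time derivative with values in
    C^3, so y_ttt is not given. It is obtained by trading time for space: y_ttt = B^2 y_xxt. The
    decay of its energy needs one more derivative, y_tttt = B^3 y_xxxt, which uses up exactly the
    three space derivatives available. The parameter lambda has to depend on t: a fixed lambda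
    leaves a term lambda E(0), which does not vanish as t tends to 0. *)

(** * Derivatives relative to a set *)

(** For x in D the filter [within D (locally x)] is proper, so x is its only limit and the
    quantification over limits inside [filterdiff] collapses to x. *)
Lemma is_derive_on_eps (D : R -> Prop) (f : R -> R) (x l : R) :
  D x ->
  (is_derive_on D f x l <->
   forall eps : posreal, exists d : posreal, forall y, D y -> Rabs (y - x) < d ->
     Rabs (f y - f x - (y - x) * l) <= eps * Rabs (y - x)).
Proof.
  intros Dx; split.
  - intros [_ H] eps.
    assert (Hx : is_filter_lim (within D (locally x)) x).
    { intros P [d HP]; exists d; intros y Hy _; now apply HP. }
    destruct (H x Hx eps) as [d Hd].
    exists d; intros y Dy Hy; exact (Hd y Hy Dy).
  - intros H; split.
    + apply (is_linear_scal_l (K := R_AbsRing) l).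
    + intros x' Hx' eps.
      assert (PF : ProperFilter' (within D (locally x))).
      { constructor.
        - intros [d HP]; exact (HP x (ball_center x d) Dx).
        - apply within_filter, locally_filter. }
      assert (E : x' = x).
      { apply (is_filter_lim_unique (F := within D (locally x))); trivial.
        intros P [d HP]; exists d; intros y Hy _; now apply HP. }
      subst x'.
      destruct (H eps) as [d Hd]; exists d; intros y Hy Dy; exact (Hd y Dy Hy).
Qed.

(** At an isolated point of D every number is a derivative, so [Derive_on] is determined only at
    limit points. *)
Definition limit_point (D : R -> Prop) (x : R) : Prop :=
  forall d : posreal, exists y, D y /\ y <> x /\ Rabs (y - x) < d.

Lemma is_derive_on_unique (D : R -> Prop) (f : R -> R) (x l1 l2 : R) :
  D x -> limit_point D x ->
  is_derive_on D f x l1 -> is_derive_on D f x l2 -> l1 = l2.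
Proof.
  intros Dx Acc H1 H2.
  rewrite is_derive_on_eps in H1, H2 by exact Dx.
  destruct (Req_dec l1 l2) as [|Hne]; trivial; exfalso.
  assert (He : 0 < Rabs (l1 - l2) / 4).
  { assert (0 < Rabs (l1 - l2)) by (apply Rabs_pos_lt; lra); lra. }
  destruct (H1 (mkposreal _ He)) as [d1 Hd1].
  destruct (H2 (mkposreal _ He)) as [d2 Hd2]; simpl in *.
  assert (Hd : 0 < Rmin d1 d2) by (apply Rmin_pos; apply cond_pos).
  destruct (Acc (mkposreal _ Hd)) as [y [Dy [Hyx Hy]]]; simpl in Hy.
  specialize (Hd1 y Dy (Rlt_le_trans _ _ _ Hy (Rmin_l _ _))).
  specialize (Hd2 y Dy (Rlt_le_trans _ _ _ Hy (Rmin_r _ _))).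
  assert (Hp : 0 < Rabs (y - x)) by (apply Rabs_pos_lt; lra).
  assert (H : Rabs ((y - x) * (l1 - l2)) <= Rabs (l1 - l2) / 2 * Rabs (y - x)).
  { replace ((y - x) * (l1 - l2)) with
      ((f y - f x - (y - x) * l2) - (f y - f x - (y - x) * l1)) by ring.
    unfold Rminus at 1; eapply Rle_trans; [apply Rabs_triang|].
    rewrite Rabs_Ropp; lra. }
  rewrite Rabs_mult in H.
  assert (0 < Rabs (l1 - l2)) by lra. nra.
Qed.

Lemma Derive_on_unique (D : R -> Prop) (f : R -> R) (x l : R) :
  D x -> limit_point D x -> is_derive_on D f x l -> Derive_on D f x = l.
Proof.
  intros Dx Acc H.
  apply (iota_unique (V := R_CompleteNormedModule)); trivial.
  intros y Hy; exact (is_derive_on_unique D f x y l Dx Acc Hy H).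
Qed.

Lemma Derive_on_correct (D : R -> Prop) (f : R -> R) (x : R) :
  D x -> limit_point D x -> ex_derive_on D f x ->
  is_derive_on D f x (Derive_on D f x).
Proof.
  intros Dx Acc [l H]; now rewrite (Derive_on_unique D f x l).
Qed.

(** Three terms are what the quotient (f s - f t) / (s - t) - g t requires; shorter combinations are
    padded with a zero coefficient. Agreement of h with the combination is asked on D only, since
    values outside D are arbitrary. *)
Lemma is_derive_on_lin3 (D : R -> Prop) (f g k h : R -> R) (a b c x lf lg lk : R) :
  D x -> (forall y, D y -> h y = a * f y + b * g y + c * k y) ->
  is_derive_on D f x lf -> is_derive_on D g x lg -> is_derive_on D k x lk ->
  is_derive_on D h x (a * lf + b * lg + c * lk).
Proof.
  intros Dx Hh Hf Hg Hk.
  rewrite is_derive_on_eps in * by exact Dx.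
  intros eps.
  pose proof (Rabs_pos a) as Pa; pose proof (Rabs_pos b) as Pb; pose proof (Rabs_pos c) as Pc.
  set (M := Rabs a + Rabs b + Rabs c + 1).
  assert (He : 0 < eps / M).
  { apply Rdiv_lt_0_compat; [apply cond_pos | unfold M; lra]. }
  destruct (Hf (mkposreal _ He)) as [d1 H1].
  destruct (Hg (mkposreal _ He)) as [d2 H2].
  destruct (Hk (mkposreal _ He)) as [d3 H3]; simpl in *.
  assert (Hd : 0 < Rmin d1 (Rmin d2 d3)).
  { repeat apply Rmin_pos; apply cond_pos. }
  exists (mkposreal _ Hd); simpl; intros y Dy Hy.
  specialize (H1 y Dy (Rlt_le_trans _ _ _ Hy (Rmin_l _ _))).
  specialize (H2 y Dy (Rlt_le_trans _ _ _ Hy (Rle_trans _ _ _ (Rmin_r _ _) (Rmin_l _ _)))).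
  specialize (H3 y Dy (Rlt_le_trans _ _ _ Hy (Rle_trans _ _ _ (Rmin_r _ _) (Rmin_r _ _)))).
  rewrite (Hh y Dy), (Hh x Dx).
  set (A := f y - f x - (y - x) * lf) in *.
  set (B := g y - g x - (y - x) * lg) in *.
  set (C := k y - k x - (y - x) * lk) in *.
  replace (_ - _ - _) with (a * A + b * B + c * C) by (unfold A, B, C; ring).
  eapply Rle_trans; [apply Rabs_triang|].
  eapply Rle_trans; [apply Rplus_le_compat_r, Rabs_triang|].
  rewrite !Rabs_mult.
  set (q := eps / M * Rabs (y - x)) in *.
  assert (Hq : 0 <= q).
  { unfold q; apply Rmult_le_pos; [lra | apply Rabs_pos]. }
  replace (eps * Rabs (y - x)) with (M * q) by (unfold q; field; unfold M; lra).
  pose proof (Rmult_le_compat_l _ _ _ Pa H1).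
  pose proof (Rmult_le_compat_l _ _ _ Pb H2).
  pose proof (Rmult_le_compat_l _ _ _ Pc H3).
  unfold M; lra.
Qed.

Lemma is_derive_on_interior (D : R -> Prop) (f : R -> R) (x l : R) :
  locally x D -> is_derive_on D f x l -> is_derive f x l.
Proof.
  intros [d0 HD] H.
  assert (Dx : D x) by (apply HD, ball_center).
  rewrite is_derive_on_eps in H by exact Dx.
  split; [apply is_linear_scal_l|].
  intros x' Hx'.
  assert (E : x' = x).
  { apply (is_filter_lim_unique (F := locally x)); trivial.
    intros P HP; exact HP. }
  subst x'; intros eps; destruct (H eps) as [d Hd].
  assert (Hm : 0 < Rmin d0 d) by (apply Rmin_pos; apply cond_pos).
  exists (mkposreal _ Hm); intros y Hy.
  apply Hd; [apply HD|]; (eapply Rlt_le_trans; [exact Hy|]);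
    [apply Rmin_l | apply Rmin_r].
Qed.

Lemma limit_point_segment (l x : R) : 0 < l -> segment l x -> limit_point (segment l) x.
Proof.
  intros Hl [H0 H1] d; pose proof (cond_pos d) as Hd.
  destruct (Rlt_le_dec x l) as [Hx|Hx].
  - exists (Rmin l (x + d / 2)).
    unfold Rmin, segment; destruct (Rle_dec l (x + d / 2));
      (split; [lra | split; [lra | apply Rabs_lt_between; lra]]).
  - exists (Rmax 0 (x - d / 2)).
    unfold Rmax, segment; destruct (Rle_dec 0 (x - d / 2));
      (split; [lra | split; [lra | apply Rabs_lt_between; lra]]).
Qed.

Lemma limit_point_nonneg_time (t : R) : nonneg_time t -> limit_point nonneg_time t.
Proof.
  intros Ht d; pose proof (cond_pos d); unfold nonneg_time in *.
  exists (t + d / 2); split; [lra | split; [lra | apply Rabs_lt_between; lra]].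
Qed.

Lemma locally_segment (l x : R) : 0 < x < l -> locally x (segment l).
Proof.
  intros Hx.
  assert (Hd : 0 < Rmin x (l - x)) by (apply Rmin_pos; lra).
  exists (mkposreal _ Hd); intros y Hy.
  apply Rabs_lt_between in Hy; simpl in Hy; unfold minus, plus, opp in Hy; simpl in Hy.
  pose proof (Rmin_l x (l - x)); pose proof (Rmin_r x (l - x)).
  unfold segment; lra.
Qed.

Lemma locally_nonneg_time (t : R) : 0 < t -> locally t nonneg_time.
Proof.
  intros Ht; exists (mkposreal _ Ht); intros y Hy.
  apply Rabs_lt_between in Hy; simpl in Hy; unfold minus, plus, opp in Hy; simpl in Hy.
  unfold nonneg_time; lra.
Qed.

(** * Norms of C^k on a segment *)

Lemma continuous_on_eps (D : R -> Prop) (f : R -> R) (x : R) :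
  continuous_on D f -> D x ->
  forall eps : posreal, exists d : posreal, forall y, D y -> Rabs (y - x) < d ->
    Rabs (f y - f x) < eps.
Proof.
  intros H Dx eps.
  destruct (H x Dx (ball (f x) eps) (locally_ball _ _)) as [d Hd].
  exists d; intros y Dy Hy; exact (Hd y Hy Dy).
Qed.

Definition clamp (l x : R) : R := Rmax 0 (Rmin l x).

Lemma clamp_segment (l x : R) : 0 <= l -> segment l (clamp l x).
Proof.
  intros; unfold segment, clamp, Rmax, Rmin.
  destruct (Rle_dec l x); destruct (Rle_dec 0 _); lra.
Qed.

Lemma clamp_id (l x : R) : segment l x -> clamp l x = x.
Proof.
  unfold segment, clamp, Rmax, Rmin; intros.
  destruct (Rle_dec l x); destruct (Rle_dec 0 _); lra.
Qed.

Lemma clamp_lipschitz (l x y : R) : 0 <= l -> Rabs (clamp l y - clamp l x) <= Rabs (y - x).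
Proof.
  intros; unfold clamp, Rmin.
  destruct (Rle_dec l x); destruct (Rle_dec l y); unfold Rmax;
  repeat match goal with
    | |- context [Rle_dec ?a ?b] => destruct (Rle_dec a b)
    end; unfold Rabs; repeat destruct (Rcase_abs _); lra.
Qed.

Lemma Rmax0_lipschitz (x y : R) : Rabs (Rmax 0 y - Rmax 0 x) <= Rabs (y - x).
Proof.
  unfold Rmax.
  repeat match goal with
    | |- context [Rle_dec ?a ?b] => destruct (Rle_dec a b)
    end; unfold Rabs; repeat destruct (Rcase_abs _); lra.
Qed.

Lemma continuous_on_segment_bounded (l : R) (f : R -> R) :
  0 <= l -> continuous_on (segment l) f ->
  exists M, forall x, segment l x -> Rabs (f x) <= M.
Proof.
  intros Hl H.
  destruct (continuity_ab_maj (fun x => Rabs (f (clamp l x))) 0 l Hl) as [m [Hm _]].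
  - intros c _; apply (continuity_pt_comp (fun x => f (clamp l x)) Rabs);
      [|apply Rcontinuity_abs].
    apply continuity_pt_filterlim, filterlim_locally; intros eps.
    destruct (continuous_on_eps _ _ _ H (clamp_segment l c Hl) eps) as [d Hd].
    exists d; intros y Hy; apply Hd; [now apply clamp_segment|].
    eapply Rle_lt_trans; [now apply clamp_lipschitz | exact Hy].
  - exists (Rabs (f (clamp l m))); intros x Hx.
    specialize (Hm x Hx); simpl in Hm; now rewrite clamp_id in Hm by exact Hx.
Qed.

(** [real] sends an infinite supremum to 0, so a finite bound M is required before the supremum can
    dominate anything. *)
Lemma Rabs_le_sup_norm (D : R -> Prop) (f : R -> R) (x M : R) :
  (forall x, D x -> Rabs (f x) <= M) -> D x ->
  Rabs (f x) <= real (sup_norm D f).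
Proof.
  intros HM Dx.
  destruct (Lub_Rbar_correct (fun y => exists x, D x /\ y = Rabs (f x))) as [Hub Hlub].
  fold (sup_norm D f) in Hub, Hlub.
  specialize (Hlub (Finite M)).
  assert (H1 : Rbar_le (Rabs (f x)) (sup_norm D f)) by (apply Hub; now exists x).
  assert (H2 : Rbar_le (sup_norm D f) M).
  { apply Hlub; intros y [x' [Dx' ->]]; now apply HM. }
  destruct (sup_norm D f); simpl in *; tauto.
Qed.

(** Turns convergence in the norm of C^k into convergence of each derivative, uniform in x. *)
Lemma Rabs_Derive_n_on_le_C_norm (k i : nat) (l x : R) (f : R -> R) :
  0 <= l -> class_C k (segment l) f -> (i <= k)%nat -> segment l x ->
  Rabs (Derive_n_on (segment l) f i x) <= C_norm k (segment l) f.
Proof.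
  intros Hl [_ Hc] Hi Hx.
  set (N := fun i => real (sup_norm (segment l) (Derive_n_on (segment l) f i))).
  assert (HN : forall j, (j <= k)%nat -> forall x, segment l x ->
            Rabs (Derive_n_on (segment l) f j x) <= N j).
  { intros j Hj x' Hx'.
    destruct (continuous_on_segment_bounded l _ Hl (Hc j Hj)) as [M HM].
    apply Rabs_le_sup_norm with M; trivial. }
  apply Rle_trans with (N i); [now apply HN|].
  change (N i <= sum_f_R0 N k).
  assert (Hpos : forall j, (j <= k)%nat -> 0 <= N j).
  { intros j Hj; eapply Rle_trans; [apply Rabs_pos | apply (HN j Hj x Hx)]. }
  clear - Hi Hpos; induction k as [|k IH].
  - replace i with 0%nat by lia; simpl; lra.
  - simpl; destruct (Nat.eq_dec i (S k)) as [->|Hne].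
    + assert (0 <= sum_f_R0 N k); [|lra].
      clear - Hpos; induction k as [|k IH]; simpl; [apply Hpos; lia|].
      assert (0 <= sum_f_R0 N k) by (apply IH; intros; apply Hpos; lia).
      specialize (Hpos (S k)); lra || (assert (0 <= N (S k)) by (apply Hpos; lia); lra).
    + assert (N i <= sum_f_R0 N k) by (apply IH; [lia | intros; apply Hpos; lia]).
      assert (0 <= N (S k)) by (apply Hpos; lia); lra.
Qed.

(** Identifies the derivatives of the difference quotient measured by [C_norm] with difference
    quotients of derivatives. *)
Lemma Derive_n_on_lin3 (k : nat) (l a b c : R) (f g e h : R -> R) :
  0 < l -> class_C k (segment l) f -> class_C k (segment l) g -> class_C k (segment l) e ->
  (forall x, segment l x -> h x = a * f x + b * g x + c * e x) ->
  forall i, (i <= k)%nat -> forall x, segment l x ->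
    Derive_n_on (segment l) h i x = a * Derive_n_on (segment l) f i x
      + b * Derive_n_on (segment l) g i x + c * Derive_n_on (segment l) e i x.
Proof.
  intros Hl Hf Hg He Hh i; induction i as [|i IH]; intros Hi x Hx; [now apply Hh|].
  pose proof (limit_point_segment l x Hl Hx).
  simpl; apply Derive_on_unique; trivial.
  apply (is_derive_on_lin3 _ (Derive_n_on (segment l) f i) (Derive_n_on (segment l) g i)
    (Derive_n_on (segment l) e i)); trivial.
  - intros; apply IH; trivial; lia.
  - apply Derive_on_correct, (proj1 Hf); trivial; lia.
  - apply Derive_on_correct, (proj1 Hg); trivial; lia.
  - apply Derive_on_correct, (proj1 He); trivial; lia.
Qed.

Lemma class_C_lin3 (k : nat) (l a b c : R) (f g e h : R -> R) :
  0 < l -> class_C k (segment l) f -> class_C k (segment l) g -> class_C k (segment l) e ->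
  (forall x, segment l x -> h x = a * f x + b * g x + c * e x) ->
  class_C k (segment l) h.
Proof.
  intros Hl Hf Hg He Hh.
  pose proof (Derive_n_on_lin3 k l a b c f g e h Hl Hf Hg He Hh) as E.
  split.
  - intros i x Hi Hx.
    eexists; apply (is_derive_on_lin3 _ (Derive_n_on (segment l) f i)
      (Derive_n_on (segment l) g i) (Derive_n_on (segment l) e i) _ a b c); trivial.
    + intros; apply E; trivial; lia.
    + apply Derive_on_correct, (proj1 Hf); trivial; now apply limit_point_segment.
    + apply Derive_on_correct, (proj1 Hg); trivial; now apply limit_point_segment.
    + apply Derive_on_correct, (proj1 He); trivial; now apply limit_point_segment.
  - intros i Hi x Hx.
    rewrite (E i Hi x Hx).
    apply filterlim_within_ext with (fun x => a * Derive_n_on (segment l) f i x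
      + b * Derive_n_on (segment l) g i x + c * Derive_n_on (segment l) e i x).
    { intros; symmetry; now apply E. }
    assert (Hs : forall q F G, filterlim F (within (segment l) (locally x)) (locally (G : R))
       -> filterlim (fun y => q * F y) (within (segment l) (locally x)) (locally (q * G))).
    { intros q F G HF; apply (filterlim_comp _ _ _ F (Rmult q) _ (locally G)); trivial.
      apply (filterlim_scal_r (K := R_AbsRing) q G). }
    assert (Hp : forall F G u v, filterlim F (within (segment l) (locally x)) (locally (u : R))
       -> filterlim G (within (segment l) (locally x)) (locally (v : R))
       -> filterlim (fun y => F y + G y) (within (segment l) (locally x)) (locally (u + v))).
    { intros F G u v HF HG.
      eapply filterlim_comp_2; [exact HF | exact HG |].
      apply (filterlim_plus (K := R_AbsRing) (V := R_NormedModule) u v). }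
    repeat apply Hp; apply Hs.
    + now apply (proj2 Hf). + now apply (proj2 Hg). + now apply (proj2 He).
Qed.

(** * Extension of the data to the plane *)

Definition continuous_2d (f : R -> R -> R) : Prop :=
  forall x t, continuity_2d_pt f x t.

Definition clamped (l : R) (f : R -> R -> R) : Prop :=
  forall x t, f x t = f (clamp l x) (Rmax 0 t).

Lemma clamped_clamp (l : R) (H : R -> R -> R) :
  0 <= l -> clamped l (fun x t => H (Rmax 0 t) (clamp l x)).
Proof.
  intros Hl x t.
  rewrite (clamp_id l (clamp l x)) by now apply clamp_segment.
  now rewrite (Rmax_right 0 (Rmax 0 t)) by apply Rmax_l.
Qed.

(** Separate continuity becomes joint because the continuity in time is uniform in x. *)
Lemma continuous_2d_clamp (l : R) (H : R -> R -> R) :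
  0 <= l ->
  (forall t, 0 <= t -> continuous_on (segment l) (H t)) ->
  (forall t, 0 <= t -> forall eps : posreal, exists d : posreal, forall s, 0 <= s ->
     Rabs (s - t) < d -> forall x, segment l x -> Rabs (H s x - H t x) <= eps) ->
  continuous_2d (fun x t => H (Rmax 0 t) (clamp l x)).
Proof.
  intros Hl Hx Ht x t eps.
  assert (Hm : 0 <= Rmax 0 t) by apply Rmax_l.
  assert (He : 0 < eps / 2) by (apply is_pos_div_2).
  destruct (Ht _ Hm (mkposreal _ He)) as [d1 H1].
  destruct (continuous_on_eps _ _ _ (Hx _ Hm) (clamp_segment l x Hl) (mkposreal _ He))
    as [d2 H2]; simpl in *.
  assert (Hd : 0 < Rmin d1 d2) by (apply Rmin_pos; apply cond_pos).
  exists (mkposreal _ Hd); simpl; intros u v Hu Hv.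
  replace (_ - _) with ((H (Rmax 0 v) (clamp l u) - H (Rmax 0 t) (clamp l u))
    + (H (Rmax 0 t) (clamp l u) - H (Rmax 0 t) (clamp l x))) by ring.
  eapply Rle_lt_trans; [apply Rabs_triang|].
  assert (A1 : Rabs (H (Rmax 0 v) (clamp l u) - H (Rmax 0 t) (clamp l u)) <= eps / 2).
  { apply H1; [apply Rmax_l | | now apply clamp_segment].
    eapply Rle_lt_trans; [apply Rmax0_lipschitz|].
    eapply Rlt_le_trans; [exact Hv | apply Rmin_l]. }
  assert (A2 : Rabs (H (Rmax 0 t) (clamp l u) - H (Rmax 0 t) (clamp l x)) < eps / 2).
  { apply H2; [now apply clamp_segment|].
    eapply Rle_lt_trans; [now apply clamp_lipschitz|].
    eapply Rlt_le_trans; [exact Hu | apply Rmin_r]. }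
  lra.
Qed.

Lemma is_derive_near (f g : R -> R) (x l : R) (D : R -> Prop) :
  locally x D -> (forall y, D y -> f y = g y) -> is_derive f x l -> is_derive g x l.
Proof.
  intros HD E; apply is_derive_ext_loc.
  destruct HD as [d HD]; exists d; intros y Hy; apply E, HD, Hy.
Qed.

(** Clamping both variables extends the data to the plane, so that two-sided derivatives
    and joint continuity in the sense of Coquelicot make sense up to the boundary. *)
Lemma C1_time_C_space_clamped (k : nat) (l : R) (f : R -> R -> R) :
  0 < l -> C1_time_C_space k (segment l) f ->
  exists F G : nat -> R -> R -> R,
    (forall x t, F 0%nat x t = f (Rmax 0 t) (clamp l x)) /\
    (forall i, clamped l (F i) /\ clamped l (G i)) /\
    (forall i, (i <= k)%nat -> continuous_2d (F i) /\ continuous_2d (G i) /\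
       forall x t, 0 < t -> is_derive (fun s => F i x s) t (G i x t)) /\
    (forall i x t, (i < k)%nat -> 0 < x < l ->
       is_derive (fun z => F i z t) x (F (S i) x t) /\
       is_derive (fun z => G i z t) x (G (S i) x t)) /\
    (forall x t, segment l x -> 0 <= t ->
       is_derive_on nonneg_time (fun s => f s x) t (G 0%nat x t)).
Proof.
  intros Hl [g [HC [HF HG]]].
  assert (Hl0 : 0 <= l) by lra.
  set (DF := fun i t x => Derive_n_on (segment l) (f t) i x).
  set (DG := fun i t x => Derive_n_on (segment l) (g t) i x).
  (* Differentiability in time of all space derivatives at once, with one d for every i and x. The
     limit is along a punctured filter, so s = t is treated apart. *)
  assert (EF : forall t, 0 <= t -> forall eps : posreal, exists d : posreal, forall s, 0 <= s ->
     Rabs (s - t) < d -> forall i x, (i <= k)%nat -> segment l x ->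
     Rabs (DF i s x - DF i t x - (s - t) * DG i t x) <= eps * Rabs (s - t)).
  { intros t Ht eps.
    destruct (HF t Ht (ball 0 eps) (locally_ball _ _)) as [d Hd].
    exists d; intros s Hs Hst i x Hi Hx.
    destruct (Req_dec s t) as [->|Hne].
    { rewrite !Rminus_diag, Rabs_R0, Rmult_0_l, Rminus_diag, Rabs_R0; lra. }
    specialize (Hd s Hst Hne Hs).
    assert (Hh : forall x, segment l x -> (f s x - f t x) / (s - t) - g t x
      = / (s - t) * f s x + (- / (s - t)) * f t x + (-1) * g t x)
      by (intros; field; lra).
    destruct (HC s Hs) as [Cs _]; destruct (HC t Ht) as [Ct Cg].
    pose proof (class_C_lin3 k l _ _ _ (f s) (f t) (g t) _ Hl Cs Ct Cg Hh) as Ch.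
    pose proof (Derive_n_on_lin3 k l _ _ _ (f s) (f t) (g t) _ Hl Cs Ct Cg Hh i Hi x Hx) as Eh.
    pose proof (Rabs_Derive_n_on_le_C_norm k i l x _ Hl0 Ch Hi Hx) as B.
    rewrite Eh in B.
    replace (DF i s x - DF i t x - (s - t) * DG i t x) with
      ((/ (s - t) * DF i s x + - / (s - t) * DF i t x + -1 * DG i t x) * (s - t))
      by (field; lra).
    rewrite Rabs_mult; apply Rmult_le_compat_r; [apply Rabs_pos|].
    eapply Rle_trans; [exact B|].
    eapply Rle_trans; [apply Rle_abs|].
    unfold ball in Hd; simpl in Hd; unfold AbsRing_ball, abs, minus, plus, opp in Hd;
      simpl in Hd; rewrite Ropp_0, Rplus_0_r in Hd; lra. }
  assert (EG : forall t, 0 <= t -> forall eps : posreal, exists d : posreal, forall s, 0 <= s ->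
     Rabs (s - t) < d -> forall i x, (i <= k)%nat -> segment l x ->
     Rabs (DG i s x - DG i t x) <= eps).
  { intros t Ht eps.
    destruct (HG t Ht (ball 0 eps) (locally_ball _ _)) as [d Hd].
    exists d; intros s Hs Hst i x Hi Hx.
    specialize (Hd s Hst Hs).
    assert (Hh : forall x, segment l x -> g s x - g t x
      = 1 * g s x + (-1) * g t x + 0 * g t x) by (intros; ring).
    destruct (HC s Hs) as [_ Cs]; destruct (HC t Ht) as [_ Cg].
    pose proof (class_C_lin3 k l _ _ _ (g s) (g t) (g t) _ Hl Cs Cg Cg Hh) as Ch.
    pose proof (Derive_n_on_lin3 k l _ _ _ (g s) (g t) (g t) _ Hl Cs Cg Cg Hh i Hi x Hx) as Eh.
    pose proof (Rabs_Derive_n_on_le_C_norm k i l x _ Hl0 Ch Hi Hx) as B.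
    rewrite Eh in B.
    replace (DG i s x - DG i t x) with (1 * DG i s x + -1 * DG i t x + 0 * DG i t x) by ring.
    eapply Rle_trans; [exact B|].
    eapply Rle_trans; [apply Rle_abs|].
    unfold ball in Hd; simpl in Hd; unfold AbsRing_ball, abs, minus, plus, opp in Hd;
      simpl in Hd; rewrite Ropp_0, Rplus_0_r in Hd; lra. }
  (* Continuity in time of [DF], uniform in x: differentiability with eps = 1 and a bound M for [DG]
     at time t give |DF s - DF t| <= (1 + M) |s - t| for s near t. *)
  assert (EF' : forall t, 0 <= t -> forall i, (i <= k)%nat -> forall eps : posreal,
     exists d : posreal, forall s, 0 <= s -> Rabs (s - t) < d ->
     forall x, segment l x -> Rabs (DF i s x - DF i t x) <= eps).
  { intros t Ht i Hi eps.
    destruct (continuous_on_segment_bounded l _ Hl0 (proj2 (proj2 (HC t Ht)) i Hi)) as [M HM].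
    destruct (EF t Ht (mkposreal 1 Rlt_0_1)) as [d1 Hd1]; simpl in Hd1.
    assert (HM0 : 0 <= M).
    { eapply Rle_trans; [apply Rabs_pos | apply (HM 0); split; lra]. }
    assert (He : 0 < eps / (1 + M)) by (apply Rdiv_lt_0_compat; [apply cond_pos | lra]).
    assert (Hd : 0 < Rmin d1 (eps / (1 + M))) by (apply Rmin_pos; [apply cond_pos | lra]).
    exists (mkposreal _ Hd); simpl; intros s Hs Hst x Hx.
    specialize (Hd1 s Hs (Rlt_le_trans _ _ _ Hst (Rmin_l _ _)) i x Hi Hx).
    assert (Hst' : Rabs (s - t) <= eps / (1 + M)).
    { left; eapply Rlt_le_trans; [exact Hst | apply Rmin_r]. }
    replace (DF i s x - DF i t x) with
      ((DF i s x - DF i t x - (s - t) * DG i t x) + (s - t) * DG i t x) by ring.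
    eapply Rle_trans; [apply Rabs_triang|]; rewrite (Rabs_mult (s - t)).
    specialize (HM x Hx); fold (DG i t x) in HM.
    pose proof (Rabs_pos (s - t)) as P.
    apply Rle_trans with (Rabs (s - t) * (1 + M)).
    { pose proof (Rmult_le_compat_l _ _ _ P HM); lra. }
    replace (pos eps) with (eps / (1 + M) * (1 + M)) by (field; lra).
    apply Rmult_le_compat_r; lra. }
  exists (fun i x t => DF i (Rmax 0 t) (clamp l x)), (fun i x t => DG i (Rmax 0 t) (clamp l x)).
  split; [reflexivity|]; split; [|split; [|split]].
  - intros i; split; [exact (clamped_clamp l (DF i) Hl0) | exact (clamped_clamp l (DG i) Hl0)].
  - intros i Hi; split; [|split].
    + apply continuous_2d_clamp; trivial.
      * intros t Ht; exact (proj2 (proj1 (HC t Ht)) i Hi).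
      * intros t Ht eps; exact (EF' t Ht i Hi eps).
    + apply continuous_2d_clamp; trivial.
      * intros t Ht; exact (proj2 (proj2 (HC t Ht)) i Hi).
      * intros t Ht eps; destruct (EG t Ht eps) as [d Hd].
        exists d; intros; now apply Hd.
    + intros x t Ht.
      apply is_derive_near with (D := nonneg_time) (f := fun s => DF i s (clamp l x)).
      * now apply locally_nonneg_time.
      * intros s Hs; now rewrite Rmax_right.
      * rewrite (Rmax_right 0 t) by lra.
        apply is_derive_on_interior with nonneg_time; [now apply locally_nonneg_time|].
        rewrite is_derive_on_eps by (unfold nonneg_time; lra).
        intros eps; destruct (EF t (Rlt_le _ _ Ht) eps) as [d Hd].
        exists d; intros s Hs Hst; apply Hd; trivial; now apply clamp_segment.
  - intros i x t Hi Hx.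
    assert (Hm : 0 <= Rmax 0 t) by apply Rmax_l.
    assert (Sx : segment l x) by (unfold segment; lra).
    rewrite (clamp_id l x Sx).
    split.
    + apply is_derive_near with (D := segment l) (f := DF i (Rmax 0 t));
        [now apply locally_segment | intros z Hz; now rewrite (clamp_id l z) |].
      apply is_derive_on_interior with (segment l); [now apply locally_segment|].
      apply Derive_on_correct; trivial;
        [now apply limit_point_segment | now apply (proj1 (HC _ Hm))].
    + apply is_derive_near with (D := segment l) (f := DG i (Rmax 0 t));
        [now apply locally_segment | intros z Hz; now rewrite (clamp_id l z) |].
      apply is_derive_on_interior with (segment l); [now apply locally_segment|].
      apply Derive_on_correct; trivial;
        [now apply limit_point_segment | now apply (proj1 (proj2 (HC _ Hm)))].
  - intros x t Hx Ht; rewrite (clamp_id l x Hx), Rmax_right by lra.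
    rewrite is_derive_on_eps by exact Ht.
    intros eps; destruct (EF t Ht eps) as [d Hd].
    exists d; intros s Hs Hst.
    exact (Hd s Hs Hst 0%nat x (Nat.le_0_l k) Hx).
Qed.

(** * Functions of two variables and integrals depending on time *)

Lemma continuous_2d_const (c : R) : continuous_2d (fun _ _ => c).
Proof. intros x t; apply continuity_2d_pt_const. Qed.

Lemma continuous_2d_fst (h : R -> R) :
  (forall x, continuous h x) -> continuous_2d (fun x _ => h x).
Proof.
  intros H x t; apply (continuity_1d_2d_pt_comp h (fun u _ => u)).
  - apply continuity_pt_filterlim, H.
  - apply continuity_2d_pt_id1.
Qed.

Lemma continuous_2d_plus (f g : R -> R -> R) :
  continuous_2d f -> continuous_2d g -> continuous_2d (fun x t => f x t + g x t).
Proof. intros Hf Hg x t; now apply continuity_2d_pt_plus. Qed.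

Lemma continuous_2d_minus (f g : R -> R -> R) :
  continuous_2d f -> continuous_2d g -> continuous_2d (fun x t => f x t - g x t).
Proof. intros Hf Hg x t; now apply continuity_2d_pt_minus. Qed.

Lemma continuous_2d_mult (f g : R -> R -> R) :
  continuous_2d f -> continuous_2d g -> continuous_2d (fun x t => f x t * g x t).
Proof. intros Hf Hg x t; now apply continuity_2d_pt_mult. Qed.

Lemma continuous_2d_sqr (f : R -> R -> R) :
  continuous_2d f -> continuous_2d (fun x t => f x t ^ 2).
Proof.
  intros Hf x t; simpl; apply continuity_2d_pt_mult; trivial.
  apply continuity_2d_pt_mult; trivial; apply continuity_2d_pt_const.
Qed.

Ltac solve_2d :=
  repeat (assumption
    || apply continuous_2d_const
    || apply continuous_2d_sqr
    || apply continuous_2d_minus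
    || apply continuous_2d_plus
    || apply continuous_2d_mult).

Lemma continuous_2d_slice_x (f : R -> R -> R) (t x : R) :
  continuous_2d f -> continuous (fun z => f z t) x.
Proof.
  intros H; apply filterlim_locally; intros eps.
  destruct (H x t eps) as [d Hd]; exists d; intros z Hz.
  apply Hd; [exact Hz|]; rewrite Rminus_diag, Rabs_R0; apply cond_pos.
Qed.

Lemma continuous_2d_slice_t (f : R -> R -> R) (x t : R) :
  continuous_2d f -> continuous (fun s => f x s) t.
Proof.
  intros H; apply filterlim_locally; intros eps.
  destruct (H x t eps) as [d Hd]; exists d; intros z Hz.
  apply Hd; [|exact Hz]; rewrite Rminus_diag, Rabs_R0; apply cond_pos.
Qed.

Lemma ex_RInt_continuous_2d (f : R -> R -> R) (t a b : R) :
  continuous_2d f -> ex_RInt (fun x => f x t) a b.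
Proof.
  intros H; apply (ex_RInt_continuous (V := R_CompleteNormedModule)).
  intros; now apply (continuous_2d_slice_x f).
Qed.

Lemma RInt_mult_l (f : R -> R) (a b c : R) :
  ex_RInt f a b -> RInt (fun x => c * f x) a b = c * RInt f a b.
Proof. exact (RInt_scal (V := R_CompleteNormedModule) f a b c). Qed.

Lemma RInt_Rplus (f g : R -> R) (a b : R) :
  ex_RInt f a b -> ex_RInt g a b ->
  RInt (fun x => f x + g x) a b = RInt f a b + RInt g a b.
Proof. exact (RInt_plus (V := R_CompleteNormedModule) f g a b). Qed.

(** The clamped extensions need not be differentiable at the end points, so the fundamental theorem
    is needed with a derivative in the open interval only. There f minus the primitive of df has
    derivative 0, and the mean value theorem applies by continuity up to the ends. *)
Lemma is_RInt_derive_open (f df : R -> R) (a b : R) :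
  a <= b -> (forall x, continuous f x) -> (forall x, continuous df x) ->
  (forall x, a < x < b -> is_derive f x (df x)) ->
  is_RInt df a b (f b - f a).
Proof.
  intros Hab Hf Hdf Hd.
  assert (Hex : forall u v, ex_RInt df u v).
  { intros; apply (ex_RInt_continuous (V := R_CompleteNormedModule)); auto. }
  set (P := fun x => RInt df a x).
  assert (HP : forall x, is_derive P x (df x)).
  { intros x; apply is_derive_RInt with a; auto.
    apply filter_forall; intros; apply (RInt_correct (V := R_CompleteNormedModule)), Hex. }
  destruct (MVT_gen (fun x => f x - P x) a b (fun _ => 0)) as [c [_ Hc]].
  - rewrite Rmin_left, Rmax_right by lra; intros x Hx.
    replace 0 with (df x - df x) by ring.
    apply (is_derive_minus (K := R_AbsRing) (V := R_NormedModule)); auto.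
  - intros x _; apply continuity_pt_filterlim.
    apply (continuous_minus (K := R_AbsRing) (V := R_NormedModule)); auto.
    apply (ex_derive_continuous (K := R_AbsRing) (V := R_NormedModule)).
    eexists; apply HP.
  - replace (f b - f a) with (RInt df a b).
    + apply (RInt_correct (V := R_CompleteNormedModule)), Hex.
    + assert (P a = 0) by (unfold P; rewrite RInt_point; reflexivity).
      unfold P in *; lra.
Qed.

Lemma is_derive_RInt_time (f df : R -> R -> R) (a b t : R) :
  continuous_2d f -> continuous_2d df -> 0 < t ->
  (forall x s, 0 < s -> is_derive (f x) s (df x s)) ->
  is_derive (fun s => RInt (fun x => f x s) a b) t (RInt (fun x => df x t) a b).
Proof.
  intros Cf Cdf Ht H.
  assert (Hpos : locally t (fun s => 0 < s)) by (now apply open_gt).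
  replace (RInt (fun x => df x t) a b) with
    (RInt (fun x => Derive (fun u => f x u) t) a b).
  2:{ apply RInt_ext; intros x _; now apply is_derive_unique, H. }
  apply (is_derive_RInt_param (fun s x => f x s)).
  - destruct Hpos as [d Hd]; exists d; intros s Hs x _; eexists; apply H, Hd, Hs.
  - intros x _.
    apply continuity_2d_pt_ext_loc with (fun s x => df x s).
    + destruct Hpos as [d Hd]; exists d; intros s z Hs _.
      symmetry; apply is_derive_unique, H, (Hd s Hs).
    + intros eps; destruct (Cdf x t eps) as [d Hd]; exists d; intros; now apply Hd.
  - apply filter_forall; intros s; now apply ex_RInt_continuous_2d.
Qed.

Lemma continuous_RInt_time (f : R -> R -> R) (a b t : R) :
  a <= b -> continuous_2d f ->
  continuous (fun s => RInt (fun x => f x s) a b) t.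
Proof.
  intros Hab Cf; apply filterlim_locally; intros eps.
  assert (He : 0 < eps / (2 * (1 + (b - a)))).
  { apply Rdiv_lt_0_compat; [apply cond_pos | lra]. }
  destruct (uniform_continuity_2d_1d f a b t (fun x _ => Cf x t) (mkposreal _ He)) as [d Hd].
  exists d; intros s Hs; simpl in Hd.
  apply Rabs_lt_between in Hs; unfold minus, plus, opp in Hs; simpl in Hs.
  change (Rabs (RInt (fun x => f x s) a b - RInt (fun x => f x t) a b) < eps).
  replace (RInt (fun x => f x s) a b - RInt (fun x => f x t) a b) with
    (RInt (fun x => f x s - f x t) a b).
  2:{ apply (RInt_minus (V := R_CompleteNormedModule) (fun x => f x s) (fun x => f x t));
      now apply ex_RInt_continuous_2d. }
  apply Rle_lt_trans with ((b - a) * (eps / (2 * (1 + (b - a))))).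
  - apply abs_RInt_le_const; trivial.
    + apply (ex_RInt_minus (V := R_NormedModule) (fun x => f x s) (fun x => f x t)); now apply ex_RInt_continuous_2d.
    + intros x Hx; left.
      pose proof (cond_pos d).
      apply (Hd x t x s); trivial; try lra.
      rewrite Rminus_diag, Rabs_R0; lra.
  - pose proof (cond_pos eps).
    apply Rlt_le_trans with ((1 + (b - a)) * (eps / (1 + (b - a)))); [|right; field; lra].
    replace (eps / (2 * (1 + (b - a)))) with (eps / (1 + (b - a)) / 2) by (field; lra).
    assert (0 < eps / (1 + (b - a))) by (apply Rdiv_lt_0_compat; lra). nra.
Qed.

(** * Monotonicity on the half line *)

(** Freezing f at its value at 0 for negative times expresses one-sided continuity through the
    two-sided [continuous], so that sum and product rules carry over. Grid functions are arbitrary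
    for negative times. *)
Definition right_continuous (f : R -> R) : Prop :=
  continuous (fun t => f (Rmax 0 t)) 0.

Lemma continuous_right_continuous (f : R -> R) : continuous f 0 -> right_continuous f.
Proof.
  intros H; apply filterlim_locally; intros eps.
  rewrite Rmax_left by lra.
  destruct (proj1 (filterlim_locally f (f 0)) H eps) as [d Hd].
  exists d; intros y Hy; apply Hd.
  unfold ball; simpl; unfold AbsRing_ball, abs, minus, plus, opp; simpl.
  pose proof (Rmax0_lipschitz 0 y) as B; rewrite (Rmax_left 0 0) in B by lra.
  eapply Rle_lt_trans; [exact B | exact Hy].
Qed.

Lemma is_derive_on_right_continuous (f : R -> R) :
  ex_derive_on nonneg_time f 0 -> right_continuous f.
Proof.
  intros [l H].
  rewrite is_derive_on_eps in H by (unfold nonneg_time; lra).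
  destruct (H (mkposreal 1 Rlt_0_1)) as [d Hd]; simpl in Hd.
  apply filterlim_locally; intros eps; rewrite Rmax_left by lra.
  pose proof (Rabs_pos l).
  assert (He : 0 < eps / (1 + Rabs l)) by (apply Rdiv_lt_0_compat; [apply cond_pos | lra]).
  assert (Hm : 0 < Rmin d (eps / (1 + Rabs l))) by (apply Rmin_pos; [apply cond_pos | lra]).
  exists (mkposreal _ Hm); intros y Hy.
  assert (B : Rabs (Rmax 0 y - 0) < Rmin d (eps / (1 + Rabs l))).
  { pose proof (Rmax0_lipschitz 0 y) as B; rewrite (Rmax_left 0 0) in B by lra.
    eapply Rle_lt_trans; [exact B | exact Hy]. }
  change (Rabs (f (Rmax 0 y) - f 0) < eps).
  specialize (Hd (Rmax 0 y) (Rmax_l _ _) (Rlt_le_trans _ _ _ B (Rmin_l _ _))).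
  replace (f (Rmax 0 y) - f 0) with
    ((f (Rmax 0 y) - f 0 - (Rmax 0 y - 0) * l) + (Rmax 0 y - 0) * l) by ring.
  eapply Rle_lt_trans; [apply Rabs_triang|]; rewrite (Rabs_mult (_ - 0)).
  apply Rle_lt_trans with (Rabs (Rmax 0 y - 0) * (1 + Rabs l)); [lra|].
  replace (pos eps) with (eps / (1 + Rabs l) * (1 + Rabs l)) by (field; lra).
  apply Rmult_lt_compat_r; [lra|].
  eapply Rlt_le_trans; [exact B | apply Rmin_r].
Qed.

Lemma right_continuous_const (c : R) : right_continuous (fun _ => c).
Proof. apply continuous_const. Qed.

Lemma right_continuous_plus (f g : R -> R) :
  right_continuous f -> right_continuous g -> right_continuous (fun t => f t + g t).
Proof.
  intros Hf Hg; exact (continuous_plus (K := R_AbsRing) (V := R_NormedModule) _ _ _ Hf Hg).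
Qed.

Lemma right_continuous_minus (f g : R -> R) :
  right_continuous f -> right_continuous g -> right_continuous (fun t => f t - g t).
Proof.
  intros Hf Hg; exact (continuous_minus (K := R_AbsRing) (V := R_NormedModule) _ _ _ Hf Hg).
Qed.

Lemma right_continuous_mult (f g : R -> R) :
  right_continuous f -> right_continuous g -> right_continuous (fun t => f t * g t).
Proof. intros Hf Hg; exact (continuous_mult (K := R_AbsRing) _ _ _ Hf Hg). Qed.

Lemma right_continuous_sqr (f : R -> R) :
  right_continuous f -> right_continuous (fun t => f t ^ 2).
Proof.
  intros Hf; apply (right_continuous_mult f (fun t => f t * 1)); trivial.
  apply right_continuous_mult; trivial; apply right_continuous_const.
Qed.

(** The common engine of the Lyapunov, Gronwall and energy comparison arguments. *)
Lemma nonincreasing_half_line (f df : R -> R) :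
  right_continuous f ->
  (forall t, 0 < t -> is_derive f t (df t)) -> (forall t, 0 < t -> df t <= 0) ->
  forall t, 0 <= t -> f t <= f 0.
Proof.
  intros H0 Hd Hle t Ht.
  destruct (Rle_lt_or_eq_dec _ _ Ht) as [Ht'|<-]; [|lra].
  (* The point c of the mean value theorem may be 0, where nothing is known about [df];
     [Rmin 0 (df s)] equals [df s] for s > 0 and is nonpositive everywhere. *)
  destruct (MVT_gen (fun s => f (Rmax 0 s)) 0 t (fun s => Rmin 0 (df s)))
    as [c [_ Hc]].
  - rewrite Rmin_left, Rmax_right by lra; intros s Hs.
    rewrite Rmin_right by (apply Hle; lra).
    apply is_derive_near with (D := nonneg_time) (f := f).
    + apply locally_nonneg_time; lra.
    + intros r Hr; now rewrite Rmax_right.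
    + apply Hd; lra.
  - rewrite Rmin_left, Rmax_right by lra; intros s Hs; apply continuity_pt_filterlim.
    destruct (Rle_lt_or_eq_dec _ _ (proj1 Hs)) as [Hs'|<-]; [|exact H0].
    apply (ex_derive_continuous (K := R_AbsRing) (V := R_NormedModule)
      (fun r => f (Rmax 0 r))).
    exists (df s); apply (is_derive_near f (fun r => f (Rmax 0 r)) s (df s) nonneg_time).
    + apply locally_nonneg_time; lra.
    + intros r Hr; now rewrite Rmax_right.
    + apply Hd; lra.
  - rewrite (Rmax_right 0 t), (Rmax_left 0 0) in Hc by lra.
    pose proof (Rmin_l 0 (df c)); nra.
Qed.

(** [auto_derive] leaves [Derive] of eta-expanded functions, hence the detour by [exact]. *)
Ltac rewrite_derive :=
  repeat match goal with
  | H : is_derive _ ?x ?l |- context [Derive ?g ?x] =>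
      let E := fresh in
      assert (E : Derive g x = l) by exact (is_derive_unique _ _ _ H);
      rewrite E; clear E
  end.

(** [ring] for equations typed in the normed module [R]. *)
Ltac ring_R := match goal with |- ?a = ?b => change (@eq R a b); ring end.

(** * Energy, multiplier and exponential decay *)

Record positive_params (p : params) : Prop := {
  L_pos : 0 < L p; rho_pos : 0 < rho p; mu_pos : 0 < mu p;
  beta_pos : 0 < beta p; alpha1_pos : 0 < alpha1 p;
  k1_pos : 0 < k1 p; k2_pos : 0 < k2 p }.

Lemma alpha_eq (p : params) : alpha p = alpha1 p + gamma p ^ 2 * beta p.
Proof. unfold alpha1; ring. Qed.

(** The arguments are [u1, u2, w1, w2]; [energy] and [energy_ORFD] share this quadratic form. *)
Definition density (p : params) (a b c d : R) : R :=
  rho p * c ^ 2 + mu p * d ^ 2 + beta p * (gamma p * a - b) ^ 2 + alpha1 p * a ^ 2.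

(** Half of its time derivative when [(a, b, c, d)] has derivative [(a', b', c', d')]. *)
Definition density' (p : params) (a b c d a' b' c' d' : R) : R :=
  rho p * c * c' + mu p * d * d'
  + beta p * (gamma p * a - b) * (gamma p * a' - b') + alpha1 p * a * a'.

Lemma density_nonneg (p : params) (a b c d : R) : positive_params p -> 0 <= density p a b c d.
Proof.
  intros [_ Hr Hm Hb Ha _ _]; unfold density.
  pose proof (pow2_ge_0 a); pose proof (pow2_ge_0 c); pose proof (pow2_ge_0 d);
  pose proof (pow2_ge_0 (gamma p * a - b)); nra.
Qed.

Lemma is_derive_density (p : params) (a b c d : R -> R) (t a' b' c' d' : R) :
  is_derive a t a' -> is_derive b t b' -> is_derive c t c' -> is_derive d t d' ->
  is_derive (fun s => density p (a s) (b s) (c s) (d s)) t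
    (2 * density' p (a t) (b t) (c t) (d t) a' b' c' d').
Proof.
  intros Ha Hb Hc Hd; unfold density, density'.
  auto_derive.
  - repeat split; eexists; eassumption.
  - rewrite_derive; ring.
Qed.

(** The stresses: the momentum equations read rho w1_t = (sigma1)_x and mu w2_t = (sigma2)_x. They
    are inverted by sigma1 + gamma sigma2 = alpha1 u1 and sigma2 = beta (u2 - gamma u1), which
    explains the space derivatives in [wave_pair]. *)
Definition sigma1 (p : params) (a b : R) : R := alpha p * a - gamma p * beta p * b.
Definition sigma2 (p : params) (a b : R) : R := beta p * b - gamma p * beta p * a.

(** [y'] is the time derivative of the solution [y]; the first-order equations are solved
    for the space derivatives. *)
Record wave_pair (p : params) (y y' : fields (R -> R -> R)) : Prop := {
  wp_cont_u1 : continuous_2d (u1 y); wp_cont_u2 : continuous_2d (u2 y);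
  wp_cont_w1 : continuous_2d (w1 y); wp_cont_w2 : continuous_2d (w2 y);
  wp_cont_u1' : continuous_2d (u1 y'); wp_cont_u2' : continuous_2d (u2 y');
  wp_cont_w1' : continuous_2d (w1 y'); wp_cont_w2' : continuous_2d (w2 y');
  wp_t_u1 : forall x t, 0 < t -> is_derive (u1 y x) t (u1 y' x t);
  wp_t_u2 : forall x t, 0 < t -> is_derive (u2 y x) t (u2 y' x t);
  wp_t_w1 : forall x t, 0 < t -> is_derive (w1 y x) t (w1 y' x t);
  wp_t_w2 : forall x t, 0 < t -> is_derive (w2 y x) t (w2 y' x t);
  wp_x_w1 : forall x t, 0 < x < L p -> 0 < t -> is_derive (fun z => w1 y z t) x (u1 y' x t);
  wp_x_w2 : forall x t, 0 < x < L p -> 0 < t -> is_derive (fun z => w2 y z t) x (u2 y' x t);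
  wp_x_u1 : forall x t, 0 < x < L p -> 0 < t -> is_derive (fun z => u1 y z t) x
    ((rho p * w1 y' x t + gamma p * (mu p * w2 y' x t)) / alpha1 p);
  wp_x_u2 : forall x t, 0 < x < L p -> 0 < t -> is_derive (fun z => u2 y z t) x
    (gamma p * ((rho p * w1 y' x t + gamma p * (mu p * w2 y' x t)) / alpha1 p)
      + mu p * w2 y' x t / beta p);
  wp_w1_0 : forall t, 0 < t -> w1 y 0 t = 0;
  wp_w2_0 : forall t, 0 < t -> w2 y 0 t = 0;
  wp_sigma1_L : forall t, 0 < t ->
    sigma1 p (u1 y (L p) t) (u2 y (L p) t) = - k1 p * w1 y (L p) t;
  wp_sigma2_L : forall t, 0 < t ->
    sigma2 p (u1 y (L p) t) (u2 y (L p) t) = - k2 p * w2 y (L p) t }.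

Definition density_at (p : params) (y : fields (R -> R -> R)) (x t : R) : R :=
  density p (u1 y x t) (u2 y x t) (w1 y x t) (w2 y x t).

Definition density_at' (p : params) (y y' : fields (R -> R -> R)) (x t : R) : R :=
  density' p (u1 y x t) (u2 y x t) (w1 y x t) (w2 y x t)
    (u1 y' x t) (u2 y' x t) (w1 y' x t) (w2 y' x t).

Definition boundary_power (p : params) (y : fields (R -> R -> R)) (t : R) : R :=
  k1 p * w1 y (L p) t ^ 2 + k2 p * w2 y (L p) t ^ 2.

Lemma energy_density (p : params) (y : fields (R -> R -> R)) (t : R) :
  energy p y t = / 2 * RInt (fun x => density_at p y x t) 0 (L p).
Proof.
  unfold energy; f_equal; apply RInt_ext; intros x _.
  rewrite !pow2_abs; unfold density_at, density, alpha1.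
  ring_R.
Qed.

Section WavePair.
Variables (p : params) (y y' : fields (R -> R -> R)).
Hypotheses (Hp : positive_params p) (Hy : wave_pair p y y').

Lemma continuous_2d_density : continuous_2d (density_at p y).
Proof. destruct Hy; unfold density_at, density; solve_2d. Qed.

Lemma continuous_2d_density' : continuous_2d (density_at' p y y').
Proof. destruct Hy; unfold density_at', density'; solve_2d. Qed.

Lemma is_derive_density_at (x t : R) : 0 < t ->
  is_derive (density_at p y x) t (2 * density_at' p y y' x t).
Proof.
  intros Ht; destruct Hy.
  apply (is_derive_density p (u1 y x) (u2 y x) (w1 y x) (w2 y x)); auto.
Qed.

Lemma energy_right_continuous : right_continuous (energy p y).
Proof.
  apply continuous_right_continuous.
  apply continuous_ext with (fun t => / 2 * RInt (fun x => density_at p y x t) 0 (L p)).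
  { intros t; now rewrite energy_density. }
  apply (continuous_mult (K := R_AbsRing)); [apply continuous_const|].
  apply continuous_RInt_time; [left; apply Hp | apply continuous_2d_density].
Qed.

Lemma energy_nonneg (t : R) : 0 <= energy p y t.
Proof.
  rewrite energy_density; apply Rmult_le_pos; [lra|].
  apply RInt_ge_0; [left; apply Hp | |].
  - apply ex_RInt_continuous_2d, continuous_2d_density.
  - intros; now apply density_nonneg.
Qed.

(** The integrand is the x-derivative of the energy flux sigma1 w1 + sigma2 w2. The flux vanishes at
    x = 0 by the clamping, and at x = L the feedback makes it minus the dissipation. *)
Lemma power_flux (t : R) : 0 < t ->
  RInt (fun x => density_at' p y y' x t) 0 (L p) = - boundary_power p y t.
Proof.
  intros Ht.
  pose proof (alpha1_pos p Hp) as Ha; pose proof (beta_pos p Hp) as Hb.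
  apply is_RInt_unique.
  replace (- boundary_power p y t) with
   ((sigma1 p (u1 y (L p) t) (u2 y (L p) t) * w1 y (L p) t
     + sigma2 p (u1 y (L p) t) (u2 y (L p) t) * w2 y (L p) t)
    - (sigma1 p (u1 y 0 t) (u2 y 0 t) * w1 y 0 t
     + sigma2 p (u1 y 0 t) (u2 y 0 t) * w2 y 0 t)).
  2:{ rewrite (wp_w1_0 _ _ _ Hy), (wp_w2_0 _ _ _ Hy), (wp_sigma1_L _ _ _ Hy),
        (wp_sigma2_L _ _ _ Hy) by exact Ht; unfold boundary_power; ring. }
  apply (is_RInt_derive_open (fun x => sigma1 p (u1 y x t) (u2 y x t) * w1 y x t
     + sigma2 p (u1 y x t) (u2 y x t) * w2 y x t)).
  - left; apply Hp.
  - intros x.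
    apply (continuous_2d_slice_x (fun x t => sigma1 p (u1 y x t) (u2 y x t) * w1 y x t
     + sigma2 p (u1 y x t) (u2 y x t) * w2 y x t)).
    destruct Hy; unfold sigma1, sigma2; solve_2d.
  - intros x; apply (continuous_2d_slice_x (density_at' p y y')), continuous_2d_density'.
  - intros x Hx.
    pose proof (wp_x_w1 _ _ _ Hy x t Hx Ht) as D1; pose proof (wp_x_w2 _ _ _ Hy x t Hx Ht) as D2.
    pose proof (wp_x_u1 _ _ _ Hy x t Hx Ht) as D3; pose proof (wp_x_u2 _ _ _ Hy x t Hx Ht) as D4.
    unfold sigma1, sigma2; auto_derive.
    + repeat split; eexists; eassumption.
    + rewrite_derive.
      unfold density_at', density'; rewrite alpha_eq; field; lra.
Qed.

Lemma is_derive_energy (t : R) : 0 < t -> is_derive (energy p y) t (- boundary_power p y t).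
Proof.
  intros Ht.
  apply is_derive_ext with (fun s => / 2 * RInt (fun x => density_at p y x s) 0 (L p)).
  { intros s; now rewrite energy_density. }
  replace (- boundary_power p y t) with
    (/ 2 * RInt (fun x => 2 * density_at' p y y' x t) 0 (L p)).
  - apply is_derive_scal.
    apply (is_derive_RInt_time (density_at p y) (fun x t => 2 * density_at' p y y' x t)).
    + apply continuous_2d_density.
    + apply continuous_2d_mult; [apply continuous_2d_const | apply continuous_2d_density'].
    + exact Ht.
    + apply is_derive_density_at.
  - rewrite (RInt_mult_l (fun x => density_at' p y y' x t)).
    + rewrite power_flux by exact Ht; field.
    + apply ex_RInt_continuous_2d, continuous_2d_density'.
Qed.

(** The multiplier functional: its derivative produces [- energy] up to boundary terms. *)
Definition multiplier_density (x t : R) : R :=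
  x * (rho p * w1 y x t * u1 y x t + mu p * w2 y x t * u2 y x t).

Definition multiplier (t : R) : R := RInt (fun x => multiplier_density x t) 0 (L p).

Definition multiplier_density' (x t : R) : R :=
  x * (rho p * (w1 y' x t * u1 y x t + w1 y x t * u1 y' x t)
       + mu p * (w2 y' x t * u2 y x t + w2 y x t * u2 y' x t)).

Lemma continuous_2d_multiplier : continuous_2d multiplier_density.
Proof.
  destruct Hy; unfold multiplier_density.
  apply continuous_2d_mult; [|solve_2d].
  apply (continuous_2d_fst (fun x => x)); intros; apply continuous_id.
Qed.

Lemma continuous_2d_multiplier' : continuous_2d multiplier_density'.
Proof.
  destruct Hy; unfold multiplier_density'.
  apply continuous_2d_mult; [|solve_2d].
  apply (continuous_2d_fst (fun x => x)); intros; apply continuous_id.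
Qed.

(** By the equations [multiplier_density'] equals x / 2 times the x-derivative of the energy
    density; integration by parts leaves the boundary term at L minus half the integral of the
    density, which is the energy. *)
Lemma is_derive_multiplier (t : R) : 0 < t ->
  is_derive multiplier t (L p / 2 * density_at p y (L p) t - energy p y t).
Proof.
  intros Ht.
  replace (L p / 2 * density_at p y (L p) t - energy p y t) with
    (RInt (fun x => multiplier_density' x t) 0 (L p)).
  - apply (is_derive_RInt_time multiplier_density multiplier_density'); trivial.
    + apply continuous_2d_multiplier.
    + apply continuous_2d_multiplier'.
    + intros x s Hs; unfold multiplier_density, multiplier_density'.
      pose proof (wp_t_w1 _ _ _ Hy x s Hs) as D1; pose proof (wp_t_w2 _ _ _ Hy x s Hs) as D2.
      pose proof (wp_t_u1 _ _ _ Hy x s Hs) as D3; pose proof (wp_t_u2 _ _ _ Hy x s Hs) as D4.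
      auto_derive.
      * repeat split; eexists; eassumption.
      * rewrite_derive; ring.
  - pose proof (alpha1_pos p Hp) as Ha; pose proof (beta_pos p Hp) as Hb.
    assert (I : is_RInt (fun x => / 2 * density_at p y x t + multiplier_density' x t) 0 (L p)
      (L p / 2 * density_at p y (L p) t - 0 / 2 * density_at p y 0 t)).
    { apply (is_RInt_derive_open (fun x => x / 2 * density_at p y x t)).
      - left; apply Hp.
      - intros x; apply (continuous_2d_slice_x (fun x t => x / 2 * density_at p y x t)).
        apply continuous_2d_mult; [|apply continuous_2d_density].
        apply (continuous_2d_fst (fun x => x / 2)); intros z.
        apply (continuous_mult (K := R_AbsRing)); [apply continuous_id | apply continuous_const].
      - intros x; apply (continuous_2d_slice_x
          (fun x t => / 2 * density_at p y x t + multiplier_density' x t)).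
        apply continuous_2d_plus; [|apply continuous_2d_multiplier'].
        apply continuous_2d_mult; [apply continuous_2d_const | apply continuous_2d_density].
      - intros x Hx.
        pose proof (wp_x_w1 _ _ _ Hy x t Hx Ht) as D1; pose proof (wp_x_w2 _ _ _ Hy x t Hx Ht) as D2.
        pose proof (wp_x_u1 _ _ _ Hy x t Hx Ht) as D3; pose proof (wp_x_u2 _ _ _ Hy x t Hx Ht) as D4.
        unfold density_at, density, multiplier_density'; auto_derive.
        + repeat split; eexists; eassumption.
        + rewrite_derive.
          field; lra. }
    apply (is_RInt_unique (V := R_CompleteNormedModule)) in I.
    rewrite (RInt_Rplus (fun x => / 2 * density_at p y x t)
      (fun x => multiplier_density' x t)) in I.
    + rewrite (RInt_mult_l (fun x => density_at p y x t)) in I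
        by apply ex_RInt_continuous_2d, continuous_2d_density.
      rewrite energy_density; lra.
    + apply (ex_RInt_continuous_2d (fun x t => / 2 * density_at p y x t)).
      apply continuous_2d_mult; [apply continuous_2d_const | apply continuous_2d_density].
    + apply ex_RInt_continuous_2d, continuous_2d_multiplier'.
Qed.

(** Young's inequality on w1 u1 and w2 u2, followed by u1^2 <= e / alpha1 and u2^2 <= 2 e / beta + 2
    gamma^2 e / alpha1, where e is the energy density. *)
Definition multiplier_constant : R :=
  1 + rho p / alpha1 p + 2 * mu p / beta p + 2 * mu p * gamma p ^ 2 / alpha1 p.

(** The first two terms come from the velocities at x = L, the two over alpha1 from u1 and the last
    from gamma u1 - u2. *)
Definition boundary_constant : R :=
  rho p / k1 p + mu p / k2 p + 2 * k1 p / alpha1 p + 2 * gamma p ^ 2 * k2 p / alpha1 p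
  + k2 p / beta p.

Lemma multiplier_bound (t : R) :
  Rabs (multiplier t) <= L p * multiplier_constant * energy p y t.
Proof.
  destruct Hp as [HL Hr Hm Hb Ha _ _].
  rewrite energy_density.
  eapply Rle_trans; [apply abs_RInt_le; [lra | apply ex_RInt_continuous_2d, continuous_2d_multiplier]|].
  rewrite <- Rmult_assoc.
  rewrite <- (RInt_mult_l (fun x => density_at p y x t))
    by apply ex_RInt_continuous_2d, continuous_2d_density.
  apply RInt_le; [lra | | |].
  - apply (ex_RInt_norm (fun x => multiplier_density x t)).
    apply ex_RInt_continuous_2d, continuous_2d_multiplier.
  - apply (ex_RInt_scal (V := R_NormedModule)).
    apply ex_RInt_continuous_2d, continuous_2d_density.
  - intros x Hx; change (Rabs (multiplier_density x t) <=
      L p * multiplier_constant * / 2 * density_at p y x t).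
    unfold multiplier_density, density_at, density.
    set (a := u1 y x t); set (b := u2 y x t); set (c := w1 y x t); set (d := w2 y x t).
    rewrite Rabs_mult, (Rabs_right x) by lra.
    set (e := rho p * c ^ 2 + mu p * d ^ 2 + beta p * (gamma p * a - b) ^ 2 + alpha1 p * a ^ 2).
    pose proof (pow2_ge_0 a) as Pa; pose proof (pow2_ge_0 c) as Pc; pose proof (pow2_ge_0 d) as Pd.
    pose proof (pow2_ge_0 (gamma p * a - b)) as Pg.
    pose proof (Rmult_le_pos _ _ (Rlt_le _ _ Ha) Pa) as Qa.
    pose proof (Rmult_le_pos _ _ (Rlt_le _ _ Hb) Pg) as Qg.
    pose proof (Rmult_le_pos _ _ (Rlt_le _ _ Hr) Pc) as Qc.
    pose proof (Rmult_le_pos _ _ (Rlt_le _ _ Hm) Pd) as Qd.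
    assert (E3 : rho p * c ^ 2 + mu p * d ^ 2 <= e) by (unfold e; lra).
    assert (E4 : a ^ 2 <= e / alpha1 p) by (apply (proj1 (Rle_div_r _ _ _ Ha)); unfold e; lra).
    assert (E5 : (gamma p * a - b) ^ 2 <= e / beta p) by (apply (proj1 (Rle_div_r _ _ _ Hb)); unfold e; lra).
    assert (E6 : b ^ 2 <= 2 * (e / beta p) + 2 * gamma p ^ 2 * (e / alpha1 p)).
    { apply Rle_trans with (2 * (gamma p * a - b) ^ 2 + 2 * gamma p ^ 2 * a ^ 2).
      - pose proof (pow2_ge_0 (2 * (gamma p * a) - b)); nra.
      - pose proof (pow2_ge_0 (gamma p)).
        pose proof (Rmult_le_compat_l (2 * gamma p ^ 2) _ _ ltac:(lra) E4); lra. }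
    assert (E7 : Rabs (rho p * c * a + mu p * d * b) <= multiplier_constant * / 2 * e).
    { apply Rle_trans with (/ 2 * (rho p * c ^ 2 + mu p * d ^ 2 + rho p * a ^ 2 + mu p * b ^ 2)).
      - apply Rabs_le; split.
        + pose proof (pow2_ge_0 (c + a)); pose proof (pow2_ge_0 (d + b)); nra.
        + pose proof (pow2_ge_0 (c - a)); pose proof (pow2_ge_0 (d - b)); nra.
      - pose proof (Rmult_le_compat_l _ _ _ (Rlt_le _ _ Hr) E4).
        pose proof (Rmult_le_compat_l _ _ _ (Rlt_le _ _ Hm) E6).
        unfold multiplier_constant.
        replace ((1 + rho p / alpha1 p + 2 * mu p / beta p + 2 * mu p * gamma p ^ 2 / alpha1 p)
           * / 2 * e) with (/ 2 * (e + rho p * (e / alpha1 p) + mu p * (2 * (e / beta p)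
             + 2 * gamma p ^ 2 * (e / alpha1 p)))) by (field; lra).
        lra. }
    replace (L p * multiplier_constant * / 2 * e) with (L p * (multiplier_constant * / 2 * e)) by ring.
    apply Rmult_le_compat; trivial; try lra; apply Rabs_pos.
Qed.

(** The two feedback laws determine u1 and u2 at x = L from w1 and w2, so the whole density there is
    dominated by the dissipation. This absorbs the boundary term produced by the multiplier. *)
Lemma density_boundary_bound (t : R) : 0 < t ->
  density_at p y (L p) t <= boundary_constant * boundary_power p y t.
Proof.
  intros Ht.
  pose proof (wp_sigma1_L _ _ _ Hy t Ht) as S1; pose proof (wp_sigma2_L _ _ _ Hy t Ht) as S2.
  destruct Hp as [HL Hr Hm Hb Ha H1 H2].
  unfold density_at, density, boundary_power, boundary_constant, sigma1, sigma2 in *.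
  set (a := u1 y (L p) t) in *; set (b := u2 y (L p) t) in *;
  set (c := w1 y (L p) t) in *; set (d := w2 y (L p) t) in *.
  rewrite alpha_eq in S1.
  assert (Ea : a = - (k1 p * c + gamma p * k2 p * d) / alpha1 p).
  { apply Rmult_eq_reg_l with (alpha1 p); [|lra].
    replace (alpha1 p * (- (k1 p * c + gamma p * k2 p * d) / alpha1 p)) with
      (- k1 p * c + gamma p * (- k2 p * d)) by (field; lra).
    rewrite <- S1, <- S2; ring. }
  assert (Eb : gamma p * a - b = k2 p * d / beta p).
  { apply Rmult_eq_reg_l with (beta p); [|lra].
    replace (beta p * (k2 p * d / beta p)) with (- (- k2 p * d)) by (field; lra).
    rewrite <- S2; ring. }
  rewrite Eb, Ea; clear Ea Eb S1 S2; clearbody c d; clear a b.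
  set (P := k1 p * c ^ 2 + k2 p * d ^ 2).
  pose proof (pow2_ge_0 c) as Pc; pose proof (pow2_ge_0 d) as Pd.
  assert (Q1 : k1 p * c ^ 2 <= P) by (unfold P; nra).
  assert (Q2 : k2 p * d ^ 2 <= P) by (unfold P; nra).
  pose proof (pow2_ge_0 (gamma p)) as Pg.
  assert (T1 : rho p * c ^ 2 <= rho p / k1 p * P).
  { replace (rho p * c ^ 2) with (rho p / k1 p * (k1 p * c ^ 2)) by (field; lra).
    apply Rmult_le_compat_l; trivial; left; now apply Rdiv_lt_0_compat. }
  assert (T2 : mu p * d ^ 2 <= mu p / k2 p * P).
  { replace (mu p * d ^ 2) with (mu p / k2 p * (k2 p * d ^ 2)) by (field; lra).
    apply Rmult_le_compat_l; trivial; left; now apply Rdiv_lt_0_compat. }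
  assert (T3 : beta p * (k2 p * d / beta p) ^ 2 <= k2 p / beta p * P).
  { replace (beta p * (k2 p * d / beta p) ^ 2) with (k2 p / beta p * (k2 p * d ^ 2)) by (field; lra).
    apply Rmult_le_compat_l; trivial; left; now apply Rdiv_lt_0_compat. }
  assert (T4 : alpha1 p * (- (k1 p * c + gamma p * k2 p * d) / alpha1 p) ^ 2
     <= (2 * k1 p / alpha1 p + 2 * gamma p ^ 2 * k2 p / alpha1 p) * P).
  { replace (alpha1 p * (- (k1 p * c + gamma p * k2 p * d) / alpha1 p) ^ 2) with
      ((k1 p * c + gamma p * k2 p * d) ^ 2 / alpha1 p) by (field; lra).
    replace ((2 * k1 p / alpha1 p + 2 * gamma p ^ 2 * k2 p / alpha1 p) * P) with
      ((2 * k1 p * P + 2 * gamma p ^ 2 * k2 p * P) / alpha1 p) by (field; lra).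
    apply Rmult_le_compat_r; [left; now apply Rinv_0_lt_compat|].
    apply Rle_trans with (2 * k1 p * (k1 p * c ^ 2) + 2 * gamma p ^ 2 * k2 p * (k2 p * d ^ 2)).
    - pose proof (pow2_ge_0 (k1 p * c - gamma p * k2 p * d)); nra.
    - apply Rplus_le_compat; apply Rmult_le_compat_l; trivial; nra. }
  lra.
Qed.

End WavePair.

(** The rate is chosen before the solution, hence it also serves the time derivatives of the given
    solution. The factor 3 is the ratio of the constants in E / 2 <= V <= 3 E / 2. *)
Lemma energy_decay (p : params) : positive_params p ->
  exists omega, 0 < omega /\ forall y y', wave_pair p y y' ->
    forall t, 0 <= t -> energy p y t <= 3 * exp (- omega * t) * energy p y 0.
Proof.
  intros Hp.
  set (K1 := multiplier_constant p); set (K2 := boundary_constant p).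
  assert (HK1 : 0 < K1).
  { destruct Hp as [HL Hr Hm Hb Ha _ _]; unfold K1, multiplier_constant.
    pose proof (pow2_ge_0 (gamma p)).
    assert (0 < rho p / alpha1 p) by now apply Rdiv_lt_0_compat.
    assert (0 < 2 * mu p / beta p) by (apply Rdiv_lt_0_compat; lra).
    assert (0 <= 2 * mu p * gamma p ^ 2 / alpha1 p)
      by (apply Rdiv_le_0_compat; trivial; nra).
    lra. }
  assert (HK2 : 0 < K2).
  { destruct Hp as [HL Hr Hm Hb Ha H1 H2]; unfold K2, boundary_constant.
    pose proof (pow2_ge_0 (gamma p)).
    assert (0 < rho p / k1 p) by now apply Rdiv_lt_0_compat.
    assert (0 < mu p / k2 p) by now apply Rdiv_lt_0_compat.
    assert (0 < k2 p / beta p) by now apply Rdiv_lt_0_compat.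
    assert (0 < 2 * k1 p / alpha1 p) by (apply Rdiv_lt_0_compat; lra).
    assert (0 <= 2 * gamma p ^ 2 * k2 p / alpha1 p)
      by (apply Rdiv_le_0_compat; trivial; nra).
    lra. }
  pose proof (L_pos p Hp) as HL.
  (* The two terms of the denominator give eps L K1 <= 1 / 2, which makes V equivalent to the
     energy, and eps L K2 <= 1, which lets half of the dissipation absorb the boundary term of the
     multiplier. *)
  set (eps := / (L p * (K2 + 2 * K1))).
  assert (Hd : 0 < L p * (K2 + 2 * K1)) by (apply Rmult_lt_0_compat; lra).
  assert (He : 0 < eps) by now apply Rinv_0_lt_compat.
  assert (He1 : eps * (L p * (K2 + 2 * K1)) = 1) by (unfold eps; field; lra).
  (* V' <= - eps E <= - (2 / 3) eps V, and eps / 2 is below that rate. *)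
  exists (eps / 2); split; [lra|].
  intros y y' Hy t Ht.
  set (V := fun t => energy p y t + eps * multiplier p y t).
  assert (HLK1 : 0 < L p * K1) by now apply Rmult_lt_0_compat.
  assert (HLK2 : 0 < L p * K2) by now apply Rmult_lt_0_compat.
  assert (HV : forall s, energy p y s / 2 <= V s <= 3 / 2 * energy p y s).
  { intros s; unfold V.
    pose proof (multiplier_bound p y y' Hp Hy s) as B; fold K1 in B.
    pose proof (energy_nonneg p y y' Hp Hy s) as P.
    assert (Q : eps * (L p * K1) <= / 2) by nra.
    apply Rabs_le_between in B.
    assert (eps * (L p * K1 * energy p y s) <= / 2 * energy p y s).
    { rewrite <- Rmult_assoc; now apply Rmult_le_compat_r. }
    split; nra. }
  assert (Hmono : exp (eps / 2 * t) * V t <= exp (eps / 2 * 0) * V 0).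
  { apply (nonincreasing_half_line (fun s => exp (eps / 2 * s) * V s)
      (fun s => exp (eps / 2 * s) * (eps / 2 * V s + (- boundary_power p y s
         + eps * (L p / 2 * density_at p y (L p) s - energy p y s))))); trivial.
    - apply right_continuous_mult.
      + apply continuous_right_continuous.
        apply (ex_derive_continuous (K := R_AbsRing) (V := R_NormedModule)); now auto_derive.
      + apply right_continuous_plus; [now apply energy_right_continuous with y'|].
        apply right_continuous_mult; [apply right_continuous_const|].
        apply continuous_right_continuous, continuous_RInt_time; [lra|].
        now apply continuous_2d_multiplier with y'.
    - intros s Hs.
      pose proof (is_derive_energy p y y' Hp Hy s Hs) as D1.
      pose proof (is_derive_multiplier p y y' Hp Hy s Hs) as D2.
      unfold V; auto_derive; [repeat split; eexists; eassumption|].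
      rewrite_derive; field.
    - intros s Hs.
      assert (eps / 2 * V s + (- boundary_power p y s
         + eps * (L p / 2 * density_at p y (L p) s - energy p y s)) <= 0).
      2:{ pose proof (exp_pos (eps / 2 * s)); nra. }
      pose proof (density_boundary_bound p y y' Hp Hy s Hs) as B; fold K2 in B.
      assert (Q : eps * (L p * K2) <= 1) by nra.
      pose proof (proj2 (HV s)) as HVs.
      assert (HP : 0 <= boundary_power p y s).
      { unfold boundary_power; destruct Hp; pose proof (pow2_ge_0 (w1 y (L p) s));
        pose proof (pow2_ge_0 (w2 y (L p) s)); nra. }
      assert (eps * (L p / 2 * density_at p y (L p) s) <= / 2 * boundary_power p y s).
      { apply Rle_trans with (eps * (L p / 2 * (K2 * boundary_power p y s))).
        - apply Rmult_le_compat_l; [lra|]; apply Rmult_le_compat_l; lra.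
        - replace (eps * (L p / 2 * (K2 * boundary_power p y s))) with
            (/ 2 * ((eps * (L p * K2)) * boundary_power p y s)) by field.
          nra. }
      pose proof (energy_nonneg p y y' Hp Hy s).
      nra. }
  rewrite Rmult_0_r, exp_0, Rmult_1_l in Hmono.
  pose proof (HV t) as [V1 _]; pose proof (HV 0) as [_ V2].
  pose proof (exp_pos (eps / 2 * t)) as X1.
  replace (- (eps / 2) * t) with (- (eps / 2 * t)) by ring.
  rewrite exp_Ropp.
  apply Rmult_le_reg_l with (exp (eps / 2 * t)); trivial.
  replace (exp (eps / 2 * t) * (3 * / exp (eps / 2 * t) * energy p y 0))
    with (3 * energy p y 0) by (field; lra).
  apply (Rmult_le_compat_l (exp (eps / 2 * t))) in V1; [|lra].
  lra.
Qed.

(** * Time derivatives of a solution as solutions *)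

(** If the two functions differed at a point of the closed strip, they would differ near it by
    continuity, and moving the point slightly towards the middle of the segment and to later time
    reaches the open strip. Outside the closed strip, clamped functions repeat its values. *)
Lemma clamped_eq (l : R) (f g : R -> R -> R) :
  0 < l -> continuous_2d f -> continuous_2d g -> clamped l f -> clamped l g ->
  (forall x t, 0 < x < l -> 0 < t -> f x t = g x t) ->
  forall x t, f x t = g x t.
Proof.
  intros Hl Cf Cg Kf Kg E x t.
  rewrite Kf, Kg.
  pose proof (clamp_segment l x (Rlt_le _ _ Hl)) as [X0 X1].
  pose proof (Rmax_l 0 t) as T0.
  set (a := clamp l x) in *; set (b := Rmax 0 t) in *; clearbody a b.
  destruct (Req_dec (f a b) (g a b)) as [|Hne]; trivial; exfalso.
  destruct (continuity_2d_pt_neq_0 (fun x t => f x t - g x t) a b) as [d Hd].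
  - now apply continuity_2d_pt_minus.
  - lra.
  - pose proof (cond_pos d) as Pd.
    set (m := Rmin (d / 2) (l / 4)).
    assert (Hm : 0 < m) by (apply Rmin_pos; lra).
    assert (Hm1 : m <= d / 2) by apply Rmin_l.
    assert (Hm2 : m <= l / 4) by apply Rmin_r.
    set (a' := if Rle_dec a (l / 2) then a + m else a - m).
    assert (Ha : 0 < a' < l /\ Rabs (a' - a) < d).
    { unfold a'; destruct (Rle_dec a (l / 2)); (split; [lra | apply Rabs_lt_between; lra]). }
    apply (Hd a' (b + m)).
    + apply Ha.
    + apply Rabs_lt_between; lra.
    + rewrite (E a' (b + m)) by lra; ring.
Qed.

Definition all_fields (P : (R -> R -> R) -> Prop) (v : fields (R -> R -> R)) : Prop :=
  P (u1 v) /\ P (u2 v) /\ P (w1 v) /\ P (w2 v).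

Definition all_fields2 (P : (R -> R -> R) -> (R -> R -> R) -> Prop)
    (v w : fields (R -> R -> R)) : Prop :=
  P (u1 v) (u1 w) /\ P (u2 v) (u2 w) /\ P (w1 v) (w1 w) /\ P (w2 v) (w2 w).

Definition eq_2d (f g : R -> R -> R) : Prop := forall x t, f x t = g x t.

Definition t_derivative (f f' : R -> R -> R) : Prop :=
  forall x t, 0 < t -> is_derive (fun s => f x s) t (f' x t).

Definition x_derivative (l : R) (f f' : R -> R -> R) : Prop :=
  forall x t, 0 < x < l -> 0 < t -> is_derive (fun z => f z t) x (f' x t).

Lemma t_derivative_ext (f g f' : R -> R -> R) :
  eq_2d f g -> t_derivative f f' -> t_derivative g f'.
Proof.
  intros E D x t Ht; apply is_derive_ext with (fun s => f x s); auto.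
Qed.

Lemma is_derive_lin (f g : R -> R) (a b x f' g' : R) :
  is_derive f x f' -> is_derive g x g' ->
  is_derive (fun s => a * f s + b * g s) x (a * f' + b * g').
Proof.
  intros Df Dg; auto_derive; [repeat split; eexists; eassumption|].
  rewrite_derive; ring.
Qed.

(** A solution has time derivative [evolve p] of its space derivative. *)
Definition evolve (p : params) (v : fields (R -> R -> R)) : fields (R -> R -> R) :=
  Fields (w1 v) (w2 v)
    (fun x t => alpha p / rho p * u1 v x t + - (gamma p * beta p / rho p) * u2 v x t)
    (fun x t => beta p / mu p * u2 v x t + - (gamma p * beta p / mu p) * u1 v x t).

Lemma all_fields_evolve (P : (R -> R -> R) -> Prop) (p : params) (v : fields (R -> R -> R)) :
  (forall f g a b, P f -> P g -> P (fun x t => a * f x t + b * g x t)) ->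
  all_fields P v -> all_fields P (evolve p v).
Proof.
  intros H (H1 & H2 & H3 & H4); unfold all_fields, evolve; simpl; repeat split; auto.
Qed.

Lemma all_fields2_evolve (P : (R -> R -> R) -> (R -> R -> R) -> Prop) (p : params)
    (v w : fields (R -> R -> R)) :
  (forall f g f' g' a b, P f f' -> P g g' ->
     P (fun x t => a * f x t + b * g x t) (fun x t => a * f' x t + b * g' x t)) ->
  all_fields2 P v w -> all_fields2 P (evolve p v) (evolve p w).
Proof.
  intros H (H1 & H2 & H3 & H4); unfold all_fields2, evolve; simpl; repeat split; auto.
Qed.

Lemma continuous_2d_lin (f g : R -> R -> R) (a b : R) :
  continuous_2d f -> continuous_2d g -> continuous_2d (fun x t => a * f x t + b * g x t).
Proof. intros; solve_2d. Qed.

Lemma clamped_lin (l : R) (f g : R -> R -> R) (a b : R) :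
  clamped l f -> clamped l g -> clamped l (fun x t => a * f x t + b * g x t).
Proof. intros Hf Hg x t; now rewrite (Hf x t), (Hg x t). Qed.

Lemma t_derivative_lin (f g f' g' : R -> R -> R) (a b : R) :
  t_derivative f f' -> t_derivative g g' ->
  t_derivative (fun x t => a * f x t + b * g x t) (fun x t => a * f' x t + b * g' x t).
Proof. intros Hf Hg x t Ht; apply is_derive_lin; auto. Qed.

Lemma x_derivative_lin (l : R) (f g f' g' : R -> R -> R) (a b : R) :
  x_derivative l f f' -> x_derivative l g g' ->
  x_derivative l (fun x t => a * f x t + b * g x t) (fun x t => a * f' x t + b * g' x t).
Proof.
  intros Hf Hg x t Hx Ht; apply (is_derive_lin (fun z => f z t) (fun z => g z t)); auto.
Qed.

Definition boundary_conditions (p : params) (v : fields (R -> R -> R)) (t : R) : Prop :=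
  w1 v 0 t = 0 /\ w2 v 0 t = 0 /\
  sigma1 p (u1 v (L p) t) (u2 v (L p) t) = - k1 p * w1 v (L p) t /\
  sigma2 p (u1 v (L p) t) (u2 v (L p) t) = - k2 p * w2 v (L p) t.

Lemma is_derive_eq_half_line (f g : R -> R) (t f' g' : R) :
  (forall s, 0 < s -> f s = g s) -> 0 < t -> is_derive f t f' -> is_derive g t g' -> f' = g'.
Proof.
  intros E Ht Df Dg.
  apply (is_derive_unique f) in Df; rewrite <- Df; clear Df.
  apply is_derive_unique, is_derive_near with (D := fun s => 0 < s) (f := g); trivial.
  - now apply open_gt.
  - intros; symmetry; auto.
Qed.

(** The boundary conditions are linear with constant coefficients, so time derivatives inherit the
    same feedback, and with it the same decay rate. *)
Lemma boundary_conditions_t_derivative (p : params) (v v' : fields (R -> R -> R)) :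
  all_fields2 t_derivative v v' -> (forall t, 0 < t -> boundary_conditions p v t) ->
  forall t, 0 < t -> boundary_conditions p v' t.
Proof.
  intros (D1 & D2 & D3 & D4) B t Ht; unfold boundary_conditions.
  assert (Z : is_derive (fun _ : R => 0) t 0) by (auto_derive; trivial).
  split; [|split; [|split]].
  - apply (is_derive_eq_half_line (fun s => w1 v 0 s) (fun _ => 0) t); auto.
    intros s Hs; apply (B s Hs).
  - apply (is_derive_eq_half_line (fun s => w2 v 0 s) (fun _ => 0) t); auto.
    intros s Hs; apply (B s Hs).
  - apply (is_derive_eq_half_line (fun s => sigma1 p (u1 v (L p) s) (u2 v (L p) s))
      (fun s => - k1 p * w1 v (L p) s) t); auto.
    + intros s Hs; apply (B s Hs).
    + unfold sigma1; apply (is_derive_ext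
        (fun s => alpha p * u1 v (L p) s + - (gamma p * beta p) * u2 v (L p) s)); [intros; ring_R|].
      replace (_ - _) with (alpha p * u1 v' (L p) t + - (gamma p * beta p) * u2 v' (L p) t) by ring.
      apply is_derive_lin; auto.
    + apply is_derive_scal, D3, Ht.
  - apply (is_derive_eq_half_line (fun s => sigma2 p (u1 v (L p) s) (u2 v (L p) s))
      (fun s => - k2 p * w2 v (L p) s) t); auto.
    + intros s Hs; apply (B s Hs).
    + unfold sigma2; apply (is_derive_ext
        (fun s => beta p * u2 v (L p) s + - (gamma p * beta p) * u1 v (L p) s)); [intros; ring_R|].
      replace (_ - _) with (beta p * u2 v' (L p) t + - (gamma p * beta p) * u1 v' (L p) t) by ring.
      apply is_derive_lin; auto.
    + apply is_derive_scal, D4, Ht.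
Qed.

Lemma wave_pair_intro (p : params) (v v' vx : fields (R -> R -> R)) :
  positive_params p ->
  all_fields continuous_2d v -> all_fields continuous_2d v' ->
  all_fields2 t_derivative v v' -> all_fields2 (x_derivative (L p)) v vx ->
  all_fields2 eq_2d v' (evolve p vx) ->
  (forall t, 0 < t -> boundary_conditions p v t) ->
  wave_pair p v v'.
Proof.
  intros Hp (C1 & C2 & C3 & C4) (C1' & C2' & C3' & C4') (T1 & T2 & T3 & T4)
    (X1 & X2 & X3 & X4) (E1 & E2 & E3 & E4) B.
  destruct Hp as [HL Hr Hm Hb Ha _ _].
  constructor; trivial.
  - intros x t Hx Ht; rewrite E1; now apply X3.
  - intros x t Hx Ht; rewrite E2; now apply X4.
  - intros x t Hx Ht; rewrite E3, E4; simpl.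
    match goal with |- is_derive _ _ ?e => replace e with (u1 vx x t) end; [now apply X1|].
    rewrite alpha_eq; field; lra.
  - intros x t Hx Ht; rewrite E3, E4; simpl.
    match goal with |- is_derive _ _ ?e => replace e with (u2 vx x t) end; [now apply X2|].
    rewrite alpha_eq; field; lra.
  - intros t Ht; apply (B t Ht).
  - intros t Ht; apply (B t Ht).
  - intros t Ht; apply (B t Ht).
  - intros t Ht; apply (B t Ht).
Qed.

Lemma wave_pair_boundary (p : params) (v v' : fields (R -> R -> R)) :
  wave_pair p v v' -> forall t, 0 < t -> boundary_conditions p v t.
Proof. intros [] t Ht; unfold boundary_conditions; auto. Qed.

(** The time derivatives up to order four of a solution, as a chain of solutions:
    [y3] controls the residuals of the scheme on [y0]. *)
Lemma wave_chain (p : params) (F G : nat -> fields (R -> R -> R)) :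
  positive_params p ->
  (forall i, all_fields (clamped (L p)) (F i) /\ all_fields (clamped (L p)) (G i)) ->
  (forall i, (i <= 3)%nat -> all_fields continuous_2d (F i) /\ all_fields continuous_2d (G i) /\
     all_fields2 t_derivative (F i) (G i)) ->
  (forall i, (i < 3)%nat -> all_fields2 (x_derivative (L p)) (F i) (F (S i)) /\
     all_fields2 (x_derivative (L p)) (G i) (G (S i))) ->
  all_fields2 eq_2d (G 0%nat) (evolve p (F 1%nat)) ->
  (forall t, 0 < t -> boundary_conditions p (F 0%nat) t) ->
  exists y2 y3 y4, wave_pair p (F 0%nat) (G 0%nat) /\ wave_pair p (G 0%nat) y2 /\
    wave_pair p y2 y3 /\ wave_pair p y3 y4.
Proof.
  intros Hp HK HC HX E0 B.
  pose proof (L_pos p Hp) as HL.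
  (* The evolution equation differentiated i times in x. The step differentiates both sides in the
     open strip and extends the equality by continuity and clamping. *)
  assert (HE : forall i, (i < 3)%nat -> all_fields2 eq_2d (G i) (evolve p (F (S i)))).
  { intros i; induction i as [|i IH]; intros Hi; trivial.
    specialize (IH ltac:(lia)).
    destruct (HX i ltac:(lia)) as [_ XG]; destruct (HX (S i) Hi) as [XF _].
    apply (all_fields2_evolve _ p) in XF; [|apply x_derivative_lin].
    destruct (HC (S i) ltac:(lia)) as (_ & CG & _).
    destruct (HC (S (S i)) ltac:(lia)) as (CF & _ & _).
    apply (all_fields_evolve _ p) in CF; [|apply continuous_2d_lin].
    destruct (HK (S i)) as [_ KG]; destruct (HK (S (S i))) as [KF _].
    apply (all_fields_evolve _ p) in KF; [|apply clamped_lin].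
    assert (Hgen : forall f g f' g', x_derivative (L p) f f' -> x_derivative (L p) g g' ->
       eq_2d f g -> continuous_2d f' -> continuous_2d g' -> clamped (L p) f' ->
       clamped (L p) g' -> eq_2d f' g').
    { intros f g f' g' Df Dg E Cf Cg Kf Kg.
      refine (clamped_eq (L p) f' g' HL Cf Cg Kf Kg _); intros x t Hx Ht.
      rewrite <- (is_derive_unique _ _ _ (Df x t Hx Ht)).
      apply is_derive_unique, is_derive_ext with (fun z => g z t); [|now apply Dg].
      intros z; symmetry; apply E. }
    destruct XG as (? & ? & ? & ?), XF as (? & ? & ? & ?), IH as (? & ? & ? & ?),
      CG as (? & ? & ? & ?), CF as (? & ? & ? & ?), KG as (? & ? & ? & ?), KF as (? & ? & ? & ?).
    repeat split; eapply Hgen; eassumption. }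
  (* [G i] is only known to be continuous in time, but it equals [evolve p (F (S i))], which is
     differentiable in time: a space derivative is exchanged for a time derivative. *)
  assert (HT : forall i, (i < 3)%nat -> all_fields2 t_derivative (G i) (evolve p (G (S i)))).
  { intros i Hi; destruct (HC (S i) ltac:(lia)) as (_ & _ & T).
    apply (all_fields2_evolve _ p) in T; [|apply t_derivative_lin].
    destruct (HE i Hi) as (E1 & E2 & E3 & E4), T as (T1 & T2 & T3 & T4).
    split; [|split; [|split]];
      (eapply t_derivative_ext; [|eassumption]; intros x t; symmetry).
    - apply E1. - apply E2. - apply E3. - apply E4. }
  assert (Hrefl : forall v, all_fields2 eq_2d v v) by (intros v; repeat split).
  destruct (HC 0%nat ltac:(lia)) as (CF0 & CG0 & T0).
  destruct (HC 1%nat ltac:(lia)) as (_ & CG1 & _).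
  destruct (HC 2%nat ltac:(lia)) as (_ & CG2 & _).
  destruct (HC 3%nat ltac:(lia)) as (_ & CG3 & _).
  pose proof (HT 0%nat ltac:(lia)) as T1.
  pose proof (HT 1%nat ltac:(lia)) as T2.
  pose proof (HT 2%nat ltac:(lia)) as T3.
  destruct (HX 0%nat ltac:(lia)) as [X0 X1].
  destruct (HX 1%nat ltac:(lia)) as [_ X2].
  destruct (HX 2%nat ltac:(lia)) as [_ X3].
  do 1 (apply (all_fields_evolve _ p) in CG1; [|apply continuous_2d_lin]).
  do 2 (apply (all_fields_evolve _ p) in CG2; [|apply continuous_2d_lin]).
  do 3 (apply (all_fields_evolve _ p) in CG3; [|apply continuous_2d_lin]).
  do 1 (apply (all_fields2_evolve _ p) in T2; [|apply t_derivative_lin]).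
  do 2 (apply (all_fields2_evolve _ p) in T3; [|apply t_derivative_lin]).
  do 1 (apply (all_fields2_evolve _ p) in X2; [|apply x_derivative_lin]).
  do 2 (apply (all_fields2_evolve _ p) in X3; [|apply x_derivative_lin]).
  pose proof (boundary_conditions_t_derivative p _ _ T0 B) as B1.
  pose proof (boundary_conditions_t_derivative p _ _ T1 B1) as B2.
  pose proof (boundary_conditions_t_derivative p _ _ T2 B2) as B3.
  (* Each further time derivative is one more application of [evolve] to one more space derivative
     of y_t; the last member uses the third. *)
  exists (evolve p (G 1%nat)), (evolve p (evolve p (G 2%nat))),
    (evolve p (evolve p (evolve p (G 3%nat)))).
  split; [|split; [|split]]; eapply wave_pair_intro; eauto.
Qed.

Definition clamp_of (l : R) (f g : R -> R -> R) : Prop :=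
  forall x t, g x t = f (clamp l x) (Rmax 0 t).

(** The time derivative of y itself, relative to the half line, is recorded separately because it
    includes t = 0, where [wave_pair] gives no derivative and the grid functions must be
    differentiable. *)
Lemma regular_wave_chain (p : params) (v0 v1 p0 p1 : R -> R) (y : fields (R -> R -> R)) :
  positive_params p -> regular p y -> solves_PDE p v0 v1 p0 p1 y ->
  exists y0 y1 y2 y3 y4,
    all_fields2 (clamp_of (L p)) y y0 /\
    all_fields2 (fun f f' => forall x t, segment (L p) x -> 0 <= t ->
      is_derive_on nonneg_time (f x) t (f' x t)) y y1 /\
    wave_pair p y0 y1 /\ wave_pair p y1 y2 /\ wave_pair p y2 y3 /\ wave_pair p y3 y4.
Proof.
  intros Hp (R1 & R2 & R3 & R4) (P1 & P2 & _).
  pose proof (L_pos p Hp) as HL.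
  destruct (C1_time_C_space_clamped 3 (L p) _ HL R1) as (F1 & G1 & A1 & K1 & C1 & X1 & T1).
  destruct (C1_time_C_space_clamped 3 (L p) _ HL R2) as (F2 & G2 & A2 & K2 & C2 & X2 & T2).
  destruct (C1_time_C_space_clamped 3 (L p) _ HL R3) as (F3 & G3 & A3 & K3 & C3 & X3 & T3).
  destruct (C1_time_C_space_clamped 3 (L p) _ HL R4) as (F4 & G4 & A4 & K4 & C4 & X4 & T4).
  set (F := fun i => Fields (F1 i) (F2 i) (F3 i) (F4 i)).
  set (G := fun i => Fields (G1 i) (G2 i) (G3 i) (G4 i)).
  destruct (wave_chain p F G Hp) as (y2 & y3 & y4 & W).
  - intros i; destruct (K1 i), (K2 i), (K3 i), (K4 i); repeat split; assumption.
  - intros i Hi; destruct (C1 i Hi) as (? & ? & ?), (C2 i Hi) as (? & ? & ?),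
      (C3 i Hi) as (? & ? & ?), (C4 i Hi) as (? & ? & ?).
    unfold all_fields, all_fields2; tauto.
  - intros i Hi; unfold all_fields2, x_derivative; simpl.
    split; (split; [|split; [|split]]); intros x t Hx _;
      solve [apply (X1 i x t Hi Hx) | apply (X2 i x t Hi Hx)
        | apply (X3 i x t Hi Hx) | apply (X4 i x t Hi Hx)].
  - assert (Hrho := rho_pos p Hp); assert (Hmu := mu_pos p Hp).
    (* The equations are stated with two-sided [Derive] of y, whose values outside the closed strip
       are arbitrary; at interior points y and its clamped extension agree nearby. *)
    assert (DT : forall (f : R -> R -> R) (F G : nat -> R -> R -> R),
      (forall x t, F 0%nat x t = f (clamp (L p) x) (Rmax 0 t)) ->
      t_derivative (F 0%nat) (G 0%nat) ->
      forall x t, 0 < x < L p -> 0 < t -> Derive (fun s => f x s) t = G 0%nat x t).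
    { intros f F' G' E T x t Hx Ht; apply is_derive_unique.
      apply is_derive_near with (D := nonneg_time) (f := F' 0%nat x);
        [now apply locally_nonneg_time | | now apply T].
      intros s Hs; rewrite E, clamp_id, Rmax_right; trivial; unfold segment; lra. }
    assert (DX : forall (f : R -> R -> R) (F : nat -> R -> R -> R),
      (forall x t, F 0%nat x t = f (clamp (L p) x) (Rmax 0 t)) ->
      (forall x t, 0 < x < L p -> is_derive (fun z => F 0%nat z t) x (F 1%nat x t)) ->
      forall x t, 0 < x < L p -> 0 < t -> Derive (fun z => f z t) x = F 1%nat x t).
    { intros f F' E X x t Hx Ht; apply is_derive_unique.
      apply is_derive_near with (D := segment (L p)) (f := fun z => F' 0%nat z t);
        [now apply locally_segment | | now apply X].
      intros s Hs; rewrite E, clamp_id, Rmax_right; trivial; lra. }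
    assert (EQ : forall x t, 0 < x < L p -> 0 < t ->
      G1 0%nat x t = F3 1%nat x t /\ G2 0%nat x t = F4 1%nat x t /\
      G3 0%nat x t = alpha p / rho p * F1 1%nat x t + - (gamma p * beta p / rho p) * F2 1%nat x t /\
      G4 0%nat x t = beta p / mu p * F2 1%nat x t + - (gamma p * beta p / mu p) * F1 1%nat x t).
    { intros x t Hx Ht; destruct (P1 x t Hx Ht) as (Q1 & Q2 & Q3 & Q4).
      assert (Z : (0 <= 3)%nat) by lia; assert (Z' : (0 < 3)%nat) by lia.
      rewrite (DT (w1 y) F3 G3 A3 (proj2 (proj2 (C3 _ Z))) x t Hx Ht),
        (DX (u1 y) F1 A1 (fun x t Hx => proj1 (X1 _ x t Z' Hx)) x t Hx Ht),
        (DX (u2 y) F2 A2 (fun x t Hx => proj1 (X2 _ x t Z' Hx)) x t Hx Ht) in Q1.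
      rewrite (DT (w2 y) F4 G4 A4 (proj2 (proj2 (C4 _ Z))) x t Hx Ht),
        (DX (u1 y) F1 A1 (fun x t Hx => proj1 (X1 _ x t Z' Hx)) x t Hx Ht),
        (DX (u2 y) F2 A2 (fun x t Hx => proj1 (X2 _ x t Z' Hx)) x t Hx Ht) in Q2.
      rewrite (DT (u1 y) F1 G1 A1 (proj2 (proj2 (C1 _ Z))) x t Hx Ht),
        (DX (w1 y) F3 A3 (fun x t Hx => proj1 (X3 _ x t Z' Hx)) x t Hx Ht) in Q3.
      rewrite (DT (u2 y) F2 G2 A2 (proj2 (proj2 (C2 _ Z))) x t Hx Ht),
        (DX (w2 y) F4 A4 (fun x t Hx => proj1 (X4 _ x t Z' Hx)) x t Hx Ht) in Q4.
      repeat split; try lra.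
      - apply Rmult_eq_reg_l with (rho p); [|lra].
        transitivity (alpha p * F1 1%nat x t - gamma p * beta p * F2 1%nat x t); [lra | field; lra].
      - apply Rmult_eq_reg_l with (mu p); [|lra].
        transitivity (beta p * F2 1%nat x t - gamma p * beta p * F1 1%nat x t); [lra | field; lra]. }
    destruct (C1 0%nat ltac:(lia)) as (_ & ? & _), (C2 0%nat ltac:(lia)) as (_ & ? & _),
      (C3 0%nat ltac:(lia)) as (_ & ? & _), (C4 0%nat ltac:(lia)) as (_ & ? & _).
    destruct (C1 1%nat ltac:(lia)) as (? & _ & _), (C2 1%nat ltac:(lia)) as (? & _ & _),
      (C3 1%nat ltac:(lia)) as (? & _ & _), (C4 1%nat ltac:(lia)) as (? & _ & _).
    destruct (K1 0%nat) as [_ ?], (K2 0%nat) as [_ ?], (K3 0%nat) as [_ ?], (K4 0%nat) as [_ ?].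
    destruct (K1 1%nat) as [? _], (K2 1%nat) as [? _], (K3 1%nat) as [? _], (K4 1%nat) as [? _].
    split; [|split; [|split]]; simpl; refine (clamped_eq (L p) _ _ HL _ _ _ _ _);
      try assumption; try (now apply continuous_2d_lin); try (now apply clamped_lin);
      intros x t Hx Ht; apply (EQ x t Hx Ht).
  - intros t Ht; destruct (P2 t Ht) as (B1 & B2 & B3 & B4).
    assert (S0 : segment (L p) 0) by (unfold segment; lra).
    assert (SL : segment (L p) (L p)) by (unfold segment; lra).
    unfold boundary_conditions, sigma1, sigma2; simpl.
    rewrite !A1, !A2, !A3, !A4, !(clamp_id (L p) 0 S0), !(clamp_id (L p) (L p) SL),
      Rmax_right by lra; auto.
  - exists (F 0%nat), (G 0%nat), y2, y3, y4; split; [|split; [|exact W]].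
    + unfold all_fields2, clamp_of; simpl; auto.
    + unfold all_fields2; simpl; auto.
Qed.

(** * The residuals *)

(** Cauchy-Schwarz, with the integral of q^2 estimated by (b - a) M. *)
Lemma sqr_RInt_kernel (q f : R -> R) (a b M : R) :
  a <= b -> 0 < M -> (forall x, continuous q x) -> (forall x, continuous f x) ->
  (forall x, a < x < b -> q x ^ 2 <= M) ->
  RInt (fun x => q x * f x) a b ^ 2 <= (b - a) * M * RInt (fun x => f x ^ 2) a b.
Proof.
  intros Hab HM Cq Cf Hq.
  assert (Cm : forall f g : R -> R, (forall x, continuous f x) -> (forall x, continuous g x) ->
    forall x, continuous (fun z => f z * g z) x).
  { intros f' g' H1 H2 x; apply (continuous_mult (K := R_AbsRing)); auto. }
  assert (Cs : forall f : R -> R, (forall x, continuous f x) -> forall x, continuous (fun z => f z ^ 2) x).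
  { intros f' H x; apply (Cm f' (fun z => f' z * 1)); trivial.
    apply Cm; trivial; intros; apply continuous_const. }
  assert (Hex : forall f : R -> R, (forall x, continuous f x) -> ex_RInt f a b).
  { intros f' H; apply (ex_RInt_continuous (V := R_CompleteNormedModule)); auto. }
  set (I := RInt (fun x => q x * f x) a b); set (S := RInt (fun x => f x ^ 2) a b).
  destruct (Rle_lt_or_eq_dec _ _ Hab) as [Hlt|<-].
  2:{ unfold I; rewrite RInt_point; unfold zero; simpl; lra. }
  assert (Hpos : 0 < (b - a) * M) by (apply Rmult_lt_0_compat; lra).
  set (c := (b - a) * M) in *.
  (* expand [0 <= int (c f - I q)^2] and use [int q^2 <= c] *)
  assert (E : RInt (fun x => c ^ 2 * f x ^ 2 + ((- 2 * c * I) * (q x * f x) + I ^ 2 * q x ^ 2)) a b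
    = c ^ 2 * S + ((- 2 * c * I) * I + I ^ 2 * RInt (fun x => q x ^ 2) a b)).
  { rewrite (RInt_Rplus (fun x => c ^ 2 * f x ^ 2)
      (fun x => (- 2 * c * I) * (q x * f x) + I ^ 2 * q x ^ 2)).
    - rewrite (RInt_mult_l (fun x => f x ^ 2)) by auto.
      f_equal; rewrite (RInt_Rplus (fun x => (- 2 * c * I) * (q x * f x))
        (fun x => I ^ 2 * q x ^ 2)).
      + rewrite (RInt_mult_l (fun x => q x * f x)) by auto.
        now rewrite (RInt_mult_l (fun x => q x ^ 2)) by auto.
      + apply Hex, Cm; [intros; apply continuous_const | auto].
      + apply Hex, Cm; [intros; apply continuous_const | auto].
    - apply Hex, Cm; [intros; apply continuous_const | auto].
    - apply (ex_RInt_plus (V := R_NormedModule)).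
      + apply Hex, Cm; [intros; apply continuous_const | auto].
      + apply Hex, Cm; [intros; apply continuous_const | auto]. }
  assert (P : 0 <= RInt (fun x => c ^ 2 * f x ^ 2 + ((- 2 * c * I) * (q x * f x) + I ^ 2 * q x ^ 2)) a b).
  { apply RInt_ge_0; trivial.
    - apply (ex_RInt_plus (V := R_NormedModule)); [|apply (ex_RInt_plus (V := R_NormedModule))];
        apply Hex, Cm; auto; intros; apply continuous_const.
    - intros x _; pose proof (pow2_ge_0 (c * f x - I * q x)); lra. }
  assert (Q : RInt (fun x => q x ^ 2) a b <= c).
  { apply Rle_trans with (RInt (fun _ => M) a b).
    - apply RInt_le; auto; apply ex_RInt_const.
    - rewrite RInt_const; unfold scal; simpl; unfold mult; simpl; unfold c; lra. }
  pose proof (Rmult_le_compat_l _ _ _ (pow2_ge_0 I) Q).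
  rewrite E in P.
  apply Rmult_le_reg_l with c; trivial. nra.
Qed.

(** The error is the integral of [g''] against the Peano kernel [(x - a) (b - x) / 2]. *)
Lemma trapezoid_residual (phi g g1 g2 : R -> R) (a b : R) :
  a < b -> (forall x, continuous phi x) -> (forall x, continuous g x) ->
  (forall x, continuous g1 x) -> (forall x, continuous g2 x) ->
  (forall x, a < x < b -> is_derive phi x (g x)) ->
  (forall x, a < x < b -> is_derive g x (g1 x)) ->
  (forall x, a < x < b -> is_derive g1 x (g2 x)) ->
  ((g a + g b) / 2 - (phi b - phi a) / (b - a)) ^ 2
    <= (b - a) ^ 3 / 64 * RInt (fun x => g2 x ^ 2) a b.
Proof.
  intros Hab Cphi Cg Cg1 Cg2 D1 D2 D3.
  set (q := fun x => (x - a) * (b - x)).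
  assert (Cq : forall x, continuous q x).
  { intros x; apply (ex_derive_continuous (K := R_AbsRing) (V := R_NormedModule)).
    unfold q; now auto_derive. }
  (* Two integrations by parts, with q' = a + b - 2 x and q'' = - 2; the terms in g1 drop out
     because q vanishes at both ends. *)
  assert (I : is_RInt (fun x => q x * g2 x) a b
    ((q b * g1 b - (a + b - 2 * b) * g b - 2 * phi b)
     - (q a * g1 a - (a + b - 2 * a) * g a - 2 * phi a))).
  { apply (is_RInt_derive_open (fun x => q x * g1 x - (a + b - 2 * x) * g x - 2 * phi x)).
    - lra.
    - intros x.
      apply (continuous_minus (K := R_AbsRing) (V := R_NormedModule)).
      + apply (continuous_minus (K := R_AbsRing) (V := R_NormedModule)).
        * apply (continuous_mult (K := R_AbsRing)); auto.
        * apply (continuous_mult (K := R_AbsRing)); auto.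
          apply (ex_derive_continuous (K := R_AbsRing) (V := R_NormedModule)); now auto_derive.
      + apply (continuous_mult (K := R_AbsRing)); auto; apply continuous_const.
    - intros x; apply (continuous_mult (K := R_AbsRing)); auto.
    - intros x Hx; specialize (D1 x Hx); specialize (D2 x Hx); specialize (D3 x Hx).
      unfold q; auto_derive; [repeat split; eexists; eassumption|].
      rewrite_derive; ring. }
  apply (is_RInt_unique (V := R_CompleteNormedModule)) in I.
  (* The maximum of q on the interval is (b - a)^2 / 4. Dividing (b - a) (b - a)^4 / 16 by the
     factor (2 (b - a))^2 in front of the residual leaves (b - a)^3 / 64. *)
  assert (HM : 0 < (b - a) ^ 4 / 16) by (apply Rdiv_lt_0_compat; [apply pow_lt|]; lra).
  pose proof (sqr_RInt_kernel q g2 a b ((b - a) ^ 4 / 16) ltac:(lra) HM Cq Cg2) as B.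
  rewrite I in B.
  assert (E : q b * g1 b - (a + b - 2 * b) * g b - 2 * phi b
     - (q a * g1 a - (a + b - 2 * a) * g a - 2 * phi a)
     = 2 * (b - a) * ((g a + g b) / 2 - (phi b - phi a) / (b - a)))
    by (unfold q; field; lra).
  rewrite E in B.
  set (r := (g a + g b) / 2 - (phi b - phi a) / (b - a)) in *.
  apply Rmult_le_reg_l with ((2 * (b - a)) ^ 2); [apply pow_lt; lra|].
  eapply Rle_trans; [|eapply Rle_trans; [apply B|]].
  - right; ring.
  - intros x Hx; unfold q.
    replace ((b - a) ^ 4 / 16) with (((b - a) ^ 2 / 4) ^ 2) by field.
    apply pow_incr; split; [apply Rmult_le_pos; lra|].
    pose proof (pow2_ge_0 (2 * x - a - b)); lra.
  - right; field.
Qed.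

Lemma sum_RInt_nodes (p : params) (f : R -> R) (N n : nat) :
  (forall x, continuous f x) ->
  sum_f_R0 (fun j => RInt f (node p N j) (node p N (S j))) n = RInt f 0 (node p N (S n)).
Proof.
  intros Cf.
  assert (Hex : forall a b, ex_RInt f a b).
  { intros; apply (ex_RInt_continuous (V := R_CompleteNormedModule)); auto. }
  assert (N0 : node p N 0 = 0) by (unfold node; simpl; ring).
  induction n as [|n IH]; [simpl; now rewrite N0|].
  change (sum_f_R0 (fun j => RInt f (node p N j) (node p N (S j))) n
    + RInt f (node p N (S n)) (node p N (S (S n))) = RInt f 0 (node p N (S (S n)))).
  rewrite IH; apply (RInt_Chasles (V := R_CompleteNormedModule)); auto.
Qed.

Lemma mesh_pos (p : params) (N : nat) : 0 < L p -> 0 < mesh p N.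
Proof.
  intros H; apply Rdiv_lt_0_compat; trivial; apply lt_0_INR; lia.
Qed.

Lemma mesh_le (p : params) (N : nat) : 0 < L p -> mesh p N <= L p.
Proof.
  intros H; unfold mesh.
  assert (1 <= INR (S N)) by (rewrite S_INR; pose proof (pos_INR N); lra).
  apply Rle_div_l; [lra|]; nra.
Qed.

Lemma node_S (p : params) (N j : nat) : node p N (S j) = node p N j + mesh p N.
Proof. unfold node; rewrite S_INR; ring. Qed.

Lemma node_last (p : params) (N : nat) : node p N (S N) = L p.
Proof.
  unfold node, mesh; field; apply not_0_INR; lia.
Qed.

Lemma node_segment (p : params) (N j : nat) :
  0 < L p -> (j <= S N)%nat -> segment (L p) (node p N j).
Proof.
  intros HL Hj; pose proof (mesh_pos p N HL).
  split; [apply Rmult_le_pos; [apply pos_INR | lra]|].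
  rewrite <- (node_last p N); apply Rmult_le_compat_r; [lra | now apply le_INR].
Qed.

Lemma density_coercive (p : params) : positive_params p ->
  exists K, 0 < K /\ forall a b c d,
    a ^ 2 + b ^ 2 + c ^ 2 + d ^ 2 <= K * density p a b c d.
Proof.
  intros [_ Hr Hm Hb Ha _ _].
  pose proof (pow2_ge_0 (gamma p)) as Pg.
  set (K := (1 + 2 * gamma p ^ 2) / alpha1 p + 2 / beta p + / rho p + / mu p).
  assert (K1 : 0 < (1 + 2 * gamma p ^ 2) / alpha1 p) by (apply Rdiv_lt_0_compat; lra).
  assert (K2 : 0 < 2 / beta p) by (apply Rdiv_lt_0_compat; lra).
  assert (K3 : 0 < / rho p) by now apply Rinv_0_lt_compat.
  assert (K4 : 0 < / mu p) by now apply Rinv_0_lt_compat.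
  exists K; split; [unfold K; lra|].
  intros a b c d.
  pose proof (pow2_ge_0 a) as Pa; pose proof (pow2_ge_0 c) as Pc; pose proof (pow2_ge_0 d) as Pd.
  pose proof (pow2_ge_0 (gamma p * a - b)) as Pq.
  assert (Q1 : 0 <= alpha1 p * a ^ 2) by (apply Rmult_le_pos; lra).
  assert (Q2 : 0 <= beta p * (gamma p * a - b) ^ 2) by (apply Rmult_le_pos; lra).
  assert (Q3 : 0 <= rho p * c ^ 2) by (apply Rmult_le_pos; lra).
  assert (Q4 : 0 <= mu p * d ^ 2) by (apply Rmult_le_pos; lra).
  assert (T1 : b ^ 2 <= 2 * (gamma p * a - b) ^ 2 + 2 * gamma p ^ 2 * a ^ 2).
  { pose proof (pow2_ge_0 (2 * (gamma p * a) - b)); nra. }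
  assert (T2 : (1 + 2 * gamma p ^ 2) * a ^ 2
      = (1 + 2 * gamma p ^ 2) / alpha1 p * (alpha1 p * a ^ 2)) by (field; lra).
  assert (T3 : 2 * (gamma p * a - b) ^ 2
      = 2 / beta p * (beta p * (gamma p * a - b) ^ 2)) by (field; lra).
  assert (T4 : c ^ 2 = / rho p * (rho p * c ^ 2)) by (field; lra).
  assert (T5 : d ^ 2 = / mu p * (mu p * d ^ 2)) by (field; lra).
  set (e := density p a b c d).
  assert (M : forall k m, 0 < k -> m <= e -> k * m <= k * e).
  { intros; apply Rmult_le_compat_l; lra. }
  pose proof (M _ (alpha1 p * a ^ 2) K1 ltac:(unfold e, density; lra)).
  pose proof (M _ (beta p * (gamma p * a - b) ^ 2) K2 ltac:(unfold e, density; lra)).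
  pose proof (M _ (rho p * c ^ 2) K3 ltac:(unfold e, density; lra)).
  pose proof (M _ (mu p * d ^ 2) K4 ltac:(unfold e, density; lra)).
  unfold K; lra.
Qed.

Lemma sqr_lin_le (a b x y : R) : (a * x + b * y) ^ 2 <= 2 * (a ^ 2 + b ^ 2) * (x ^ 2 + y ^ 2).
Proof.
  pose proof (pow2_ge_0 (a * y - b * x)); pose proof (pow2_ge_0 (a * x + b * y)); nra.
Qed.

(** D will be the energy density of [y3], a single weight for the residuals of all four
    equations. *)
Lemma trapezoid_residual_le (phi g g1 g2 D : R -> R) (a b c : R) :
  a < b -> (forall x, continuous phi x) -> (forall x, continuous g x) ->
  (forall x, continuous g1 x) -> (forall x, continuous g2 x) -> (forall x, continuous D x) ->
  (forall x, a < x < b -> is_derive phi x (g x)) ->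
  (forall x, a < x < b -> is_derive g x (g1 x)) ->
  (forall x, a < x < b -> is_derive g1 x (g2 x)) ->
  (forall x, g2 x ^ 2 <= c * D x) ->
  ((g a + g b) / 2 - (phi b - phi a) / (b - a)) ^ 2 <= c / 64 * (b - a) ^ 3 * RInt D a b.
Proof.
  intros Hab Cphi Cg Cg1 Cg2 CD D1 D2 D3 H.
  eapply Rle_trans; [now apply (trapezoid_residual phi g g1 g2)|].
  replace (c / 64 * (b - a) ^ 3 * RInt D a b) with
    ((b - a) ^ 3 / 64 * (c * RInt D a b)) by field.
  apply Rmult_le_compat_l.
  - apply Rdiv_le_0_compat; [apply pow_le|]; lra.
  - rewrite <- RInt_mult_l.
    2:{ apply (ex_RInt_continuous (V := R_CompleteNormedModule)); auto. }
    apply RInt_le; [lra | | | intros; apply H].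
    + apply (ex_RInt_continuous (V := R_CompleteNormedModule)); intros x _.
      apply (continuous_mult (K := R_AbsRing)); trivial.
      apply (continuous_mult (K := R_AbsRing)); trivial; apply continuous_const.
    + apply (ex_RInt_continuous (V := R_CompleteNormedModule)); intros x _.
      apply (continuous_mult (K := R_AbsRing)); trivial; apply continuous_const.
Qed.

(** The residuals of the [w] equations are divided by the mass densities. *)
Definition residual_density (p : params) (y0 y1 : fields (R -> R -> R)) (a b t : R) : R :=
  density p
    ((u1 y1 a t + u1 y1 b t) / 2 - (w1 y0 b t - w1 y0 a t) / (b - a))
    ((u2 y1 a t + u2 y1 b t) / 2 - (w2 y0 b t - w2 y0 a t) / (b - a))
    ((w1 y1 a t + w1 y1 b t) / 2
      - (sigma1 p (u1 y0 b t) (u2 y0 b t) / rho p - sigma1 p (u1 y0 a t) (u2 y0 a t) / rho p) / (b - a))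
    ((w2 y1 a t + w2 y1 b t) / 2
      - (sigma2 p (u1 y0 b t) (u2 y0 b t) / mu p - sigma2 p (u1 y0 a t) (u2 y0 a t) / mu p) / (b - a)).

(** In each equation a component of [y1] is the exact x-derivative of a field or scaled stress of
    [y0], so its residual is a trapezoid error. The two further space derivatives of that component
    are combinations of components of [y2] and [y3], since a space derivative is B^(-1) times a time
    derivative. *)
Lemma residual_density_le (p : params) : positive_params p ->
  exists K, 0 < K /\ forall y0 y1 y2 y3 y4,
    wave_pair p y0 y1 -> wave_pair p y1 y2 -> wave_pair p y2 y3 -> wave_pair p y3 y4 ->
    forall a b t, 0 <= a -> a < b -> b <= L p -> 0 < t ->
    residual_density p y0 y1 a b t
      <= K * (b - a) ^ 3 * RInt (fun x => density_at p y3 x t) a b.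
Proof.
  intros Hp; destruct (density_coercive p Hp) as (K & HK & Hco).
  pose proof Hp as [_ Hr Hm Hb Ha _ _].
  (* Entries of B^(-1): (u1)_x = c1 w1_t + c2 w2_t and (u2)_x = c3 w1_t + c4 w2_t. *)
  set (c1 := rho p / alpha1 p); set (c2 := gamma p * mu p / alpha1 p).
  set (c3 := gamma p * rho p / alpha1 p); set (c4 := gamma p ^ 2 * mu p / alpha1 p + mu p / beta p).
  set (A := 2 * (c1 ^ 2 + c2 ^ 2) * K); set (B := 2 * (c3 ^ 2 + c4 ^ 2) * K).
  assert (HA : 0 < A).
  { assert (0 < c1) by now apply Rdiv_lt_0_compat.
    assert (0 < c1 ^ 2) by now apply pow_lt.
    pose proof (pow2_ge_0 c2); unfold A; apply Rmult_lt_0_compat; lra. }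
  assert (HB : 0 <= B).
  { pose proof (pow2_ge_0 c3); pose proof (pow2_ge_0 c4); unfold B; apply Rmult_le_pos; lra. }
  (* An upper bound for the quadratic form [density] relative to the sum of squares. *)
  set (M := rho p + mu p + 2 * beta p * (gamma p ^ 2 + 1) + alpha1 p).
  pose proof (pow2_ge_0 (gamma p)) as Hg.
  assert (HM : 0 < M) by (unfold M; nra).
  exists (M * (2 * A + 2 * B) / 64); split.
  { apply Rdiv_lt_0_compat; [apply Rmult_lt_0_compat|]; lra. }
  intros y0 y1 y2 y3 y4 W0 W1 W2 W3 a b t H0 Hab HL Ht.
  assert (Hin : forall x, a < x < b -> 0 < x < L p) by (intros; lra).
  set (I := RInt (fun x => density_at p y3 x t) a b).
  assert (CD : forall x, continuous (fun x => density_at p y3 x t) x).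
  { intros x; apply (continuous_2d_slice_x (density_at p y3)).
    now apply continuous_2d_density with y4. }
  assert (Hu : forall c d x, (c * u1 y3 x t + d * u2 y3 x t) ^ 2
      <= 2 * (c ^ 2 + d ^ 2) * K * density_at p y3 x t).
  { intros c d x; eapply Rle_trans; [apply sqr_lin_le|].
    rewrite (Rmult_assoc (2 * (c ^ 2 + d ^ 2))); apply Rmult_le_compat_l.
    - pose proof (pow2_ge_0 c); pose proof (pow2_ge_0 d); lra.
    - eapply Rle_trans; [|apply Hco].
      pose proof (pow2_ge_0 (w1 y3 x t)); pose proof (pow2_ge_0 (w2 y3 x t)); lra. }
  assert (Hw : forall c d x, (c * w1 y3 x t + d * w2 y3 x t) ^ 2
      <= 2 * (c ^ 2 + d ^ 2) * K * density_at p y3 x t).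
  { intros c d x; eapply Rle_trans; [apply sqr_lin_le|].
    rewrite (Rmult_assoc (2 * (c ^ 2 + d ^ 2))); apply Rmult_le_compat_l.
    - pose proof (pow2_ge_0 c); pose proof (pow2_ge_0 d); lra.
    - eapply Rle_trans; [|apply Hco].
      pose proof (pow2_ge_0 (u1 y3 x t)); pose proof (pow2_ge_0 (u2 y3 x t)); lra. }
  pose proof (wp_x_u1 _ _ _ W0) as X1; pose proof (wp_x_u2 _ _ _ W0) as X2.
  pose proof W0 as []; pose proof W1 as []; pose proof W2 as []; pose proof W3 as [].
  unfold residual_density.
  set (r1 := (u1 y1 a t + u1 y1 b t) / 2 - (w1 y0 b t - w1 y0 a t) / (b - a)).
  set (r2 := (u2 y1 a t + u2 y1 b t) / 2 - (w2 y0 b t - w2 y0 a t) / (b - a)).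
  set (r3 := (w1 y1 a t + w1 y1 b t) / 2 - _).
  set (r4 := (w2 y1 a t + w2 y1 b t) / 2 - _).
  assert (E1 : r1 ^ 2 <= A / 64 * (b - a) ^ 3 * I).
  { apply (trapezoid_residual_le (fun x => w1 y0 x t) (fun x => u1 y1 x t)
      (fun x => c1 * w1 y2 x t + c2 * w2 y2 x t) (fun x => c1 * u1 y3 x t + c2 * u2 y3 x t));
      trivial; try (intros; apply Hu).
    - intros x; now apply continuous_2d_slice_x.
    - intros x; now apply continuous_2d_slice_x.
    - intros x; apply (continuous_2d_slice_x (fun x t => c1 * w1 y2 x t + c2 * w2 y2 x t)); solve_2d.
    - intros x; apply (continuous_2d_slice_x (fun x t => c1 * u1 y3 x t + c2 * u2 y3 x t)); solve_2d.
    - auto.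
    - intros x Hx; replace (c1 * w1 y2 x t + c2 * w2 y2 x t) with
        ((rho p * w1 y2 x t + gamma p * (mu p * w2 y2 x t)) / alpha1 p)
        by (unfold c1, c2; field; lra); auto.
    - intros x Hx; apply (is_derive_lin (fun x => w1 y2 x t) (fun x => w2 y2 x t)); auto. }
  assert (E2 : r2 ^ 2 <= B / 64 * (b - a) ^ 3 * I).
  { apply (trapezoid_residual_le (fun x => w2 y0 x t) (fun x => u2 y1 x t)
      (fun x => c3 * w1 y2 x t + c4 * w2 y2 x t) (fun x => c3 * u1 y3 x t + c4 * u2 y3 x t));
      trivial; try (intros; apply Hu).
    - intros x; now apply continuous_2d_slice_x.
    - intros x; now apply continuous_2d_slice_x.
    - intros x; apply (continuous_2d_slice_x (fun x t => c3 * w1 y2 x t + c4 * w2 y2 x t)); solve_2d.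
    - intros x; apply (continuous_2d_slice_x (fun x t => c3 * u1 y3 x t + c4 * u2 y3 x t)); solve_2d.
    - auto.
    - intros x Hx; replace (c3 * w1 y2 x t + c4 * w2 y2 x t) with
        (gamma p * ((rho p * w1 y2 x t + gamma p * (mu p * w2 y2 x t)) / alpha1 p)
         + mu p * w2 y2 x t / beta p)
        by (unfold c3, c4; field; lra); auto.
    - intros x Hx; apply (is_derive_lin (fun x => w1 y2 x t) (fun x => w2 y2 x t)); auto. }
  assert (E3 : r3 ^ 2 <= A / 64 * (b - a) ^ 3 * I).
  { apply (trapezoid_residual_le (fun x => sigma1 p (u1 y0 x t) (u2 y0 x t) / rho p)
      (fun x => w1 y1 x t) (fun x => u1 y2 x t)
      (fun x => c1 * w1 y3 x t + c2 * w2 y3 x t));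
      trivial; try (intros; apply Hw).
    - intros x; apply (continuous_2d_slice_x
        (fun x t => sigma1 p (u1 y0 x t) (u2 y0 x t) * / rho p)); unfold sigma1; solve_2d.
    - intros x; now apply continuous_2d_slice_x.
    - intros x; now apply continuous_2d_slice_x.
    - intros x; apply (continuous_2d_slice_x (fun x t => c1 * w1 y3 x t + c2 * w2 y3 x t)); solve_2d.
    - intros x Hx; apply Hin in Hx; unfold sigma1.
      specialize (X1 x t Hx Ht); specialize (X2 x t Hx Ht).
      auto_derive; [repeat split; eexists; eassumption|].
      rewrite_derive; rewrite alpha_eq; field; lra.
    - auto.
    - intros x Hx; replace (c1 * w1 y3 x t + c2 * w2 y3 x t) with
        ((rho p * w1 y3 x t + gamma p * (mu p * w2 y3 x t)) / alpha1 p)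
        by (unfold c1, c2; field; lra); auto. }
  assert (E4 : r4 ^ 2 <= B / 64 * (b - a) ^ 3 * I).
  { apply (trapezoid_residual_le (fun x => sigma2 p (u1 y0 x t) (u2 y0 x t) / mu p)
      (fun x => w2 y1 x t) (fun x => u2 y2 x t)
      (fun x => c3 * w1 y3 x t + c4 * w2 y3 x t));
      trivial; try (intros; apply Hw).
    - intros x; apply (continuous_2d_slice_x
        (fun x t => sigma2 p (u1 y0 x t) (u2 y0 x t) * / mu p)); unfold sigma2; solve_2d.
    - intros x; now apply continuous_2d_slice_x.
    - intros x; now apply continuous_2d_slice_x.
    - intros x; apply (continuous_2d_slice_x (fun x t => c3 * w1 y3 x t + c4 * w2 y3 x t)); solve_2d.
    - intros x Hx; apply Hin in Hx; unfold sigma2.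
      specialize (X1 x t Hx Ht); specialize (X2 x t Hx Ht).
      auto_derive; [repeat split; eexists; eassumption|].
      rewrite_derive; field; lra.
    - auto.
    - intros x Hx; replace (c3 * w1 y3 x t + c4 * w2 y3 x t) with
        (gamma p * ((rho p * w1 y3 x t + gamma p * (mu p * w2 y3 x t)) / alpha1 p)
         + mu p * w2 y3 x t / beta p)
        by (unfold c3, c4; field; lra); auto. }
  clearbody r1 r2 r3 r4.
  apply Rle_trans with (M * (r1 ^ 2 + r2 ^ 2 + r3 ^ 2 + r4 ^ 2)).
  - pose proof (pow2_ge_0 r1); pose proof (pow2_ge_0 r2);
    pose proof (pow2_ge_0 r3); pose proof (pow2_ge_0 r4).
    assert (Q : (gamma p * r1 - r2) ^ 2 <= 2 * (gamma p ^ 2 + 1) * (r1 ^ 2 + r2 ^ 2)).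
    { replace (gamma p * r1 - r2) with (gamma p * r1 + (-1) * r2) by ring.
      eapply Rle_trans; [apply sqr_lin_le | right; ring]. }
    assert (Q' : beta p * (gamma p * r1 - r2) ^ 2
      <= 2 * beta p * (gamma p ^ 2 + 1) * (r1 ^ 2 + r2 ^ 2)).
    { apply (Rmult_le_compat_l (beta p)) in Q; lra. }
    assert (0 <= 2 * beta p * (gamma p ^ 2 + 1)) by (repeat apply Rmult_le_pos; lra).
    unfold density, M.
    set (m := 2 * beta p * (gamma p ^ 2 + 1)) in *.
    set (s1 := r1 ^ 2) in *; set (s2 := r2 ^ 2) in *;
    set (s3 := r3 ^ 2) in *; set (s4 := r4 ^ 2) in *.
    clear - Q' H H1 H2 H3 H4 Hr Hm Ha; nra.
  - apply Rle_trans with (M * (2 * (A / 64 * (b - a) ^ 3 * I) + 2 * (B / 64 * (b - a) ^ 3 * I))).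
    + apply Rmult_le_compat_l; lra.
    + right; field.
Qed.

(** * The discrete energy identity *)

Lemma is_derive_sum_f_R0 (f : nat -> R -> R) (df : nat -> R) (t : R) (n : nat) :
  (forall j, (j <= n)%nat -> is_derive (f j) t (df j)) ->
  is_derive (fun s => sum_f_R0 (fun j => f j s) n) t (sum_f_R0 df n).
Proof.
  induction n as [|n IH]; intros H; simpl; [now apply H|].
  apply (is_derive_plus (K := R_AbsRing) (V := R_NormedModule)
    (fun s => sum_f_R0 (fun j => f j s) n) (f (S n))); auto.
Qed.

Lemma sum_f_R0_telescope (f : nat -> R) (n : nat) :
  sum_f_R0 (fun j => f (S j) - f j) n = f (S n) - f 0%nat.
Proof. induction n as [|n IH]; simpl in *; [|rewrite IH]; ring. Qed.

Definition grid_density (p : params) (z : fields (nat -> R -> R)) (j : nat) (t : R) : R :=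
  density p (half (u1 z) j t) (half (u2 z) j t) (half (w1 z) j t) (half (w2 z) j t).

(** The work done by the right-hand sides of the scheme on cell j, per unit length and time. The w
    defects are divided by the mass densities to become the velocity part of a time derivative. *)
Definition defect_power (p : params) (N : nat) (z : fields (nat -> R -> R)) (j : nat) (t : R) : R :=
  density' p (half (u1 z) j t) (half (u2 z) j t) (half (w1 z) j t) (half (w2 z) j t)
    (defect_u1 p N z j t) (defect_u2 p N z j t)
    (defect_w1 p N z j t / rho p) (defect_w2 p N z j t / mu p).

Definition defect_density (p : params) (N : nat) (z : fields (nat -> R -> R)) (j : nat) (t : R) : R :=
  density p (defect_u1 p N z j t) (defect_u2 p N z j t)
    (defect_w1 p N z j t / rho p) (defect_w2 p N z j t / mu p).

Definition grid_power (p : params) (N : nat) (z : fields (nat -> R -> R)) (t : R) : R :=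
  k1 p * w1 z (S N) t ^ 2 + k2 p * w2 z (S N) t ^ 2.

Lemma energy_ORFD_density (p : params) (N : nat) (z : fields (nat -> R -> R)) (t : R) :
  energy_ORFD p N z t = mesh p N / 2 * sum_f_R0 (fun j => grid_density p z j t) N.
Proof.
  unfold energy_ORFD; f_equal; apply sum_eq; intros j _.
  rewrite !pow2_abs; reflexivity.
Qed.

Lemma is_derive_on_half (D : R -> Prop) (U : nat -> R -> R) (j : nat) (t a b : R) :
  D t -> is_derive_on D (U j) t a -> is_derive_on D (U (S j)) t b ->
  is_derive_on D (half U j) t ((a + b) / 2).
Proof.
  intros Dt Ha Hb.
  replace ((a + b) / 2) with (/ 2 * a + / 2 * b + 0 * b) by field.
  apply (is_derive_on_lin3 D (U j) (U (S j)) (U (S j))); trivial.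
  intros; unfold half; field.
Qed.

Lemma is_derive_half (U : nat -> R -> R) (j : nat) (t : R) :
  0 < t -> ex_derive_on nonneg_time (U j) t -> ex_derive_on nonneg_time (U (S j)) t ->
  is_derive (half U j) t (Dt (half U j) t).
Proof.
  intros Ht [a Ha] [b Hb].
  assert (T : nonneg_time t) by (unfold nonneg_time; lra).
  apply is_derive_on_interior with nonneg_time; [now apply locally_nonneg_time|].
  apply Derive_on_correct; trivial; [now apply limit_point_nonneg_time|].
  eexists; now apply is_derive_on_half; eassumption.
Qed.

Section Grid.
Variables (p : params) (N : nat) (z : fields (nat -> R -> R)).
Hypotheses (Hp : positive_params p) (Hd : grid_differentiable N z) (Hb : grid_boundary p N z).

Lemma energy_ORFD_nonneg (t : R) : 0 <= energy_ORFD p N z t.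
Proof.
  rewrite energy_ORFD_density.
  pose proof (mesh_pos p N (L_pos p Hp)).
  apply Rmult_le_pos; [lra|].
  apply cond_pos_sum; intros; now apply density_nonneg.
Qed.

Lemma energy_ORFD_right_continuous : right_continuous (energy_ORFD p N z).
Proof.
  assert (Hh : forall U, (forall j, (j <= S N)%nat -> ex_derive_on nonneg_time (U j) 0) ->
    forall j, (j <= N)%nat -> right_continuous (half U j)).
  { intros U HU j Hj; apply is_derive_on_right_continuous.
    destruct (HU j ltac:(lia)) as [a Ha]; destruct (HU (S j) ltac:(lia)) as [b Hb'].
    eexists; apply is_derive_on_half; try eassumption; unfold nonneg_time; lra. }
  assert (Hs : forall n, (n <= N)%nat ->
    right_continuous (fun t => sum_f_R0 (fun j => grid_density p z j t) n)).
  { assert (Hj : forall j, (j <= N)%nat -> right_continuous (grid_density p z j)).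
    { intros j Hj.
      assert (H1 : right_continuous (half (u1 z) j)) by (apply Hh; trivial; intros i Hi; apply (Hd i 0 Hi); lra).
      assert (H2 : right_continuous (half (u2 z) j)) by (apply Hh; trivial; intros i Hi; apply (Hd i 0 Hi); lra).
      assert (H3 : right_continuous (half (w1 z) j)) by (apply Hh; trivial; intros i Hi; apply (Hd i 0 Hi); lra).
      assert (H4 : right_continuous (half (w2 z) j)) by (apply Hh; trivial; intros i Hi; apply (Hd i 0 Hi); lra).
      assert (Hc : forall c f, right_continuous f -> right_continuous (fun t => c * f t)).
      { intros c f Hf; apply right_continuous_mult; trivial; apply right_continuous_const. }
      unfold grid_density, density.
      repeat apply right_continuous_plus; apply Hc, right_continuous_sqr; trivial.
      apply right_continuous_minus; trivial; now apply Hc. }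
    intros n; induction n as [|n IH]; intros Hn; simpl; [now apply Hj|].
    apply right_continuous_plus; [apply IH; lia | now apply Hj]. }
  unfold right_continuous.
  apply continuous_ext with (fun t => mesh p N / 2 *
    sum_f_R0 (fun j => grid_density p z j (Rmax 0 t)) N).
  { intros t; now rewrite energy_ORFD_density. }
  apply (continuous_mult (K := R_AbsRing)); [apply continuous_const|].
  exact (Hs N (Nat.le_refl N)).
Qed.

(** The midpoint average satisfies an exact product rule, half(f) delta(g) + half(g) delta(f) =
    delta(f g). The flux sigma1 w1 + sigma2 w2 therefore telescopes as in the continuous case, and
    no numerical dissipation or remainder appears. *)
Lemma is_derive_energy_ORFD (t : R) : 0 < t ->
  is_derive (energy_ORFD p N z) t
    (- grid_power p N z t + mesh p N * sum_f_R0 (fun j => defect_power p N z j t) N).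
Proof.
  intros Ht.
  pose proof (mesh_pos p N (L_pos p Hp)) as Hh.
  destruct Hp as [_ Hr Hm Hbe Ha _ _].
  set (P := fun j => sigma1 p (u1 z j t) (u2 z j t) * w1 z j t
     + sigma2 p (u1 z j t) (u2 z j t) * w2 z j t).
  apply is_derive_ext with (fun s => mesh p N / 2 * sum_f_R0 (fun j => grid_density p z j s) N).
  { intros s; now rewrite energy_ORFD_density. }
  replace (- grid_power p N z t) with (P (S N) - P 0%nat).
  2:{ destruct (Hb t (Rlt_le _ _ Ht)) as (B1 & B2 & B3 & B4).
      unfold P, sigma1, sigma2, grid_power; rewrite B1, B2, B3, B4; ring. }
  rewrite <- (sum_f_R0_telescope P).
  replace (sum_f_R0 (fun j => P (S j) - P j) N + mesh p N * sum_f_R0 (fun j => defect_power p N z j t) N)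
    with (mesh p N / 2 * sum_f_R0 (fun j => 2 * ((P (S j) - P j) / mesh p N + defect_power p N z j t)) N).
  - apply is_derive_scal, is_derive_sum_f_R0; intros j Hj.
    destruct (Hd j t ltac:(lia) (Rlt_le _ _ Ht)) as (D1 & D2 & D3 & D4).
    destruct (Hd (S j) t ltac:(lia) (Rlt_le _ _ Ht)) as (D1' & D2' & D3' & D4').
    pose proof (is_derive_density p _ _ _ _ t _ _ _ _
      (is_derive_half (u1 z) j t Ht D1 D1') (is_derive_half (u2 z) j t Ht D2 D2')
      (is_derive_half (w1 z) j t Ht D3 D3') (is_derive_half (w2 z) j t Ht D4 D4')) as Hder.
    match type of Hder with is_derive _ _ ?e =>
      replace (2 * ((P (S j) - P j) / mesh p N + defect_power p N z j t)) with e end.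
    + exact Hder.
    + unfold P, sigma1, sigma2, defect_power, density', defect_u1, defect_u2, defect_w1,
        defect_w2, delta.
      set (d1 := Dt _ _); set (d2 := Dt _ _); set (d3 := Dt _ _); set (d4 := Dt _ _).
      unfold half; rewrite alpha_eq; field; lra.
  - rewrite (scal_sum _ N (mesh p N)), (scal_sum _ N (mesh p N / 2)), <- plus_sum.
    apply sum_eq; intros j _; field; lra.
Qed.

(** Young's inequality in the energy inner product. The weight e is kept free because a
    time-dependent, integrable choice will be made. *)
Lemma defect_power_le (j : nat) (t e : R) : 0 < e ->
  defect_power p N z j t
    <= / (2 * e) * defect_density p N z j t + e / 2 * grid_density p z j t.
Proof.
  intros He; destruct Hp as [_ Hr Hm Hbe Ha _ _].
  unfold defect_power, defect_density, grid_density, density, density'.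
  set (a := half (u1 z) j t); set (b := half (u2 z) j t);
  set (c := half (w1 z) j t); set (d := half (w2 z) j t).
  set (a' := defect_u1 p N z j t); set (b' := defect_u2 p N z j t);
  set (c' := defect_w1 p N z j t / rho p); set (d' := defect_w2 p N z j t / mu p).
  assert (Y : forall k x y, 0 < k -> k * x * y <= / (2 * e) * (k * y ^ 2) + e / 2 * (k * x ^ 2)).
  { intros k x y Hk.
    assert (Q : 0 <= k * (/ (2 * e) * (y - e * x) ^ 2)).
    { apply Rmult_le_pos; [lra|]; apply Rmult_le_pos; [|apply pow2_ge_0].
      left; apply Rinv_0_lt_compat; lra. }
    replace (k * (/ (2 * e) * (y - e * x) ^ 2)) with
      (/ (2 * e) * (k * y ^ 2) + e / 2 * (k * x ^ 2) - k * x * y) in Q by (field; lra).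
    lra. }
  pose proof (Y _ a a' Ha); pose proof (Y _ c c' Hr); pose proof (Y _ d d' Hm).
  pose proof (Y _ (gamma p * a - b) (gamma p * a' - b') Hbe).
  lra.
Qed.

End Grid.

(** * The error system *)

Lemma Dt_half_minus (U V : nat -> R -> R) (j : nat) (t : R) : 0 <= t ->
  ex_derive_on nonneg_time (U j) t -> ex_derive_on nonneg_time (U (S j)) t ->
  ex_derive_on nonneg_time (V j) t -> ex_derive_on nonneg_time (V (S j)) t ->
  Dt (half (fun i s => U i s - V i s) j) t = Dt (half U j) t - Dt (half V j) t.
Proof.
  intros Ht [a Ha] [b Hb] [c Hc] [d Hd].
  pose proof (limit_point_nonneg_time t Ht) as Acc.
  assert (HU := is_derive_on_half nonneg_time U j t a b Ht Ha Hb).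
  assert (HV := is_derive_on_half nonneg_time V j t c d Ht Hc Hd).
  unfold Dt.
  rewrite (Derive_on_unique nonneg_time _ _ _ Ht Acc HU), (Derive_on_unique nonneg_time _ _ _ Ht Acc HV).
  apply Derive_on_unique; trivial.
  replace ((a + b) / 2 - (c + d) / 2) with (1 * ((a + b) / 2) + (-1) * ((c + d) / 2) + 0 * ((c + d) / 2))
    by field.
  apply (is_derive_on_lin3 _ (half U j) (half V j) (half V j)); trivial.
  intros; unfold half; field.
Qed.

Lemma ex_derive_on_minus (D : R -> Prop) (f g : R -> R) (t : R) :
  D t -> ex_derive_on D f t -> ex_derive_on D g t -> ex_derive_on D (fun s => f s - g s) t.
Proof.
  intros Ht [a Ha] [b Hb]; exists (1 * a + (-1) * b + 0 * b).
  apply (is_derive_on_lin3 _ f g g); trivial; intros; ring.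
Qed.

Lemma continuous_zero_at_0 (f : R -> R) :
  continuous f 0 -> (forall t, 0 < t -> f t = 0) -> forall t, 0 <= t -> f t = 0.
Proof.
  intros Hc H t Ht; destruct (Rle_lt_or_eq_dec _ _ Ht) as [|<-]; [now apply H|].
  destruct (Req_dec (f 0) 0) as [|Hne]; trivial; exfalso.
  assert (He : 0 < Rabs (f 0)) by now apply Rabs_pos_lt.
  destruct (proj1 (filterlim_locally f (f 0)) Hc (mkposreal _ He)) as [d Hd].
  pose proof (cond_pos d).
  assert (B : ball 0 d (d / 2)).
  { change (Rabs (d / 2 - 0) < d); apply Rabs_lt_between; lra. }
  specialize (Hd _ B); change (Rabs (f (d / 2) - f 0) < Rabs (f 0)) in Hd.
  rewrite H, Rminus_0_l, Rabs_Ropp in Hd by lra; lra.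
Qed.

Section Scheme.
Variables (p : params) (v0 v1 p0 p1 : R -> R) (y y0 y1 : fields (R -> R -> R)).
Hypotheses (Hp : positive_params p) (HP : solves_PDE p v0 v1 p0 p1 y)
  (Hclamp : all_fields2 (clamp_of (L p)) y y0)
  (Hder : all_fields2 (fun f f' => forall x t, segment (L p) x -> 0 <= t ->
      is_derive_on nonneg_time (f x) t (f' x t)) y y1)
  (W0 : wave_pair p y0 y1).

Lemma clamp_of_eq (f g : R -> R -> R) (x t : R) :
  clamp_of (L p) f g -> segment (L p) x -> 0 <= t -> f x t = g x t.
Proof. intros E Hx Ht; now rewrite E, clamp_id, Rmax_right by assumption. Qed.

(** The continuous problem imposes the boundary conditions for t > 0 only, while the discrete ones
    include t = 0; continuity of the clamped extension closes the gap. *)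
Lemma boundary_conditions_closed (t : R) : 0 <= t -> boundary_conditions p y t.
Proof.
  intros Ht; pose proof (L_pos p Hp) as HL.
  assert (S0 : segment (L p) 0) by (unfold segment; lra).
  assert (SL : segment (L p) (L p)) by (unfold segment; lra).
  destruct Hclamp as (E1 & E2 & E3 & E4).
  unfold boundary_conditions.
  rewrite (clamp_of_eq _ _ 0 t E3), (clamp_of_eq _ _ 0 t E4), (clamp_of_eq _ _ (L p) t E1),
    (clamp_of_eq _ _ (L p) t E2), (clamp_of_eq _ _ (L p) t E3), (clamp_of_eq _ _ (L p) t E4)
    by assumption.
  pose proof (wave_pair_boundary p y0 y1 W0) as B.
  pose proof (wp_cont_u1 _ _ _ W0); pose proof (wp_cont_u2 _ _ _ W0);
  pose proof (wp_cont_w1 _ _ _ W0); pose proof (wp_cont_w2 _ _ _ W0).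
  split; [|split; [|split]].
  - apply (continuous_zero_at_0 (fun t => w1 y0 0 t)); trivial.
    + now apply continuous_2d_slice_t.
    + intros s Hs; apply (B s Hs).
  - apply (continuous_zero_at_0 (fun t => w2 y0 0 t)); trivial.
    + now apply continuous_2d_slice_t.
    + intros s Hs; apply (B s Hs).
  - apply Rminus_diag_uniq.
    apply (continuous_zero_at_0 (fun t => sigma1 p (u1 y0 (L p) t) (u2 y0 (L p) t)
      - - k1 p * w1 y0 (L p) t)); trivial.
    + apply (continuous_2d_slice_t (fun x t => sigma1 p (u1 y0 x t) (u2 y0 x t)
        - - k1 p * w1 y0 x t)); unfold sigma1; solve_2d.
    + intros s Hs; apply Rminus_diag_eq, (B s Hs).
  - apply Rminus_diag_uniq.
    apply (continuous_zero_at_0 (fun t => sigma2 p (u1 y0 (L p) t) (u2 y0 (L p) t)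
      - - k2 p * w2 y0 (L p) t)); trivial.
    + apply (continuous_2d_slice_t (fun x t => sigma2 p (u1 y0 x t) (u2 y0 x t)
        - - k2 p * w2 y0 x t)); unfold sigma2; solve_2d.
    + intros s Hs; apply Rminus_diag_eq, (B s Hs).
Qed.

Lemma nodal_differentiable (N : nat) : grid_differentiable N (nodal p N y).
Proof.
  intros j t Hj Ht; pose proof (node_segment p N j (L_pos p Hp) Hj) as S.
  destruct Hder as (D1 & D2 & D3 & D4).
  unfold nodal; simpl; repeat split; eexists; eauto.
Qed.

Lemma error_system (N : nat) (z : fields (nat -> R -> R)) :
  solves_scheme p v0 v1 p0 p1 N z ->
  solves_error_system p N (nodal p N y) (grid_minus (nodal p N y) z).
Proof.
  intros (Hz & Hdz & Hbz & Hiz).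
  pose proof (nodal_differentiable N) as HY.
  pose proof (L_pos p Hp) as HL.
  split; [|split; [|split]].
  - intros j t Hj Ht.
    destruct (HY j t Hj Ht) as (? & ? & ? & ?), (Hz j t Hj Ht) as (? & ? & ? & ?).
    unfold grid_minus; simpl; split; [|split; [|split]]; now apply ex_derive_on_minus.
  - intros j t Hj Ht.
    destruct (HY j t ltac:(lia) Ht) as (A1 & A2 & A3 & A4),
      (HY (S j) t ltac:(lia) Ht) as (B1 & B2 & B3 & B4),
      (Hz j t ltac:(lia) Ht) as (C1 & C2 & C3 & C4),
      (Hz (S j) t ltac:(lia) Ht) as (D1 & D2 & D3 & D4).
    destruct (Hdz j t Hj Ht) as (Z1 & Z2 & Z3 & Z4).
    pose proof (mesh_pos p N HL) as Hh.
    unfold defect_u1, defect_u2, defect_w1, defect_w2, delta in *.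
    unfold grid_minus; cbn [u1 u2 w1 w2].
    rewrite !Dt_half_minus by assumption.
    unfold Rdiv in *.
    split; [|split; [|split]]; lra.
  - intros t Ht.
    destruct (boundary_conditions_closed t Ht) as (B1 & B2 & B3 & B4).
    destruct (Hbz t Ht) as (Z1 & Z2 & Z3 & Z4).
    unfold sigma1, sigma2 in *.
    unfold grid_minus, nodal; cbn [u1 u2 w1 w2].
    rewrite node_last.
    replace (node p N 0) with 0 by (unfold node; simpl; ring).
    repeat split; lra.
  - intros j Hj.
    pose proof (node_segment p N j HL Hj) as Hs.
    destruct (proj2 (proj2 HP) _ Hs) as (I1 & I2 & I3 & I4).
    destruct (Hiz j Hj) as (Z1 & Z2 & Z3 & Z4).
    pose proof (limit_point_segment _ _ HL Hs) as Acc.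
    unfold grid_minus, nodal; cbn [u1 u2 w1 w2].
    rewrite Z1, Z2, Z3, Z4, (Derive_on_unique (segment (L p)) _ _ _ Hs Acc I1),
      (Derive_on_unique (segment (L p)) _ _ _ Hs Acc I3), I2, I4; repeat split; ring.
Qed.

(** With the nodal time derivatives given by [y1], the truncation error becomes a purely spatial
    quadrature error at fixed t, to which the trapezoid estimate applies. *)
Lemma nodal_defect_density (N j : nat) (t : R) : (j <= N)%nat -> 0 <= t ->
  defect_density p N (nodal p N y) j t
    = residual_density p y0 y1 (node p N j) (node p N (S j)) t.
Proof.
  intros Hj Ht; pose proof (L_pos p Hp) as HL.
  pose proof (rho_pos p Hp); pose proof (mu_pos p Hp).
  pose proof (mesh_pos p N HL) as Hh.
  assert (S1 := node_segment p N j HL ltac:(lia)).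
  assert (S2 := node_segment p N (S j) HL ltac:(lia)).
  pose proof (limit_point_nonneg_time t Ht) as Acc.
  destruct Hclamp as (E1 & E2 & E3 & E4), Hder as (D1 & D2 & D3 & D4).
  assert (HD : forall f f' : R -> R -> R, (forall x t, segment (L p) x -> 0 <= t ->
      is_derive_on nonneg_time (f x) t (f' x t)) ->
    Dt (half (fun i s => f (node p N i) s) j) t
      = (f' (node p N j) t + f' (node p N (S j)) t) / 2).
  { intros f f' Hf; apply Derive_on_unique; trivial.
    apply (is_derive_on_half nonneg_time (fun i s => f (node p N i) s)); auto. }
  unfold defect_density, residual_density, defect_u1, defect_u2, defect_w1, defect_w2, delta,
    nodal; cbn [u1 u2 w1 w2].
  rewrite (HD _ _ D1), (HD _ _ D2), (HD _ _ D3), (HD _ _ D4).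
  rewrite !(clamp_of_eq _ _ _ t E1), !(clamp_of_eq _ _ _ t E2), !(clamp_of_eq _ _ _ t E3),
    !(clamp_of_eq _ _ _ t E4) by assumption.
  replace (node p N (S j) - node p N j) with (mesh p N) by (rewrite node_S; ring).
  unfold sigma1, sigma2; f_equal; field; lra.
Qed.

Lemma energy_clamp (t : R) : 0 <= t -> energy p y t = energy p y0 t.
Proof.
  intros Ht; pose proof (L_pos p Hp) as HL.
  destruct Hclamp as (E1 & E2 & E3 & E4).
  unfold energy; f_equal; apply RInt_ext.
  rewrite Rmin_left, Rmax_right by lra; intros x Hx.
  assert (S : segment (L p) x) by (unfold segment; lra).
  now rewrite (clamp_of_eq _ _ x t E1), (clamp_of_eq _ _ x t E2), (clamp_of_eq _ _ x t E3),
    (clamp_of_eq _ _ x t E4).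
Qed.

End Scheme.

(** * Comparison of the two energies *)

(** The square root of the decay factor of the energies, since residuals enter through their norm.
    Its integral over [0, t], [decay_primitive], is bounded both by t and by 2 / omega, which are
    the short-time and long-time regimes of the final estimate. *)
Definition decay (omega t : R) : R := exp (- (omega / 2) * t).
Definition decay_primitive (omega t : R) : R := 2 / omega * (1 - decay omega t).

Lemma is_derive_decay_primitive (omega t : R) : 0 < omega ->
  is_derive (decay_primitive omega) t (decay omega t).
Proof.
  intros H; unfold decay_primitive, decay; auto_derive; trivial; field; lra.
Qed.

Lemma decay_primitive_0 (omega : R) : decay_primitive omega 0 = 0.
Proof. unfold decay_primitive, decay; rewrite Rmult_0_r, exp_0; ring. Qed.

Lemma decay_primitive_le (omega t : R) : 0 < omega ->
  decay_primitive omega t <= 2 / omega.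
Proof.
  intros H; unfold decay_primitive.
  assert (0 < 2 / omega) by (apply Rdiv_lt_0_compat; lra).
  pose proof (exp_pos (- (omega / 2) * t)); unfold decay; nra.
Qed.

Lemma decay_primitive_le_id (omega t : R) : 0 < omega -> decay_primitive omega t <= t.
Proof.
  intros H; unfold decay_primitive.
  pose proof (exp_ineq1_le (- (omega / 2) * t)) as B; fold (decay omega t) in B.
  apply Rle_trans with (2 / omega * (omega / 2 * t)); [|right; field; lra].
  apply Rmult_le_compat_l; [left; apply Rdiv_lt_0_compat|]; lra.
Qed.

Lemma decay_primitive_right_continuous (omega : R) : 0 < omega ->
  right_continuous (decay_primitive omega).
Proof.
  intros H; apply continuous_right_continuous.
  apply (ex_derive_continuous (K := R_AbsRing) (V := R_NormedModule)).
  eexists; now apply is_derive_decay_primitive.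
Qed.

(** With e = a - b, the difference is 2 a e - e^2. Only a, the trace of the exact solution, is
    charged with the weight lambda, so no separate bound on the discrete trace is required. *)
Lemma sqr_diff_le (lambda a b : R) : 0 < lambda ->
  Rabs (a ^ 2 - b ^ 2) <= lambda * a ^ 2 + (/ lambda + 1) * (a - b) ^ 2.
Proof.
  intros H; set (e := a - b); replace b with (a - e) by (unfold e; ring); clearbody e.
  pose proof (pow2_ge_0 e) as Pe.
  assert (Hl : 0 < / lambda) by now apply Rinv_0_lt_compat.
  assert (Q1 : 0 <= / lambda * (lambda * a - e) ^ 2)
    by (apply Rmult_le_pos; [lra | apply pow2_ge_0]).
  assert (Q2 : 0 <= / lambda * (lambda * a + e) ^ 2)
    by (apply Rmult_le_pos; [lra | apply pow2_ge_0]).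
  replace (/ lambda * (lambda * a - e) ^ 2) with
    (lambda * a ^ 2 - 2 * a * e + / lambda * e ^ 2) in Q1 by (field; lra).
  replace (/ lambda * (lambda * a + e) ^ 2) with
    (lambda * a ^ 2 + 2 * a * e + / lambda * e ^ 2) in Q2 by (field; lra).
  apply Rabs_le; split; lra.
Qed.

(** [lambda] stays free here, with constants independent of it, because it will be chosen as a
    function of t and h. *)
Lemma energy_difference (p : params) (v0 v1 p0 p1 : R -> R) (y : fields (R -> R -> R)) :
  positive_params p -> regular p y -> solves_PDE p v0 v1 p0 p1 y ->
  exists omega C, 0 < omega /\ 0 <= C /\ 0 <= energy p y 0 /\
    forall N z, solves_scheme p v0 v1 p0 p1 N z ->
      solves_error_system p N (nodal p N y) (grid_minus (nodal p N y) z) /\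
      forall lambda t, 0 < lambda -> 0 <= t ->
        Rabs (energy_ORFD p N z t - energy p y t)
          <= Rabs (energy_ORFD p N z 0 - energy p y 0) + lambda * energy p y 0
             + (/ lambda + 1) * (C * mesh p N ^ 4 * decay_primitive omega t).
Proof.
  intros Hp HR HP.
  destruct (regular_wave_chain p v0 v1 p0 p1 y Hp HR HP)
    as (y0 & y1 & y2 & y3 & y4 & Hclamp & Hder & W0 & W1 & W2 & W3).
  destruct (energy_decay p Hp) as (omega & Hom & Hdec).
  destruct (residual_density_le p Hp) as (K & HK & Hres).
  pose proof (L_pos p Hp) as HL.
  set (E3 := energy p y3 0).
  assert (HE3 : 0 <= E3) by now apply energy_nonneg with y4.
  set (C1 := 3 * K * E3).
  assert (HC1 : 0 <= C1) by (unfold C1; apply Rmult_le_pos; lra).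
  (* [C1] collects the constants of the residual estimate and of the decay; the exponential bounds
     the Gronwall factor, as the integral of [decay omega] is at most 2 / omega. *)
  set (C := C1 * exp (2 / omega)).
  assert (HC : 0 <= C) by (apply Rmult_le_pos; trivial; left; apply exp_pos).
  exists omega, C; split; [trivial|]; split; [trivial|]; split.
  { rewrite (energy_clamp p y y0) by (trivial; lra); now apply energy_nonneg with y1. }
  intros N z Hz.
  pose proof (error_system p v0 v1 p0 p1 y y0 y1 Hp HP Hclamp Hder W0 N z Hz) as He.
  split; [exact He|].
  set (Y := nodal p N y) in *; set (e := grid_minus Y z) in *.
  destruct He as (Ge & Se & Be & Ie).
  destruct Hz as (Gz & Sz & Bz & _).
  pose proof (mesh_pos p N HL) as Hh; set (h := mesh p N) in *.
  assert (Hh4 : 0 < h ^ 4) by now apply pow_lt.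
  (* The power fed into the error energy by the residuals. Young's inequality with weight d =
     [decay omega t] makes both parts integrable in time: the residuals contribute d^2 / d, and the
     coefficient of the error energy is d itself. *)
  set (R := fun t => h * sum_f_R0 (fun j => defect_power p N e j t) N).
  assert (HRe : forall t, 0 < t ->
    R t <= decay omega t * (energy_ORFD p N e t + C1 * h ^ 4)).
  { intros t Ht.
    pose proof (exp_pos (- (omega / 2) * t)) as Pd; fold (decay omega t) in Pd.
    set (d := decay omega t) in *.
    (* The integral of the density is twice the energy, whence the factor 2, and exp(- omega t) =
       d^2. *)
    assert (Q : h * sum_f_R0 (fun j => defect_density p N e j t) N <= 2 * C1 * h ^ 4 * d ^ 2).
    { apply Rle_trans with (h * sum_f_R0 (fun j => RInt (fun x => density_at p y3 x t)
        (node p N j) (node p N (S j)) * (K * h ^ 3)) N).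
      - apply Rmult_le_compat_l; [lra|]; apply sum_Rle; intros j Hj.
        replace (defect_density p N e j t) with (defect_density p N Y j t).
        2:{ destruct (Se j t Hj (Rlt_le _ _ Ht)) as (S1 & S2 & S3 & S4).
            unfold defect_density; now rewrite S1, S2, S3, S4. }
        unfold Y; rewrite (nodal_defect_density p y y0 y1) by (trivial; lra).
        pose proof (node_segment p N j HL ltac:(lia)) as [Sj _].
        pose proof (node_segment p N (S j) HL ltac:(lia)) as [_ Sj'].
        pose proof (node_S p N j) as En; fold h in En.
        eapply Rle_trans; [apply (Hres y0 y1 y2 y3 y4); trivial; lra|].
        replace (node p N (S j) - node p N j) with h by lra; lra.
      - rewrite <- scal_sum, sum_RInt_nodes, node_last.
        2:{ intros x; apply (continuous_2d_slice_x (density_at p y3)).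
            now apply continuous_2d_density with y4. }
        pose proof (Hdec y3 y4 W3 t (Rlt_le _ _ Ht)) as B; fold E3 in B.
        rewrite energy_density in B.
        replace (exp (- omega * t)) with (d ^ 2) in B.
        2:{ unfold d, decay; simpl; rewrite Rmult_1_r, <- exp_plus; f_equal; field. }
        set (I := RInt _ _ _) in *.
        replace (h * (K * h ^ 3 * I)) with (2 * (K * h ^ 4) * (/ 2 * I)) by field.
        replace (2 * C1 * h ^ 4 * d ^ 2) with (2 * (K * h ^ 4) * (3 * d ^ 2 * E3))
          by (unfold C1; ring).
        apply Rmult_le_compat_l; trivial.
        apply Rmult_le_pos; [lra|]; apply Rmult_le_pos; lra. }
    apply Rle_trans with (h * sum_f_R0 (fun j => / (2 * d) * defect_density p N e j t
      + d / 2 * grid_density p e j t) N).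
    { apply Rmult_le_compat_l; [lra|]; apply sum_Rle; intros; now apply defect_power_le. }
    rewrite plus_sum, energy_ORFD_density; fold h.
    replace (sum_f_R0 (fun j => / (2 * d) * defect_density p N e j t) N) with
      (/ (2 * d) * sum_f_R0 (fun j => defect_density p N e j t) N)
      by (rewrite scal_sum; apply sum_eq; intros; ring).
    replace (sum_f_R0 (fun j => d / 2 * grid_density p e j t) N) with
      (d / 2 * sum_f_R0 (fun j => grid_density p e j t) N)
      by (rewrite scal_sum; apply sum_eq; intros; ring).
    assert (Hd2 : 0 < / (2 * d)) by (apply Rinv_0_lt_compat; lra).
    apply (Rmult_le_compat_l (/ (2 * d))) in Q; [|lra].
    replace (/ (2 * d) * (2 * C1 * h ^ 4 * d ^ 2)) with (C1 * h ^ 4 * d) in Q by (field; lra).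
    lra. }
  assert (He0 : energy_ORFD p N e 0 = 0).
  { rewrite energy_ORFD_density, (sum_eq _ (fun _ => 0) N).
    - rewrite sum_cte; ring.
    - intros j Hj; destruct (Ie j ltac:(lia)) as (I1 & I2 & I3 & I4),
        (Ie (S j) ltac:(lia)) as (J1 & J2 & J3 & J4).
      unfold grid_density, density, half; rewrite I1, I2, I3, I4, J1, J2, J3, J4; field. }
  assert (Hpow : forall t, 0 <= grid_power p N e t).
  { intros t; unfold grid_power; destruct Hp as [_ _ _ _ _ Hk1 Hk2].
    pose proof (pow2_ge_0 (w1 e (S N) t)); pose proof (pow2_ge_0 (w2 e (S N) t)); nra. }
  pose proof (fun t => energy_ORFD_nonneg p N e Hp t) as HEe.
  pose proof (energy_ORFD_right_continuous p N e Ge) as Ce.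
  pose proof (is_derive_energy_ORFD p N e Hp Ge Be) as De.
  (* Gronwall with integrating factor exp(- [decay_primitive]): the derivative of the error energy
     plus C1 h^4 is at most [decay] times itself, the boundary dissipation having a favourable
     sign. *)
  assert (HEe' : forall t, 0 <= t -> energy_ORFD p N e t + C1 * h ^ 4 <= C * h ^ 4).
  { intros t Ht.
    assert (M : (energy_ORFD p N e t + C1 * h ^ 4) * exp (- decay_primitive omega t)
      <= (energy_ORFD p N e 0 + C1 * h ^ 4) * exp (- decay_primitive omega 0)).
    { apply (nonincreasing_half_line
        (fun t => (energy_ORFD p N e t + C1 * h ^ 4) * exp (- decay_primitive omega t))
        (fun t => exp (- decay_primitive omega t) *
          ((- grid_power p N e t + R t)
            - decay omega t * (energy_ORFD p N e t + C1 * h ^ 4)))); trivial.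
      - apply right_continuous_mult.
        + apply right_continuous_plus; trivial; apply right_continuous_const.
        + apply continuous_right_continuous.
          apply (ex_derive_continuous (K := R_AbsRing) (V := R_NormedModule)).
          pose proof (is_derive_decay_primitive omega 0 Hom).
          auto_derive; eexists; eassumption.
      - intros s Hs.
        pose proof (De s Hs) as De'; fold h in De'; change (h * sum_f_R0 _ N) with (R s) in De'.
        pose proof (is_derive_decay_primitive omega s Hom).
        auto_derive; [repeat split; eexists; eassumption|].
        rewrite_derive; ring.
      - intros s Hs; specialize (HRe s Hs); specialize (Hpow s).
        pose proof (exp_pos (- decay_primitive omega s)); nra. }
    rewrite He0, decay_primitive_0, Ropp_0, exp_0, Rplus_0_l, Rmult_1_r in M.
    pose proof (exp_pos (decay_primitive omega t)) as P.
    apply (Rmult_le_compat_r (exp (decay_primitive omega t))) in M; [|lra].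
    rewrite Rmult_assoc, <- exp_plus, Rplus_opp_l, exp_0, Rmult_1_r in M.
    eapply Rle_trans; [exact M|].
    unfold C; replace (C1 * exp (2 / omega) * h ^ 4) with (C1 * h ^ 4 * exp (2 / omega)) by ring.
    apply Rmult_le_compat_l; [apply Rmult_le_pos; lra|].
    destruct (decay_primitive_le omega t Hom) as [Hlt|Heq];
      [left; now apply exp_increasing | right; now f_equal]. }
  intros lambda t Hl Ht.
  rewrite !(energy_clamp p y y0) by (trivial; lra).
  set (Ey := energy p y0); set (Ez := energy_ORFD p N z); set (Ee := energy_ORFD p N e) in *.
  assert (Hl' : 0 < / lambda) by now apply Rinv_0_lt_compat.
  pose proof (energy_nonneg p y0 y1 Hp W0 t) as HEy; fold Ey in HEy.
  assert (Dz : forall s, 0 < s -> is_derive Ez s (- grid_power p N z s)).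
  { intros s Hs; pose proof (is_derive_energy_ORFD p N z Hp Gz Bz s Hs) as D.
    replace (sum_f_R0 (fun j => defect_power p N z j s) N) with 0 in D.
    - now rewrite Rmult_0_r, Rplus_0_r in D.
    - rewrite (sum_eq _ (fun _ => 0) N); [rewrite sum_cte; ring|].
      intros j Hj; destruct (Sz j s Hj (Rlt_le _ _ Hs)) as (Z1 & Z2 & Z3 & Z4).
      unfold defect_power, density'; rewrite Z1, Z2, Z3, Z4; unfold Rdiv; ring. }
  (* The two signs give the two halves of the absolute value. *)
  assert (Hsigned : forall sg, sg = 1 \/ sg = -1 ->
    sg * (Ez t - Ey t) <= sg * (Ez 0 - Ey 0) + lambda * Ey 0
      + (/ lambda + 1) * (C * h ^ 4 * decay_primitive omega t)).
  { intros sg Hsg.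
    (* This functional is nonincreasing: the dissipation of lambda E and of (1 / lambda + 1) times
       the error energy pays for the difference of the two boundary powers, and C h^4 [decay] pays
       for the residual power. The terms at time t other than the signed difference are then bounded
       below. *)
    assert (M : sg * (Ez t - Ey t) + lambda * Ey t
        + (/ lambda + 1) * (Ee t - C * h ^ 4 * decay_primitive omega t)
      <= sg * (Ez 0 - Ey 0) + lambda * Ey 0
        + (/ lambda + 1) * (Ee 0 - C * h ^ 4 * decay_primitive omega 0)).
    { apply (nonincreasing_half_line (fun t => sg * (Ez t - Ey t) + lambda * Ey t
        + (/ lambda + 1) * (Ee t - C * h ^ 4 * decay_primitive omega t))
        (fun t => sg * (boundary_power p y0 t - grid_power p N z t)
          - lambda * boundary_power p y0 t
          + (/ lambda + 1) * (- grid_power p N e t + R t - C * h ^ 4 * decay omega t))); trivial.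
      - assert (Cc : forall c f, right_continuous f -> right_continuous (fun t => c * f t)).
        { intros c f Hf; apply right_continuous_mult; trivial; apply right_continuous_const. }
        assert (Cy : right_continuous Ey) by now apply energy_right_continuous with y1.
        assert (Cz : right_continuous Ez) by now apply energy_ORFD_right_continuous.
        pose proof (decay_primitive_right_continuous omega Hom).
        apply right_continuous_plus; [apply right_continuous_plus|].
        + apply Cc, right_continuous_minus; trivial.
        + now apply Cc.
        + apply Cc, right_continuous_minus; trivial; now apply Cc.
      - intros s Hs.
        pose proof (Dz s Hs); pose proof (is_derive_energy p y0 y1 Hp W0 s Hs) as Dy; fold Ey in Dy.
        pose proof (De s Hs) as De'; fold h in De'; change (h * sum_f_R0 _ N) with (R s) in De'.
        pose proof (is_derive_decay_primitive omega s Hom).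
        auto_derive; [repeat split; eexists; eassumption|].
        rewrite_derive; ring.
      - intros s Hs; specialize (HRe s Hs).
        assert (HR' : R s <= C * h ^ 4 * decay omega s).
        { eapply Rle_trans; [exact HRe|]; rewrite (Rmult_comm (C * h ^ 4)).
          apply Rmult_le_compat_l; [left; apply exp_pos | apply HEe'; lra]. }
        assert (SL : segment (L p) (L p)) by (unfold segment; lra).
        (* The exact and discrete traces at x = L differ by the trace of the error, whose weighted
           squares are exactly its boundary dissipation. *)
        assert (B : Rabs (boundary_power p y0 s - grid_power p N z s)
          <= lambda * boundary_power p y0 s + (/ lambda + 1) * grid_power p N e s).
        { destruct Hclamp as (_ & _ & K1 & K2).
          unfold boundary_power, grid_power, e, Y, grid_minus, nodal; cbn [w1 w2].
          rewrite node_last, (clamp_of_eq p _ _ _ s K1), (clamp_of_eq p _ _ _ s K2) by (trivial; lra).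
          pose proof (sqr_diff_le lambda (w1 y0 (L p) s) (w1 z (S N) s) Hl) as B1.
          pose proof (sqr_diff_le lambda (w2 y0 (L p) s) (w2 z (S N) s) Hl) as B2.
          pose proof (k1_pos p Hp) as Hk1; pose proof (k2_pos p Hp) as Hk2.
          apply (Rmult_le_compat_l (k1 p)) in B1; [|lra].
          apply (Rmult_le_compat_l (k2 p)) in B2; [|lra].
          match goal with |- Rabs ?x <= _ => replace x with
            (k1 p * (w1 y0 (L p) s ^ 2 - w1 z (S N) s ^ 2)
             + k2 p * (w2 y0 (L p) s ^ 2 - w2 z (S N) s ^ 2)) by ring end.
          eapply Rle_trans; [apply Rabs_triang|].
          rewrite !Rabs_mult, (Rabs_right (k1 p)), (Rabs_right (k2 p)) by lra.
          lra. }
        apply Rabs_le_between in B.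
        assert (0 <= (/ lambda + 1) * (C * h ^ 4 * decay omega s - R s))
          by (apply Rmult_le_pos; lra).
        destruct Hsg as [-> | ->]; lra. }
    rewrite He0, decay_primitive_0 in M.
    pose proof (HEe t) as He1.
    assert (0 <= lambda * Ey t) by (apply Rmult_le_pos; lra).
    assert (0 <= (/ lambda + 1) * Ee t) by (apply Rmult_le_pos; lra).
    lra. }
  pose proof (Hsigned 1 (or_introl eq_refl)) as B1.
  pose proof (Hsigned (-1) (or_intror eq_refl)) as B2.
  fold (Ez 0) (Ez t) in *.
  pose proof (Rle_abs (Ez 0 - Ey 0)); pose proof (Rle_abs (- (Ez 0 - Ey 0))) as A2.
  rewrite Rabs_Ropp in A2.
  apply Rabs_le; split; lra.
Qed.

(** * Choice of lambda and the two conclusions *)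

Lemma Rpower_3_2 (h : R) : 0 < h -> h ^ 2 = Rpower h (3 / 2) * sqrt h.
Proof.
  intros H; rewrite <- Rpower_sqrt by exact H.
  rewrite <- Rpower_plus, <- Rpower_pow by exact H.
  f_equal; simpl; field.
Qed.

Lemma mesh_sqr_small (p : params) (C eps : R) : 0 < L p -> 0 <= C -> 0 < eps ->
  eventually (fun N => C * mesh p N ^ 2 < eps).
Proof.
  intros HL HC He.
  destruct (INR_unbounded (C * L p ^ 2 / eps)) as [n Hn].
  exists n; intros N HN.
  assert (H1 : INR n <= INR (S N)) by (apply le_INR; lia).
  assert (H2 : 1 <= INR (S N)) by (rewrite S_INR; pose proof (pos_INR N); lra).
  unfold mesh; set (m := INR (S N)) in *.
  replace (C * (L p / m) ^ 2) with (C * L p ^ 2 / eps * (eps / m ^ 2)) by (field; lra).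
  assert (0 < m ^ 2) by (apply pow_lt; lra).
  assert (0 < eps / m ^ 2) by now apply Rdiv_lt_0_compat.
  apply Rlt_le_trans with (m * (eps / m ^ 2)); [apply Rmult_lt_compat_r; lra|].
  replace (m * (eps / m ^ 2)) with (eps / m) by (field; lra).
  apply Rle_div_l; nra.
Qed.

Theorem theorem3p10 :
  forall (p : params)
    (hL : 0 < L p) (hrho : 0 < rho p) (hmu : 0 < mu p)
    (halpha : 0 < alpha p) (hbeta : 0 < beta p) (hgamma : 0 < gamma p)
    (halpha1 : 0 < alpha1 p) (hk1 : 0 < k1 p) (hk2 : 0 < k2 p)
    (v0 v1 p0 p1 : R -> R)
    (y : fields (R -> R -> R)) (z : nat -> fields (nat -> R -> R))
    (hreg : regular p y)
    (hP : solves_PDE p v0 v1 p0 p1 y)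
    (hS : forall N : nat, solves_scheme p v0 v1 p0 p1 N (z N)),
  (forall N : nat,
     solves_error_system p N (nodal p N y) (grid_minus (nodal p N y) (z N))) /\
  (is_lim_seq (fun N : nat => energy_ORFD p N (z N) 0) (energy p y 0) ->
     (exists c : R, 0 < c /\
        forall (N : nat) (t : R), 0 <= t ->
          Rabs (energy_ORFD p N (z N) t - energy p y t)
          <= Rabs (energy_ORFD p N (z N) 0 - energy p y 0)
             + c * Rpower (mesh p N) (3 / 2) * sqrt t) /\
     (forall eps : posreal,
        eventually (fun N : nat =>
          Rbar_lt
            (sup_norm nonneg_time
               (fun t => energy_ORFD p N (z N) t - energy p y t))
            eps))).
Proof.
  intros p hL hrho hmu halpha hbeta hgamma halpha1 hk1 hk2 v0 v1 p0 p1 y z hreg hP hS.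
  assert (Hp : positive_params p) by now constructor.
  destruct (energy_difference p v0 v1 p0 p1 y Hp hreg hP) as (omega & C & Hom & HC & HE & Hdiff).
  split; [intros N; apply (Hdiff N (z N) (hS N))|].
  (* Chosen so that [decay_primitive omega t] <= C3 min(t, 1) in both regimes t <= 1 and t > 1. *)
  set (C3 := 1 + 2 / omega).
  assert (Hom' : 0 < 2 / omega) by (apply Rdiv_lt_0_compat; lra).
  (* With l = lambda = h^2 sqrt(min(t, 1)), the last term of the estimate is at most (1 / l + 1) C
     C3 l^2 = C C3 (l + l^2) <= C C3 (1 + L^2) l, because l <= L^2. The final 1 keeps the constant
     positive. *)
  set (C4 := energy p y 0 + C * C3 * (1 + L p ^ 2) + 1).
  assert (HCC : 0 <= C * C3) by (apply Rmult_le_pos; unfold C3; lra).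
  assert (HC4 : 0 < C4).
  { pose proof (pow2_ge_0 (L p)); unfold C4.
    pose proof (Rmult_le_pos (C * C3) (1 + L p ^ 2) HCC ltac:(lra)); lra. }
  (* Time 0 is excluded because lambda would vanish there; both conclusions are immediate at t =
     0. *)
  assert (Hbound : forall N t, 0 < t ->
    Rabs (energy_ORFD p N (z N) t - energy p y t)
      <= Rabs (energy_ORFD p N (z N) 0 - energy p y 0)
         + C4 * (mesh p N ^ 2 * sqrt (Rmin t 1))).
  { intros N t Ht.
    pose proof (mesh_pos p N hL) as Hh; pose proof (mesh_le p N hL) as Hh'.
    set (h := mesh p N) in *.
    set (tau := Rmin t 1).
    assert (Htau : 0 < tau) by (apply Rmin_pos; lra).
    assert (Hs : 0 < sqrt tau) by now apply sqrt_lt_R0.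
    assert (Hss : sqrt tau * sqrt tau = tau) by (apply sqrt_sqrt; lra).
    assert (Hs1 : sqrt tau <= 1).
    { rewrite <- sqrt_1; apply sqrt_le_1_alt, Rmin_r. }
    assert (Hh2 : 0 < h ^ 2) by now apply pow_lt.
    assert (HhL : h ^ 2 <= L p ^ 2) by (apply pow_incr; lra).
    assert (Hl : 0 < h ^ 2 * sqrt tau) by now apply Rmult_lt_0_compat.
    assert (HPsi : decay_primitive omega t <= C3 * tau).
    { unfold tau, C3, Rmin; destruct (Rle_dec t 1).
      - pose proof (decay_primitive_le_id omega t Hom); nra.
      - pose proof (decay_primitive_le omega t Hom); lra. }
    pose proof (proj2 (Hdiff N (z N) (hS N)) _ t Hl (Rlt_le _ _ Ht)) as B; fold h in B.
    eapply Rle_trans; [exact B|]; rewrite Rplus_assoc; apply Rplus_le_compat_l.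
    assert (Q : C * h ^ 4 * decay_primitive omega t <= C * C3 * (h ^ 2 * sqrt tau) ^ 2).
    { replace (C * C3 * (h ^ 2 * sqrt tau) ^ 2) with (C * h ^ 4 * (C3 * (sqrt tau * sqrt tau)))
        by ring.
      rewrite Hss; apply Rmult_le_compat_l; trivial.
      apply Rmult_le_pos; trivial; left; now apply pow_lt. }
    set (l := h ^ 2 * sqrt tau) in *.
    assert (Hil : 0 < / l) by now apply Rinv_0_lt_compat.
    apply (Rmult_le_compat_l (/ l + 1)) in Q; [|lra].
    replace ((/ l + 1) * (C * C3 * l ^ 2)) with (C * C3 * (l + l ^ 2)) in Q by (field; lra).
    assert (Hl2 : l ^ 2 <= L p ^ 2 * l).
    { assert (l <= L p ^ 2) by (unfold l; nra). nra. }
    assert (C * C3 * (l + l ^ 2) <= C * C3 * ((1 + L p ^ 2) * l))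
      by (apply Rmult_le_compat_l; lra).
    unfold C4; lra. }
  intros Hlim; split.
  (* h^2 = h^(3/2) sqrt h <= h^(3/2) sqrt L, and min(t, 1) <= t. *)
  - exists (C4 * sqrt (L p)); split.
    { apply Rmult_lt_0_compat; trivial; now apply sqrt_lt_R0. }
    intros N t Ht.
    destruct (Rle_lt_or_eq_dec _ _ Ht) as [Ht'|<-].
    2:{ rewrite sqrt_0; lra. }
    eapply Rle_trans; [now apply Hbound|]; apply Rplus_le_compat_l.
    pose proof (mesh_pos p N hL) as Hh; pose proof (mesh_le p N hL) as Hh'.
    rewrite Rpower_3_2 by exact Hh.
    set (q := Rpower (mesh p N) (3 / 2)).
    assert (Hq : 0 < q) by apply exp_pos.
    replace (C4 * sqrt (L p) * q * sqrt t) with (C4 * (q * sqrt (L p) * sqrt t)) by ring.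
    apply Rmult_le_compat_l; [lra|].
    apply Rmult_le_compat; try apply sqrt_pos.
    + apply Rmult_le_pos; [lra | apply sqrt_pos].
    + apply Rmult_le_compat_l; [lra|]; now apply sqrt_le_1_alt.
    + apply sqrt_le_1_alt, Rmin_l.
  - intros eps.
    (* Two quarters bound the supremum by eps / 2, which leaves room for the strict inequality that
       a supremum of strictly smaller values would not give. *)
    assert (He : 0 < eps / 4) by (pose proof (cond_pos eps); lra).
    pose proof (proj2 (is_lim_seq_spec _ _) Hlim (mkposreal _ He)) as H1; simpl in H1.
    pose proof (mesh_sqr_small p C4 (eps / 4) hL (Rlt_le _ _ HC4) He) as H2.
    generalize (filter_and _ _ H1 H2); apply filter_imp; intros N [A1 A2].
    assert (Hle : Rbar_le (sup_norm nonneg_time (fun t => energy_ORFD p N (z N) t - energy p y t))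
      (eps / 2)).
    { apply Lub_Rbar_correct; intros x [t [Ht ->]]; simpl.
      destruct (Rle_lt_or_eq_dec _ _ Ht) as [Ht'|<-]; [|lra].
      eapply Rle_trans; [now apply Hbound|].
      assert (sqrt (Rmin t 1) <= 1) by (rewrite <- sqrt_1 at 2; apply sqrt_le_1_alt, Rmin_r).
      assert (C4 * (mesh p N ^ 2 * sqrt (Rmin t 1)) <= C4 * mesh p N ^ 2).
      { apply Rmult_le_compat_l; [lra|].
        pose proof (pow2_ge_0 (mesh p N)); nra. }
      lra. }
    eapply Rbar_le_lt_trans; [exact Hle|]; simpl; pose proof (cond_pos eps); lra.
Qed.
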